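(* For every positive integer $n$ there exist real parameters $(c_n,b_n)$ such that the smooth solution of $$(1-\rho^2)\,U''(\rho)+\Big(\frac{2}{\rho}-4\rho\Big)U'(\rho)-2U(\rho)+U(\rho)^3=0$$ determined at $\rho=0$ by $U(0)=c_n$ coincides with the smooth solution determined at $\rho=1$ by $U(1)=b_n$, and this common solution is in the $n$-th nodal class. That is, there is a solution $U$ which is smooth on the closed interval $[0,1]$, satisfies $U(0)=c_n$ and $U(1)=b_n$, and has exactly $n$ zeros in $(0,1)$.
   Context: The equation is the ODE satisfied by the profile $U(\rho)$ of spherically symmetric self-similar solutions $u(t,r)=(T-t)^{-1}U(\rho)$, $\rho=r/(T-t)$, of the focusing cubic wave equation $\partial_{tt}u-\partial_{rr}u-\frac{2}{r}\partial_r u-u^3=0$ in three space dimensions; the interval $0\le\rho\le 1$ corresponds to the closed past light cone of the singular point $(t,r)=(T,0)$. The points $\rho=0$ and $\rho=1$ are singular points of the ODE. For each $c\in\mathbb{R}$ there is a unique solution that is smooth at $\rho=0$ with $U(0)=c$ (necessarily $U'(0)=0$), and it is defined for $0\le\rho<1$. For each $b\in\mathbb{R}$ there is a unique solution that is smooth at $\rho=1$ with $U(1)=b$ (necessarily $U'(1)=\frac{b}{2}(b^2-2)$), and it is defined for $0<\rho\le1$. A solution smooth on $[0,1]$ is in the $n$-th nodal class if it has exactly $n$ zeros in $(0,1)$. Equivalently, $f(x)=\tanh(x)\,U(\tanh x)$, which solves $f''+f^3/\sinh^2(x)=0$ on $x>0$, has exactly $n$ zeros in $(0,\infty)$. *)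

(* Defs.v *)
From Stdlib Require Export Reals List.
From Coquelicot Require Export Coquelicot.
Open Scope R_scope.

(* Derivative of [f] at [x] relative to [D]: one-sided at an end point of an
   interval [D], the usual [is_derive f x l] at an interior point. *)
Definition is_derive_within (D : R -> Prop) (f : R -> R) (x l : R) : Prop :=
  filterdiff f (within D (locally x)) (fun y => scal y l).

(* [V k] is the [k]-th derivative of [f] on [D]. *)
Definition derivatives_on (D : R -> Prop) (f : R -> R) (V : nat -> R -> R) : Prop :=
  (forall x, D x -> V 0%nat x = f x) /\
  (forall k x, D x -> is_derive_within D (V k) x (V (S k) x)).

Definition smooth_on (D : R -> Prop) (f : R -> R) : Prop :=
  exists V, derivatives_on D f V.

(* The point [rho = 0] is excluded because of the coefficient [2 / rho];
   the equation is imposed at the other singular point [rho = 1]. *)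
Definition solves_profile_ode (D : R -> Prop) (U : R -> R) : Prop :=
  exists U' U'' : R -> R,
    (forall rho, D rho -> is_derive_within D U rho (U' rho)) /\
    (forall rho, D rho -> is_derive_within D U' rho (U'' rho)) /\
    (forall rho, D rho -> rho <> 0 ->
       (1 - rho ^ 2) * U'' rho + (2 / rho - 4 * rho) * U' rho
         - 2 * U rho + U rho ^ 3 = 0).

Definition nodal_class (n : nat) (U : R -> R) : Prop :=
  exists zeros : list R,
    NoDup zeros /\ length zeros = n /\
    (forall rho, In rho zeros <-> 0 < rho < 1 /\ U rho = 0).

(* Main.v *)
Require Import Defs.
From Stdlib Require Import Reals List ZArith Lra Psatz ClassicalEpsilon.
From Coquelicot Require Import Coquelicot.
Open Scope R_scope.

(** With [x = artanh rho], [f = rho U] and [p = df/dx], the equation becomes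
    [f' = p], [p' = - f^3 / sinh^2 x] on [x > 0], and solutions regular at
    [rho = 0] are those with [f 0 = 0], [p 0 = c].  The parameter [c] is found
    by shooting.

    Every solution with [c > 0] is global ([profile_exists]), and the polar
    angle of [(f, p)] starts at 0 and increases strictly, so that the positive
    zeros of [f] are the points where it equals a positive multiple of [PI]
    ([polar], [angle_increasing]).  At a fixed abscissa the angle depends
    continuously on [c] ([angle_lipschitz]).  For [c <= 1/10] there is no
    positive zero ([small_data_positive]), and the number of zeros tends to
    infinity with [c] ([many_zeros]).

    Let [c] be the supremum of the parameters at least 1/10 whose solution has
    at most [n] zeros.  The weight [1 / sinh^2 x] is so small for large [x] that
    at most one zero can be created near infinity ([miss_next]), and none at all
    if the slope [p] of the limiting solution stays away from 0
    ([escape_stable]).  Hence the critical solution has exactly [n] zeros and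
    its slope tends to 0 ([critical_parameter], [slope_vanishes]); its decay is
    then fast enough for [f] to have a limit [b] ([value_converges]).

    In the variable [rho] the condition [p -> 0] says that the flux
    [Q = rho^2 (1 - rho^2) U'] vanishes at [rho = 1] as it does at [rho = 0].
    As [Q' = - rho^2 (U^3 - 2 U)], the slope [U'] is an explicit combination of
    averages of [U^3 - 2 U] and [rho^2 (U^3 - 2 U)], and averaging preserves
    every class [C^k] of the closed interval ([Ck_average]).  So [U] in [C^k]
    gives [U'] in [C^k], and [U] is smooth up to both singular points
    ([Ck_all]). *)

(** * Calculus on an interval and the weight 1 / sinh^2 *)

Lemma continuous_of_derive (f : R -> R) (x l : R) :
  is_derive f x l -> continuous f x.
Proof. intros H. apply (ex_derive_continuous (V := R_NormedModule)). now exists l. Qed.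

Lemma le_of_derive (f df : R -> R) (a b : R) :
  a <= b ->
  (forall x, a < x < b -> is_derive f x (df x)) ->
  (forall x, a <= x <= b -> continuous f x) ->
  (forall x, a < x < b -> 0 <= df x) ->
  f a <= f b.
Proof.
  intros Hab Hd Hc Hp.
  (* MVT_gen may return an end point, where df is arbitrary. *)
  set (g := fun x => if Rlt_dec a x then if Rlt_dec x b then df x else 0 else 0).
  destruct (MVT_gen f a b g) as [c [_ Hc2]].
  - rewrite Rmin_left, Rmax_right by lra. intros x Hx.
    unfold g. destruct (Rlt_dec a x); [|lra]. destruct (Rlt_dec x b); [|lra].
    now apply Hd.
  - rewrite Rmin_left, Rmax_right by lra. intros x Hx.
    apply continuity_pt_filterlim. now apply Hc.
  - assert (0 <= g c).
    { unfold g. destruct (Rlt_dec a c); [|lra]. destruct (Rlt_dec c b); [|lra].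
      apply Hp; lra. }
    nra.
Qed.

Lemma lt_of_derive (f df : R -> R) (a b : R) :
  a < b ->
  (forall x, a < x < b -> is_derive f x (df x)) ->
  (forall x, a <= x <= b -> continuous f x) ->
  (forall x, a < x < b -> 0 < df x) ->
  f a < f b.
Proof.
  intros Hab Hd Hc Hp.
  (* MVT_gen may return an end point, where df is arbitrary. *)
  set (g := fun x => if Rlt_dec a x then if Rlt_dec x b then df x else 1 else 1).
  destruct (MVT_gen f a b g) as [c [_ Hc2]].
  - rewrite Rmin_left, Rmax_right by lra. intros x Hx.
    unfold g. destruct (Rlt_dec a x); [|lra]. destruct (Rlt_dec x b); [|lra].
    now apply Hd.
  - rewrite Rmin_left, Rmax_right by lra. intros x Hx.
    apply continuity_pt_filterlim. now apply Hc.
  - assert (0 < g c).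
    { unfold g. destruct (Rlt_dec a c); [|lra]. destruct (Rlt_dec c b); [|lra].
      apply Hp; lra. }
    nra.
Qed.

Lemma abs_le_of_derive (f g df dg : R -> R) (a b : R) :
  a <= b ->
  (forall x, a < x < b -> is_derive f x (df x)) ->
  (forall x, a < x < b -> is_derive g x (dg x)) ->
  (forall x, a <= x <= b -> continuous f x) ->
  (forall x, a <= x <= b -> continuous g x) ->
  (forall x, a < x < b -> Rabs (df x) <= dg x) ->
  Rabs (f b - f a) <= g b - g a.
Proof.
  intros Hab Hf Hg Cf Cg H.
  assert (g a - f a <= g b - f b).
  { apply (le_of_derive (fun x => g x - f x) (fun x => dg x - df x)); trivial.
    - intros x Hx. apply (is_derive_minus g f x); auto.
    - intros x Hx. apply (continuous_minus g f x); auto.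
    - intros x Hx. specialize (H x Hx). apply Rabs_le_between in H. lra. }
  assert (g a + f a <= g b + f b).
  { apply (le_of_derive (fun x => g x + f x) (fun x => dg x + df x)); trivial.
    - intros x Hx. apply (is_derive_plus g f x); auto.
    - intros x Hx. apply (continuous_plus g f x); auto.
    - intros x Hx. specialize (H x Hx). apply Rabs_le_between in H. lra. }
  apply Rabs_le. lra.
Qed.

Lemma continuous_eps (f : R -> R) (x : R) :
  continuous f x <->
  forall eps, 0 < eps -> exists d, 0 < d /\
    forall y, Rabs (y - x) < d -> Rabs (f y - f x) < eps.
Proof.
  split.
  - intros H eps He.
    destruct (proj1 (filterlim_locally f (f x)) H (mkposreal eps He)) as [d Hd].
    exists d. split; [apply cond_pos|]. intros y Hy. exact (Hd y Hy).
  - intros H. apply filterlim_locally. intros eps.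
    destruct (H eps (cond_pos eps)) as [d [Hd Hy]].
    exists (mkposreal d Hd). intros y Hb. exact (Hy y Hb).
Qed.

(** Only an inequality for the derivative inside the interval is asked for, since
    the equation is singular at 0. *)
Lemma gronwall (D dD : R -> R) (K E X : R) :
  0 <= X -> 0 <= K -> 0 <= E ->
  (forall x, 0 < x < X -> is_derive D x (dD x)) ->
  (forall x, 0 <= x <= X -> continuous D x) ->
  (forall x, 0 < x < X -> dD x <= K * D x + E) ->
  D X <= (D 0 + E * X) * exp (K * X).
Proof.
  intros HX HK HE Hd Hc H.
  assert (Hmul : forall x, continuous (fun x => exp (- K * x)) x).
  { intros x. apply (continuous_of_derive _ x (- K * exp (- K * x))).
    auto_derive; trivial; ring. }
  assert (M : - (D 0 * exp (- K * 0) - E * 0) <= - (D X * exp (- K * X) - E * X)).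
  { apply (le_of_derive (fun x => - (D x * exp (- K * x) - E * x))
      (fun x => - ((dD x - K * D x) * exp (- K * x) - E))); trivial.
    - intros x Hx. specialize (Hd x Hx).
      assert (ex_derive D x) by now exists (dD x).
      auto_derive; trivial. replace (Derive (fun x0 : R => D x0) x) with (dD x). ring. symmetry. now apply is_derive_unique.
    - intros x Hx.
      apply (continuous_opp (fun x => D x * exp (- K * x) - E * x)).
      apply (continuous_minus (fun x => D x * exp (- K * x)) (fun x => E * x)).
      + apply (continuous_mult D (fun x => exp (- K * x))); auto.
      + apply (continuous_of_derive _ x E). auto_derive; trivial; ring.
    - intros x Hx. specialize (H x Hx).
      assert (0 < exp (- K * x)) by apply exp_pos.
      assert (exp (- K * x) <= 1).
      { rewrite <- exp_0.
        destruct (Req_dec (- K * x) 0) as [->|]; [lra|].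
        left. apply exp_increasing. nra. }
      nra. }
  rewrite Rmult_0_r, exp_0 in M.
  assert (Hx : exp (- K * X) * exp (K * X) = 1).
  { rewrite <- exp_plus, <- exp_0. f_equal. ring. }
  assert (0 < exp (K * X)) by apply exp_pos.
  replace (D X) with (D X * exp (- K * X) * exp (K * X)) by (rewrite Rmult_assoc, Hx; ring).
  apply Rmult_le_compat_r; lra.
Qed.

Definition csch2 (x : R) : R := / (sinh x) ^ 2.

Lemma is_derive_sinh x : is_derive sinh x (cosh x).
Proof. apply is_derive_Reals, derivable_pt_lim_sinh. Qed.
Lemma is_derive_cosh x : is_derive cosh x (sinh x).
Proof. apply is_derive_Reals, derivable_pt_lim_cosh. Qed.
Lemma continuous_sinh x : continuous sinh x.
Proof. exact (continuous_of_derive _ _ _ (is_derive_sinh x)). Qed.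
Lemma continuous_cosh x : continuous cosh x.
Proof. exact (continuous_of_derive _ _ _ (is_derive_cosh x)). Qed.

Lemma sinh_nonneg x : 0 <= x -> 0 <= sinh x.
Proof. intros [H|<-]; [apply sinh_lt in H|]; rewrite sinh_0 in *; lra. Qed.

Lemma cosh_ge x : 0 <= x -> 1 + x ^ 2 / 2 <= cosh x.
Proof.
  intros Hx.
  assert (S : forall y, 0 <= y -> y <= sinh y).
  { intros y Hy.
    assert (sinh 0 - 0 <= sinh y - y); [|rewrite sinh_0 in *; lra].
    apply (le_of_derive (fun x => sinh x - x) (fun x => cosh x - 1)); trivial.
    - intros z _. apply (is_derive_minus sinh (fun x => x)).
      apply is_derive_sinh. apply (is_derive_id z).
    - intros z _. apply (continuous_minus sinh (fun x => x)).
      apply continuous_sinh. apply continuous_id.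
    - intros z Hz.
      assert (cosh 0 <= cosh z); [|rewrite cosh_0 in *; lra].
      apply (le_of_derive cosh sinh); try lra; intros; auto using is_derive_cosh, continuous_cosh.
      apply sinh_nonneg; lra. }
  assert (cosh 0 - 0 ^ 2 / 2 <= cosh x - x ^ 2 / 2); [|rewrite cosh_0 in *; lra].
  apply (le_of_derive (fun x => cosh x - x ^ 2 / 2) (fun x => sinh x - x)); trivial.
  - intros z _. apply (is_derive_minus cosh (fun x => x ^ 2 / 2)).
    apply is_derive_cosh. auto_derive; trivial. field.
  - intros z _. apply (continuous_minus cosh (fun x => x ^ 2 / 2)).
    apply continuous_cosh. apply (continuous_of_derive _ z z). auto_derive; trivial. field.
  - intros z Hz. assert (z <= sinh z) by (apply S; lra). lra.
Qed.

Lemma sinh_ge x : 0 <= x -> x + x ^ 3 / 6 <= sinh x.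
Proof.
  intros Hx.
  assert (sinh 0 - (0 + 0 ^ 3 / 6) <= sinh x - (x + x ^ 3 / 6)); [|rewrite sinh_0 in *; lra].
  apply (le_of_derive (fun x => sinh x - (x + x ^ 3 / 6))
           (fun x => cosh x - (1 + x ^ 2 / 2))); trivial.
  - intros z _. apply (is_derive_minus sinh (fun x => x + x ^ 3 / 6)).
    apply is_derive_sinh. auto_derive; trivial. field.
  - intros z _. apply (continuous_minus sinh (fun x => x + x ^ 3 / 6)).
    apply continuous_sinh.
    apply (continuous_of_derive _ z (1 + z ^ 2 / 2)). auto_derive; trivial. field.
  - intros z Hz. assert (1 + z ^ 2 / 2 <= cosh z) by (apply cosh_ge; lra). lra.
Qed.

Lemma sinh_le x : 0 <= x <= 1 -> sinh x <= 2 * x.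
Proof.
  intros Hx.
  assert (2 * 0 - sinh 0 <= 2 * x - sinh x); [|rewrite sinh_0 in *; lra].
  apply (le_of_derive (fun x => 2 * x - sinh x) (fun x => 2 - cosh x)); try tauto.
  - intros z _. apply (is_derive_minus (fun x => 2 * x) sinh).
    auto_derive; trivial; ring. apply is_derive_sinh.
  - intros z _. apply (continuous_minus (fun x => 2 * x) sinh).
    apply (continuous_of_derive _ z 2). auto_derive; trivial; ring. apply continuous_sinh.
  - intros z Hz. unfold cosh.
    assert (exp z < 3). { apply Rlt_le_trans with (exp 1). apply exp_increasing; lra. apply exp_le_3. }
    assert (exp (- z) < 1). { rewrite <- exp_0. apply exp_increasing; lra. }
    lra.
Qed.

Lemma sinh_pos x : 0 < x -> 0 < sinh x.
Proof. intros H. rewrite <- sinh_0. now apply sinh_lt. Qed.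

Lemma sinh_neq0 x : x <> 0 -> sinh x <> 0.
Proof.
  intros H. destruct (Rdichotomy _ _ H) as [H1|H1]; apply sinh_lt in H1;
  rewrite sinh_0 in H1; lra.
Qed.

Lemma csch2_pos x : 0 < x -> 0 < csch2 x.
Proof. intros H. apply Rinv_0_lt_compat, pow_lt, sinh_pos, H. Qed.

Lemma csch2_mul_sinh x : 0 < x -> csch2 x * sinh x ^ 2 = 1.
Proof. intros H. apply sinh_pos in H. unfold csch2. field. lra. Qed.

(** The two upper bounds come from [sinh x >= x + x^3/6]: the first controls the
    singularity at 0, the second makes [x^3 / sinh^2 x] integrable at infinity. *)
Lemma csch2_le_inv_sqr x : 0 < x -> csch2 x * x ^ 2 <= 1.
Proof.
  intros H. rewrite <- (csch2_mul_sinh x H). apply Rmult_le_compat_l.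
  now apply Rlt_le, csch2_pos.
  assert (x + x ^ 3 / 6 <= sinh x) by (apply sinh_ge; lra).
  assert (0 < x ^ 3) by now apply pow_lt.
  apply pow_incr. lra.
Qed.

Lemma csch2_le_inv_pow6 x : 0 < x -> csch2 x * x ^ 6 <= 36.
Proof.
  intros H.
  assert (csch2 x * (x ^ 3 / 6) ^ 2 <= 1).
  { rewrite <- (csch2_mul_sinh x H). apply Rmult_le_compat_l.
    now apply Rlt_le, csch2_pos.
    assert (x + x ^ 3 / 6 <= sinh x) by (apply sinh_ge; lra).
    assert (0 < x ^ 3) by now apply pow_lt.
    apply pow_incr. lra. }
  replace (csch2 x * (x ^ 3 / 6) ^ 2) with (csch2 x * x ^ 6 / 36) in H0 by field. lra.
Qed.

(** Near 0 the weight is comparable with the scale-invariant [1 / x^2], which is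
    what makes solutions with large initial slope oscillate. *)
Lemma csch2_ge_inv_sqr x : 0 < x <= 1 -> 1 <= 4 * (csch2 x * x ^ 2).
Proof.
  intros H.
  assert (P := csch2_pos x (proj1 H)).
  rewrite <- (csch2_mul_sinh x (proj1 H)).
  assert (sinh x <= 2 * x) by (apply sinh_le; lra).
  assert (0 < sinh x) by (apply sinh_pos; lra).
  assert (sinh x ^ 2 <= 4 * x ^ 2) by nra.
  nra.
Qed.

Definition dcsch2 (x : R) : R := - 2 * cosh x / sinh x ^ 3.

Lemma is_derive_csch2 x : x <> 0 -> is_derive csch2 x (dcsch2 x).
Proof.
  intros H. assert (S := sinh_neq0 x H). unfold csch2, dcsch2.
  auto_derive.
  - apply Rmult_integral_contrapositive_currified; lra.
  - field. exact S.
Qed.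

Lemma dcsch2_nonpos x : 0 < x -> dcsch2 x <= 0.
Proof.
  intros H. unfold dcsch2.
  assert (0 < / sinh x ^ 3) by (apply Rinv_0_lt_compat, pow_lt, sinh_pos, H).
  assert (1 + x ^ 2 / 2 <= cosh x) by (apply cosh_ge; lra).
  unfold Rdiv. nra.
Qed.

Lemma continuous_csch2 x : x <> 0 -> continuous csch2 x.
Proof. intros H. exact (continuous_of_derive _ _ _ (is_derive_csch2 x H)). Qed.

(** * Picard iteration *)

Lemma is_derive_RInt0 (g : R -> R) (x : R) :
  (forall y, continuous g y) -> is_derive (fun y => RInt g 0 y) x (g x).
Proof.
  intros Hg. apply (is_derive_RInt g _ 0).
  - apply filter_forall. intros y. apply (RInt_correct (V := R_CompleteNormedModule)).
    apply (ex_RInt_continuous (V := R_CompleteNormedModule)). auto.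
  - apply Hg.
Qed.

Lemma continuous_RInt0 (g : R -> R) (x : R) :
  (forall y, continuous g y) -> continuous (fun y => RInt g 0 y) x.
Proof. intros Hg. exact (continuous_of_derive _ _ _ (is_derive_RInt0 g x Hg)). Qed.

Lemma le_of_geometric (a C : R) : (forall n : nat, a <= C * (/ 2) ^ n) -> a <= 0.
Proof.
  intros H.
  assert (L : is_lim_seq (fun n => C * (/ 2) ^ n) (C * 0)).
  { apply (is_lim_seq_scal_l _ C 0). apply is_lim_seq_geom. rewrite Rabs_pos_eq; lra. }
  rewrite Rmult_0_r in L.
  exact (is_lim_seq_le (fun _ => a) _ a 0 H (is_lim_seq_const a) L).
Qed.

Section Picard.
Variables (N : R -> R -> R) (L B c : R).
Hypothesis L_pos : 0 < L.
Hypothesis N_lip : forall s y z, Rabs (N s y - N s z) <= L * Rabs (y - z).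
Hypothesis N_bound : forall s y, Rabs (N s y) <= B.
Hypothesis N_nonpos : forall s y, s <= 0 -> N s y = 0.
Hypothesis N_cont : forall f : R -> R, (forall x, continuous f x) ->
  forall x, continuous (fun s => N s (f s)) x.

Let K := sqrt (2 * L).

Lemma rate_pos : 0 < K.
Proof. apply sqrt_lt_R0. lra. Qed.

Lemma rate_sqr : K * K = 2 * L.
Proof. apply sqrt_sqrt. lra. Qed.

(** The unknown is the slope [p]; the position is its primitive, and a fixed
    point solves [f' = p], [p' = - N x f]. *)
Definition picard_step (p : R -> R) (x : R) : R :=
  c - RInt (fun s => N s (RInt p 0 s)) 0 x.

Lemma continuous_force p : (forall x, continuous p x) ->
  forall x, continuous (fun s => N s (RInt p 0 s)) x.
Proof. intros Hp. apply N_cont. intros x. now apply continuous_RInt0. Qed.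

Lemma is_derive_picard_step p x : (forall x, continuous p x) ->
  is_derive (picard_step p) x (- N x (RInt p 0 x)).
Proof.
  intros Hp. unfold picard_step.
  replace (- N x (RInt p 0 x)) with (0 - N x (RInt p 0 x)) by ring.
  apply (is_derive_minus (fun _ => c)). apply (is_derive_const c).
  apply (is_derive_RInt0 (fun s => N s (RInt p 0 s))). now apply continuous_force.
Qed.

Lemma continuous_picard_step p : (forall x, continuous p x) ->
  forall x, continuous (picard_step p) x.
Proof. intros Hp x. exact (continuous_of_derive _ _ _ (is_derive_picard_step p x Hp)). Qed.

Lemma picard_step_nonpos p x : x <= 0 -> picard_step p x = c.
Proof.
  intros Hx. unfold picard_step.
  rewrite (RInt_ext _ (fun _ => 0)).
  - rewrite RInt_const. unfold scal; simpl; unfold mult; simpl. ring.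
  - intros s. rewrite Rmax_left by lra. intros Hs. apply N_nonpos. lra.
Qed.

Lemma is_derive_weight C x : is_derive (fun x => C * exp (K * x)) x (C * K * exp (K * x)).
Proof. auto_derive; trivial. ring. Qed.

(** In the norm weighted by [exp (K x)] one integration gains a factor [1 / K]. *)
Lemma RInt_weight p q C :
  (forall x, continuous p x) -> (forall x, continuous q x) ->
  (forall x, Rabs (p x - q x) <= C * exp (K * x)) ->
  forall x, 0 <= x -> Rabs (RInt p 0 x - RInt q 0 x) <= C / K * exp (K * x).
Proof.
  intros Hp Hq H x Hx. assert (KP := rate_pos).
  assert (HC : 0 <= C).
  { specialize (H 0). rewrite Rmult_0_r, exp_0 in H.
    assert (A := Rabs_pos (p 0 - q 0)). lra. }
  assert (A := abs_le_of_derive (fun x => RInt p 0 x - RInt q 0 x)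
    (fun x => C / K * exp (K * x)) (fun x => p x - q x) (fun x => C / K * K * exp (K * x)) 0 x Hx).
  cbv beta in A. rewrite !RInt_point in A. change (@zero R_CompleteNormedModule) with 0 in A.
  rewrite Rmult_0_r, exp_0, !Rminus_0_r in A.
  assert (0 <= C / K) by (apply Rdiv_le_0_compat; lra).
  cut (Rabs (RInt p 0 x - RInt q 0 x) <= C / K * exp (K * x) - C / K * 1); [lra|].
  apply A; intros y _.
  - apply (is_derive_minus (fun x => RInt p 0 x) (fun x => RInt q 0 x)); now apply is_derive_RInt0.
  - apply is_derive_weight.
  - apply (continuous_minus (fun x => RInt p 0 x) (fun x => RInt q 0 x)); now apply continuous_RInt0.
  - exact (continuous_of_derive _ _ _ (is_derive_weight _ _)).
  - replace (C / K * K) with C by (field; lra). apply H.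
Qed.

(** Two integrations and the Lipschitz constant [L] give the factor
    [L / K^2 = 1/2]; the weight makes this contraction global in [x]. *)
Lemma picard_step_contracts p q C :
  (forall x, continuous p x) -> (forall x, continuous q x) ->
  (forall x, Rabs (p x - q x) <= C * exp (K * x)) ->
  forall x, Rabs (picard_step p x - picard_step q x) <= C / 2 * exp (K * x).
Proof.
  intros Hp Hq H x. assert (KP := rate_pos). assert (K2 := rate_sqr).
  assert (HC : 0 <= C).
  { specialize (H 0). rewrite Rmult_0_r, exp_0 in H.
    assert (A := Rabs_pos (p 0 - q 0)). lra. }
  assert (W : 0 <= C / 2 * exp (K * x)).
  { assert (0 < exp (K * x)) by apply exp_pos. nra. }
  destruct (Rle_lt_dec x 0) as [Hx|Hx].
  { rewrite !picard_step_nonpos, Rminus_diag, Rabs_R0; trivial. }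
  assert (A := abs_le_of_derive (fun x => picard_step p x - picard_step q x)
    (fun x => C / 2 * exp (K * x)) (fun x => - N x (RInt p 0 x) - - N x (RInt q 0 x))
    (fun x => C / 2 * K * exp (K * x)) 0 x (Rlt_le _ _ Hx)).
  cbv beta in A. rewrite (picard_step_nonpos p 0), (picard_step_nonpos q 0) in A by lra.
  rewrite Rmult_0_r, exp_0, Rminus_diag, !Rminus_0_r in A.
  cut (Rabs (picard_step p x - picard_step q x) <= C / 2 * exp (K * x) - C / 2 * 1); [lra|].
  apply A; intros y Hy.
  - apply (is_derive_minus (picard_step p) (picard_step q)); now apply is_derive_picard_step.
  - apply is_derive_weight.
  - apply (continuous_minus (picard_step p) (picard_step q)); now apply continuous_picard_step.
  - exact (continuous_of_derive _ _ _ (is_derive_weight _ _)).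
  - replace (- N y (RInt p 0 y) - - N y (RInt q 0 y)) with
      (- (N y (RInt p 0 y) - N y (RInt q 0 y))) by ring.
    rewrite Rabs_Ropp.
    eapply Rle_trans. apply N_lip.
    replace (C / 2 * K * exp (K * y)) with (L * (C / K * exp (K * y))).
    + apply Rmult_le_compat_l. lra. apply RInt_weight; trivial. lra.
    + replace L with (K * K / 2) by lra. field. lra.
Qed.

Fixpoint picard (n : nat) : R -> R :=
  match n with O => fun _ => c | S n => picard_step (picard n) end.

Lemma continuous_picard n x : continuous (picard n) x.
Proof.
  revert x. induction n as [|n IH]; simpl. intros x; apply continuous_const.
  now apply continuous_picard_step.
Qed.

Lemma picard_succ n x : Rabs (picard (S n) x - picard n x) <= B / K * (/ 2) ^ n * exp (K * x).
Proof.
  assert (KP := rate_pos). revert x.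
  assert (HB : 0 <= B). { assert (A := N_bound 0 0). assert (D := Rabs_pos (N 0 0)). lra. }
  induction n as [|n IH]; intros x.
  - rewrite pow_O, Rmult_1_r.
    assert (0 <= B / K) by (apply Rdiv_le_0_compat; lra).
    assert (0 < exp (K * x)) by apply exp_pos.
    simpl picard.
    destruct (Rle_lt_dec x 0) as [Hx|Hx].
    { rewrite picard_step_nonpos, Rminus_diag, Rabs_R0; trivial. nra. }
    assert (A := abs_le_of_derive (picard_step (fun _ => c)) (fun x => B * x)
      (fun x => - N x (RInt (fun _ => c) 0 x)) (fun _ => B) 0 x (Rlt_le _ _ Hx)).
    cbv beta in A. rewrite (picard_step_nonpos _ 0), Rmult_0_r, Rminus_0_r in A by lra.
    apply Rle_trans with (B * x).
    + apply A; intros y _.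
      * apply is_derive_picard_step. intros; apply continuous_const.
      * auto_derive; trivial; ring.
      * apply continuous_picard_step. intros; apply continuous_const.
      * apply (continuous_of_derive _ y B). auto_derive; trivial; ring.
      * rewrite Rabs_Ropp. apply N_bound.
    + replace (B * x) with (B / K * (K * x)) by (field; lra).
      apply Rmult_le_compat_l; trivial.
      assert (A1 := exp_ineq1_le (K * x)). lra.
  - simpl picard at 1 2. 
    replace (B / K * (/ 2) ^ S n) with (B / K * (/ 2) ^ n / 2) by (simpl; field; lra).
    apply (picard_step_contracts (picard (S n)) (picard n)); trivial; intros; apply continuous_picard.
Qed.

Lemma picard_tail n k x :
  Rabs (picard (n + k) x - picard n x) <= 2 * (B / K) * exp (K * x) * (/ 2) ^ n.
Proof.
  assert (KP := rate_pos).
  assert (HB : 0 <= B). { assert (A := N_bound 0 0). assert (D := Rabs_pos (N 0 0)). lra. }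
  assert (0 <= B / K) by (apply Rdiv_le_0_compat; lra).
  assert (0 < exp (K * x)) by apply exp_pos.
  assert (0 < (/ 2) ^ n) by (apply pow_lt; lra).
  assert (P : 0 <= B / K * exp (K * x) * (/ 2) ^ n).
  { apply Rmult_le_pos; [apply Rmult_le_pos|]; lra. }
  cut (Rabs (picard (n + k) x - picard n x) <=
       (2 - 2 * (/ 2) ^ k) * (B / K * exp (K * x) * (/ 2) ^ n)).
  { assert (0 < (/ 2) ^ k) by (apply pow_lt; lra). intros. nra. }
  induction k as [|k IH].
  - rewrite Nat.add_0_r, Rminus_diag, Rabs_R0. simpl. lra.
  - rewrite Nat.add_succ_r.
    replace (picard (S (n + k)) x - picard n x) with
      ((picard (S (n + k)) x - picard (n + k) x) + (picard (n + k) x - picard n x)) by ring.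
    eapply Rle_trans. apply Rabs_triang.
    assert (A := picard_succ (n + k) x). rewrite pow_add in A.
    simpl pow at 1. nra.
Qed.

Definition picard_lim (x : R) : R := real (Lim_seq (fun n => picard n x)).

Lemma picard_lim_tail n x :
  Rabs (picard_lim x - picard n x) <= 2 * (B / K) * exp (K * x) * (/ 2) ^ n.
Proof.
  assert (E : ex_finite_lim_seq (fun n => picard n x)).
  { apply ex_lim_seq_cauchy_corr. intros eps.
    set (C := 2 * (B / K) * exp (K * x)).
    assert (Lm : is_lim_seq (fun n => C * (/ 2) ^ n) (C * 0)).
    { apply (is_lim_seq_scal_l _ C 0). apply is_lim_seq_geom. rewrite Rabs_pos_eq; lra. }
    rewrite Rmult_0_r in Lm. apply is_lim_seq_spec in Lm.
    destruct (Lm (mkposreal (eps / 2) (is_pos_div_2 eps))) as [N0 HN0]. simpl in HN0.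
    exists N0. intros i j Hn Hm.
    assert (F : forall n, (N0 <= n)%nat -> Rabs (picard n x - picard N0 x) < eps / 2).
    { intros k Hk. replace k with (N0 + (k - N0))%nat by lia.
      eapply Rle_lt_trans. apply picard_tail.
      specialize (HN0 N0 (le_n _)). fold C. rewrite Rminus_0_r in HN0.
      apply Rabs_lt_between in HN0. lra. }
    assert (F1 := F i Hn). assert (F2 := F j Hm).
    apply Rabs_lt_between in F1. apply Rabs_lt_between in F2. apply Rabs_lt_between. lra. }
  assert (Lx : is_lim_seq (fun n => picard n x) (picard_lim x)) by now apply Lim_seq_correct'.
  apply (is_lim_seq_le (fun k => Rabs (picard (k + n) x - picard n x))
          (fun _ => 2 * (B / K) * exp (K * x) * (/ 2) ^ n)
          (Rabs (picard_lim x - picard n x)) (2 * (B / K) * exp (K * x) * (/ 2) ^ n)).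
  - intros k. rewrite Nat.add_comm. apply picard_tail.
  - apply (is_lim_seq_abs _ (picard_lim x - picard n x)).
    apply (is_lim_seq_minus' _ (fun _ => picard n x)); [|apply is_lim_seq_const].
    now apply (is_lim_seq_incr_n (fun n => picard n x)).
  - apply is_lim_seq_const.
Qed.

Lemma continuous_picard_lim x : continuous picard_lim x.
Proof.
  assert (KP := rate_pos).
  assert (HB : 0 <= B). { assert (A := N_bound 0 0). assert (D := Rabs_pos (N 0 0)). lra. }
  assert (HBK : 0 <= B / K) by (apply Rdiv_le_0_compat; lra).
  apply continuous_eps. intros eps He.
  set (C := 2 * (B / K) * exp (K * (x + 1))).
  assert (Lm : is_lim_seq (fun n => C * (/ 2) ^ n) (C * 0)).
  { apply (is_lim_seq_scal_l _ C 0). apply is_lim_seq_geom. rewrite Rabs_pos_eq; lra. }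
  rewrite Rmult_0_r in Lm. apply is_lim_seq_spec in Lm.
  assert (He3 : 0 < eps / 3) by lra.
  destruct (Lm (mkposreal (eps / 3) He3)) as [n Hn]. specialize (Hn n (le_n _)). simpl in Hn.
  rewrite Rminus_0_r in Hn. apply Rabs_lt_between in Hn.
  destruct (proj1 (continuous_eps _ x) (continuous_picard n x) (eps / 3) He3) as [d [Hd Hc]].
  exists (Rmin d 1). split; [now apply Rmin_pos; lra|].
  intros y Hy.
  assert (Hy1 : Rabs (y - x) < d) by (eapply Rlt_le_trans; [exact Hy|apply Rmin_l]).
  assert (Hy2 : Rabs (y - x) < 1) by (eapply Rlt_le_trans; [exact Hy|apply Rmin_r]).
  specialize (Hc y Hy1). apply Rabs_lt_between in Hy2.
  assert (U : forall z, z < x + 1 -> Rabs (picard_lim z - picard n z) < eps / 3).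
  { intros z Hz. eapply Rle_lt_trans. apply picard_lim_tail.
    apply Rle_lt_trans with (C * (/ 2) ^ n); [|lra].
    apply Rmult_le_compat_r. apply pow_le; lra.
    apply Rmult_le_compat_l. lra.
    left. apply exp_increasing. nra. }
  assert (U1 := U x ltac:(lra)). assert (U2 := U y ltac:(lra)).
  apply Rabs_lt_between in U1. apply Rabs_lt_between in U2. apply Rabs_lt_between in Hc.
  apply Rabs_lt_between. lra.
Qed.

Lemma picard_lim_fixed x : picard_lim x = picard_step picard_lim x.
Proof.
  cut (Rabs (picard_lim x - picard_step picard_lim x) <= 0).
  { intros A. assert (D := Rabs_pos (picard_lim x - picard_step picard_lim x)).
    assert (E : Rabs (picard_lim x - picard_step picard_lim x) = 0) by lra.
    apply Rabs_eq_0 in E. lra. }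
  apply (le_of_geometric _ (2 * (B / K) * exp (K * x))). intros n.
  replace (picard_lim x - picard_step picard_lim x) with
   ((picard_lim x - picard (S n) x) + - (picard_step picard_lim x - picard_step (picard n) x))
   by (simpl; ring).
  eapply Rle_trans. apply Rabs_triang. rewrite Rabs_Ropp.
  assert (A := picard_lim_tail (S n) x).
  assert (D := picard_step_contracts picard_lim (picard n) (2 * (B / K) * (/ 2) ^ n)
    continuous_picard_lim (continuous_picard n)).
  assert (D1 : forall x, Rabs (picard_lim x - picard n x) <= 2 * (B / K) * (/ 2) ^ n * exp (K * x)).
  { intros y. eapply Rle_trans. apply picard_lim_tail. right; ring. }
  specialize (D D1 x). simpl pow in A. nra.
Qed.

(** Global existence for [f'' = - N x f] with a bounded, globally Lipschitz
    right-hand side. *)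
Lemma second_order_ivp : exists f p : R -> R,
  f 0 = 0 /\ (forall x, x <= 0 -> p x = c) /\
  (forall x, is_derive f x (p x)) /\ (forall x, is_derive p x (- N x (f x))).
Proof.
  exists (fun x => RInt picard_lim 0 x), picard_lim. split; [|split; [|split]].
  - apply (RInt_point (V := R_CompleteNormedModule)).
  - intros y Hy. rewrite picard_lim_fixed. now apply picard_step_nonpos.
  - intros y. apply is_derive_RInt0, continuous_picard_lim.
  - intros y. apply (is_derive_ext (picard_step picard_lim)).
    + intros t. now rewrite <- picard_lim_fixed.
    + apply is_derive_picard_step, continuous_picard_lim.
Qed.
End Picard.

(** * Global solutions regular at the origin *)

Definition clamp (m y : R) : R := (Rabs (y + m) - Rabs (y - m)) / 2.

Lemma clamp_id m y : Rabs y <= m -> clamp m y = y.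
Proof.
  intros H. apply Rabs_le_between in H. unfold clamp.
  rewrite Rabs_pos_eq, Rabs_left1 by lra. lra.
Qed.

Lemma clamp_bound m y : 0 <= m -> Rabs (clamp m y) <= m.
Proof.
  intros H. unfold clamp. apply Rabs_le.
  assert (A := Rabs_triang (y + m) (-(2 * m))). assert (B := Rabs_triang (y - m) (2 * m)).
  rewrite Rabs_Ropp in A. rewrite (Rabs_pos_eq (2 * m)) in A, B by lra.
  replace (y + m + - (2 * m)) with (y - m) in A by ring.
  replace (y - m + 2 * m) with (y + m) in B by ring. lra.
Qed.

Lemma clamp_lip m y z : Rabs (clamp m y - clamp m z) <= Rabs (y - z).
Proof.
  unfold clamp. 
  assert (A := Rabs_triang_inv2 (y + m) (z + m)). assert (B := Rabs_triang_inv2 (y - m) (z - m)).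
  replace (y + m - (z + m)) with (y - z) in A by ring.
  replace (y - m - (z - m)) with (y - z) in B by ring.
  apply Rabs_le_between in A. apply Rabs_le_between in B. apply Rabs_le. lra.
Qed.

Definition pos_part (s : R) : R := (s + Rabs s) / 2.
Lemma pos_part_pos s : 0 <= s -> pos_part s = s.
Proof. intros H. unfold pos_part. rewrite Rabs_pos_eq; lra. Qed.
Lemma pos_part_neg s : s <= 0 -> pos_part s = 0.
Proof. intros H. unfold pos_part. rewrite Rabs_left1; lra. Qed.

(** The force [f^3 / sinh^2 x] with [f] cut off at [M x], the size allowed by a
    slope at most [M].  The cut-off cancels the singularity of the weight at 0 and makes
    the force vanish for [s <= 0]. *)
Definition trunc_force (M s y : R) : R := csch2 s * clamp (M * pos_part s) y ^ 3.

Lemma trunc_force_nonpos M s y : s <= 0 -> trunc_force M s y = 0.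
Proof.
  intros H. unfold trunc_force. rewrite pos_part_neg, Rmult_0_r by trivial.
  unfold clamp. rewrite Rplus_0_r, Rminus_0_r, Rminus_diag. unfold Rdiv. ring.
Qed.

Lemma trunc_force_abs M s y : 0 <= M -> 0 < s -> Rabs (trunc_force M s y) <= csch2 s * (M * s) ^ 3.
Proof.
  intros HM Hs. unfold trunc_force. rewrite pos_part_pos by lra.
  assert (P := csch2_pos s Hs).
  rewrite Rabs_mult, (Rabs_pos_eq (csch2 s)) by lra.
  apply Rmult_le_compat_l. lra. rewrite <- RPow_abs.
  apply pow_incr. split. apply Rabs_pos. apply clamp_bound. nra.
Qed.

Lemma csch2_cube_le s : 0 < s -> csch2 s * s ^ 3 <= s.
Proof. intros H. assert (A := csch2_le_inv_sqr s H). nra. Qed.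

Lemma trunc_force_bound M s y : 0 <= M -> Rabs (trunc_force M s y) <= 36 * M ^ 3.
Proof.
  intros HM. assert (HM3 : 0 <= M ^ 3) by now apply pow_le.
  destruct (Rle_lt_dec s 0) as [Hs|Hs].
  - rewrite trunc_force_nonpos, Rabs_R0; trivial. lra.
  - eapply Rle_trans. now apply trunc_force_abs.
    rewrite Rpow_mult_distr.
    assert (csch2 s * s ^ 3 <= 36); [|nra].
    destruct (Rle_lt_dec s 1).
    + assert (A := csch2_cube_le s Hs). lra.
    + assert (A := csch2_le_inv_pow6 s Hs). assert (P := csch2_pos s Hs).
      eapply Rle_trans; [|exact A]. apply Rmult_le_compat_l. lra.
      apply Rle_pow; [lra|lia].
Qed.

Lemma trunc_force_lip M s y z : 0 <= M ->
  Rabs (trunc_force M s y - trunc_force M s z) <= 3 * M ^ 2 * Rabs (y - z).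
Proof.
  intros HM. assert (D := Rabs_pos (y - z)).
  destruct (Rle_lt_dec s 0) as [Hs|Hs].
  - rewrite !trunc_force_nonpos, Rminus_diag, Rabs_R0; trivial. nra.
  - unfold trunc_force. rewrite pos_part_pos by lra.
    assert (Hm : 0 <= M * s) by nra.
    assert (A := clamp_bound (M * s) y Hm). assert (B := clamp_bound (M * s) z Hm).
    assert (L := clamp_lip (M * s) y z).
    set (a := clamp (M * s) y) in *. set (b := clamp (M * s) z) in *.
    replace (csch2 s * a ^ 3 - csch2 s * b ^ 3) with (csch2 s * ((a - b) * (a ^ 2 + a * b + b ^ 2))) by ring.
    assert (P := csch2_pos s Hs). assert (P2 := csch2_le_inv_sqr s Hs).
    rewrite !Rabs_mult, (Rabs_pos_eq (csch2 s)) by lra.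
    assert (Q : Rabs (a ^ 2 + a * b + b ^ 2) <= 3 * (M * s) ^ 2).
    { apply Rabs_le_between in A. apply Rabs_le_between in B. apply Rabs_le. split; nra. }
    assert (Q0 := Rabs_pos (a ^ 2 + a * b + b ^ 2)). assert (L0 := Rabs_pos (a - b)).
    apply Rle_trans with (csch2 s * (Rabs (y - z) * (3 * (M * s) ^ 2))).
    + apply Rmult_le_compat_l. lra. apply Rmult_le_compat; lra.
    + replace (csch2 s * (Rabs (y - z) * (3 * (M * s) ^ 2)))
        with ((csch2 s * s ^ 2) * (3 * M ^ 2 * Rabs (y - z))) by ring.
      assert (0 <= 3 * M ^ 2 * Rabs (y - z)) by (apply Rmult_le_pos; nra). nra.
Qed.

(** At 0 continuity comes from the bound [M^3 s] on the force, since [csch2] is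
    unbounded there. *)
Lemma continuous_trunc_force M (f : R -> R) : 0 <= M -> (forall x, continuous f x) ->
  forall x, continuous (fun s => trunc_force M s (f s)) x.
Proof.
  intros HM Hf x. destruct (Req_dec x 0) as [->|Hx].
  - apply continuous_eps. intros eps He.
    assert (HM3 : 0 <= M ^ 3) by now apply pow_le.
    exists (eps / (M ^ 3 + 1)). split. apply Rdiv_lt_0_compat; lra.
    intros y Hy. rewrite Rminus_0_r in Hy.
    rewrite (trunc_force_nonpos M 0), Rminus_0_r by lra.
    destruct (Rle_lt_dec y 0) as [Hy0|Hy0].
    + rewrite trunc_force_nonpos, Rabs_R0; trivial.
    + rewrite Rabs_pos_eq in Hy by lra.
      eapply Rle_lt_trans. now apply trunc_force_abs.
      rewrite Rpow_mult_distr. assert (A := csch2_cube_le y Hy0).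
      apply Rle_lt_trans with (M ^ 3 * y). nra.
      apply Rle_lt_trans with ((M ^ 3 + 1) * y). nra.
      replace eps with ((M ^ 3 + 1) * (eps / (M ^ 3 + 1))) by (field; lra).
      apply Rmult_lt_compat_l; lra.
  - unfold trunc_force, clamp, pos_part.
    assert (C : continuous (fun s => M * ((s + Rabs s) / 2)) x).
    { apply (continuous_scal_r M (fun s => (s + Rabs s) / 2)).
      apply (continuous_mult (fun s => s + Rabs s) (fun _ => / 2)); [|apply continuous_const].
      apply (continuous_plus (fun s => s) Rabs). apply continuous_id. apply continuous_Rabs. }
    apply (continuous_mult csch2). now apply continuous_csch2.
    set (g := fun s => (Rabs (f s + M * ((s + Rabs s) / 2)) - Rabs (f s - M * ((s + Rabs s) / 2))) / 2).
    assert (G : continuous g x).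
    { apply (continuous_mult (fun s => Rabs (f s + M * ((s + Rabs s) / 2))
        - Rabs (f s - M * ((s + Rabs s) / 2))) (fun _ => / 2)); [|apply continuous_const].
      apply (continuous_minus (fun s => Rabs (f s + M * ((s + Rabs s) / 2)))
        (fun s => Rabs (f s - M * ((s + Rabs s) / 2)))).
      - apply continuous_Rabs_comp. apply (continuous_plus f); auto.
      - apply continuous_Rabs_comp. apply (continuous_minus f); auto. }
    apply (continuous_mult g (fun s => g s ^ 2)); trivial.
    apply (continuous_mult g (fun s => g s ^ 1)); trivial.
    apply (continuous_mult g (fun s => g s ^ 0)); trivial.
    apply continuous_const.
Qed.

(** The energy decreases because the weight does; its derivative is
    [dcsch2 x * f x ^ 4 / 2]. *)
Lemma energy_decreases (f p : R -> R) (a b : R) :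
  0 < a <= b ->
  (forall x, a <= x <= b -> is_derive f x (p x)) ->
  (forall x, a <= x <= b -> is_derive p x (- (csch2 x * f x ^ 3))) ->
  p b ^ 2 + csch2 b * f b ^ 4 / 2 <= p a ^ 2 + csch2 a * f a ^ 4 / 2.
Proof.
  intros Hab Hf Hp.
  cut (- (p a ^ 2 + csch2 a * f a ^ 4 / 2) <= - (p b ^ 2 + csch2 b * f b ^ 4 / 2)); [lra|].
  assert (Hd : forall x, a <= x <= b ->
    is_derive (fun x => - (p x ^ 2 + csch2 x * f x ^ 4 / 2)) x (- (dcsch2 x * f x ^ 4 / 2))).
  { intros x Hx. specialize (Hf x Hx). specialize (Hp x Hx).
    assert (Hh := is_derive_csch2 x ltac:(lra)).
    auto_derive.
    - repeat split; trivial; eexists; eassumption.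
    - replace (Derive (fun x0 : R => p x0) x) with (- (csch2 x * f x ^ 3)) by (symmetry; now apply is_derive_unique).
      replace (Derive (fun x0 : R => f x0) x) with (p x) by (symmetry; now apply is_derive_unique).
      replace (Derive (fun x0 : R => csch2 x0) x) with (dcsch2 x) by (symmetry; now apply is_derive_unique).
      simpl. field. }
  apply (le_of_derive (fun x => - (p x ^ 2 + csch2 x * f x ^ 4 / 2)) (fun x => - (dcsch2 x * f x ^ 4 / 2))).
  - lra.
  - intros; apply Hd; lra.
  - intros x Hx. exact (continuous_of_derive _ _ _ (Hd x Hx)).
  - intros x Hx. assert (D := dcsch2_nonpos x ltac:(lra)).
    assert (0 <= f x ^ 4) by (replace (f x ^ 4) with ((f x ^ 2) ^ 2) by ring; apply pow2_ge_0).
    nra.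
Qed.

(** The solution is continued to [x <= 0] by [p = c] and zero force so that all its
    derivatives are two-sided at 0; [n] is the continuous force. *)
Record profile (c : R) (f p n : R -> R) : Prop := {
  profile_0 : f 0 = 0;
  profile_neg : forall x, x <= 0 -> p x = c;
  profile_df : forall x, is_derive f x (p x);
  profile_dp : forall x, is_derive p x (- n x);
  profile_n : forall x, 0 <= x -> n x = csch2 x * f x ^ 3;
  profile_cont : forall x, continuous n x;
  profile_f_le : forall x, 0 <= x -> Rabs (f x) <= c * x;
  profile_p_le : forall x, 0 <= x -> Rabs (p x) <= c }.

(** The energy tends to [c^2] at 0, so its monotonicity bounds the slope by [c]
    as long as some linear bound for [f] holds. *)
Lemma slope_bound (f p : R -> R) (c M X : R) :
  0 < c -> 0 <= M -> 0 <= X ->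
  f 0 = 0 -> p 0 = c ->
  (forall x, is_derive f x (p x)) ->
  continuous p 0 ->
  (forall x, 0 < x <= X -> is_derive p x (- (csch2 x * f x ^ 3))) ->
  (forall x, 0 <= x <= X -> Rabs (f x) <= M * x) ->
  Rabs (p X) <= c.
Proof.
  intros Hc HM HX F0 P0 Hf Cp Hp HB.
  destruct HX as [HX|<-]; [|rewrite P0, Rabs_pos_eq; lra].
  rewrite <- (Rabs_pos_eq c) by lra. apply Rsqr_le_abs_0. rewrite !Rsqr_pow2.
  apply Rnot_lt_le. intros Hlt.
  set (eps := (p X ^ 2 - c ^ 2) / 2).
  (* This function majorizes the energy and is continuous at 0. *)
  assert (Cg : continuous (fun x => p x ^ 2 + M ^ 4 * x ^ 2 / 2) 0).
  { apply (continuous_plus (fun x => p x ^ 2) (fun x => M ^ 4 * x ^ 2 / 2)).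
    - apply (continuous_mult p (fun x => p x ^ 1)); trivial.
      apply (continuous_mult p (fun x => p x ^ 0)); trivial. apply continuous_const.
    - apply (continuous_of_derive _ 0 0). auto_derive; trivial. simpl; field. }
  destruct (proj1 (continuous_eps _ _) Cg eps) as [d [Hd H]]. unfold eps; lra.
  set (y := Rmin (d / 2) X).
  assert (Hy : 0 < y) by (apply Rmin_pos; lra).
  assert (Hy1 : y <= d / 2) by apply Rmin_l. assert (Hy2 : y <= X) by apply Rmin_r.
  specialize (H y). rewrite Rminus_0_r, Rabs_pos_eq in H by lra. specialize (H ltac:(lra)).
  apply Rabs_lt_between in H. rewrite P0 in H.
  assert (E := energy_decreases f p y X (conj Hy Hy2)).
  assert (E1 : p X ^ 2 + csch2 X * f X ^ 4 / 2 <= p y ^ 2 + csch2 y * f y ^ 4 / 2).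
  { apply E; intros; [apply Hf|apply Hp; lra]. }
  assert (Q : 0 <= csch2 X * f X ^ 4).
  { apply Rmult_le_pos. left; now apply csch2_pos.
    replace (f X ^ 4) with ((f X ^ 2) ^ 2) by ring; apply pow2_ge_0. }
  assert (Q2 : csch2 y * f y ^ 4 <= M ^ 4 * y ^ 2).
  { assert (A := HB y ltac:(lra)).
    assert (A4 : f y ^ 4 <= (M * y) ^ 4).
    { replace (f y ^ 4) with (Rabs (f y) ^ 4).
      apply pow_incr. split; trivial. apply Rabs_pos.
      rewrite RPow_abs. apply Rabs_pos_eq.
      replace (f y ^ 4) with ((f y ^ 2) ^ 2) by ring; apply pow2_ge_0. }
    assert (P := csch2_pos y Hy). assert (P2 := csch2_le_inv_sqr y Hy).
    apply Rle_trans with (csch2 y * (M * y) ^ 4). nra.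
    replace (csch2 y * (M * y) ^ 4) with (csch2 y * y ^ 2 * (M ^ 4 * y ^ 2)) by ring.
    assert (0 <= M ^ 4 * y ^ 2) by (apply Rmult_le_pos; [apply pow_le; lra|nra]). nra. }
  unfold eps in H. simpl in H. nra.
Qed.

(** With the cut-off at [M = 2 c], the bound [|f| <= c x] given by the energy is
    strictly better than the bound that keeps the cut-off inactive, so the latter
    persists for all [x] by continuity. *)
Lemma profile_exists c : 0 < c -> exists f p n, profile c f p n.
Proof.
  intros Hc. set (M := 2 * c). assert (HM : 0 < M) by (unfold M; lra).
  destruct (second_order_ivp (trunc_force M) (3 * M ^ 2) (36 * M ^ 3) c)
    as (f & p & F0 & Pn & Hf & Hp).
  { assert (0 < M ^ 2) by now apply pow_lt. lra. }
  { intros; apply trunc_force_lip; lra. }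
  { intros; apply trunc_force_bound; lra. }
  { intros; now apply trunc_force_nonpos. }
  { intros; apply continuous_trunc_force; trivial; lra. }
  assert (Cf : forall x, continuous f x) by (intros x; exact (continuous_of_derive _ _ _ (Hf x))).
  assert (Cp : forall x, continuous p x) by (intros x; exact (continuous_of_derive _ _ _ (Hp x))).
  assert (P0 : p 0 = c) by (apply Pn; lra).
  assert (Untrunc : forall x, 0 <= x -> Rabs (f x) <= M * x -> trunc_force M x (f x) = csch2 x * f x ^ 3).
  { intros x Hx H. unfold trunc_force. rewrite pos_part_pos, clamp_id; trivial. }
  assert (PB : forall X, 0 <= X -> (forall x, 0 <= x <= X -> Rabs (f x) <= M * x) -> Rabs (p X) <= c).
  { intros X HX H. apply (slope_bound f p c M X); trivial; try lra.
    intros x Hx. rewrite <- Untrunc; trivial; [lra|apply H; lra]. }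
  assert (FB : forall X, 0 <= X -> (forall x, 0 <= x <= X -> Rabs (f x) <= M * x) -> Rabs (f X) <= c * X).
  { intros X HX H.
    assert (A := abs_le_of_derive f (fun x => c * x) p (fun _ => c) 0 X HX). cbv beta in A.
    rewrite F0, Rmult_0_r, !Rminus_0_r in A. apply A; intros; auto.
    - auto_derive; trivial; ring.
    - apply (continuous_of_derive _ x c). auto_derive; trivial; ring.
    - apply PB; [lra|]. intros; apply H; lra. }
  (* The set of X up to which the cut-off is inactive is all of [0, oo). *)
  assert (All : forall X, 0 <= X -> forall x, 0 <= x <= X -> Rabs (f x) <= M * x).
  { set (A := fun X => 0 <= X /\ forall x, 0 <= x <= X -> Rabs (f x) <= M * x).
    intros X HX. apply NNPP. intros Hno.
    assert (Abd : forall Y, A Y -> Y <= X).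
    { intros Y [HY1 HY2]. apply Rnot_lt_le. intros Hlt. apply Hno. intros x Hx. apply HY2. lra. }
    assert (A0 : A 0).
    { split. lra. intros x Hx. replace x with 0 by lra. rewrite F0, Rabs_R0. lra. }
    destruct (completeness A) as [S [HS1 HS2]].
    { exists X. exact Abd. } { now exists 0. }
    assert (HS0 : 0 <= S) by now apply HS1.
    assert (Hlt : forall x, 0 <= x < S -> Rabs (f x) <= M * x).
    { intros x Hx. apply NNPP. intros Hn.
      assert (S <= x); [|lra]. apply HS2. intros Y [HY1 HY2].
      apply Rnot_lt_le. intros Hl. apply Hn, HY2. lra. }
    assert (AS : A S).
    { split; trivial. intros x Hx. destruct (Rlt_le_dec x S). now apply Hlt; lra.
      replace x with S by lra. destruct HS0 as [HS0|<-].
      - apply Rnot_lt_le. intros Hgt.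
        assert (Cg : continuous (fun x => Rabs (f x) - M * x) S).
        { apply (continuous_minus (fun x => Rabs (f x)) (fun x => M * x)).
          now apply continuous_Rabs_comp.
          apply (continuous_of_derive _ S M). auto_derive; trivial; ring. }
        destruct (proj1 (continuous_eps _ _) Cg (Rabs (f S) - M * S)) as [d [Hd Hy]]. lra.
        set (y := Rmax 0 (S - d / 2)).
        assert (Y1 : 0 <= y) by apply Rmax_l. assert (Y2 : S - d / 2 <= y) by apply Rmax_r.
        assert (Y3 : y < S) by (apply Rmax_lub_lt; lra).
        specialize (Hy y). rewrite Rabs_left1 in Hy by lra. specialize (Hy ltac:(lra)).
        apply Rabs_lt_between in Hy. specialize (Hlt y ltac:(lra)). lra.
      - rewrite F0, Rabs_R0. lra. }
    assert (exists d, 0 < d /\ forall y, S <= y < S + d -> Rabs (f y) <= M * y) as [d [Hd Hy]].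
    { destruct HS0 as [HS0|HS0].
      - assert (Cg : continuous (fun x => Rabs (f x) - M * x) S).
        { apply (continuous_minus (fun x => Rabs (f x)) (fun x => M * x)).
          now apply continuous_Rabs_comp.
          apply (continuous_of_derive _ S M). auto_derive; trivial; ring. }
        assert (FS := FB S (Rlt_le _ _ HS0) (proj2 AS)).
        destruct (proj1 (continuous_eps _ _) Cg (c * S)) as [d [Hd Hy]]. nra.
        exists d. split; trivial. intros y Hyd.
        specialize (Hy y). rewrite Rabs_pos_eq in Hy by lra. specialize (Hy ltac:(lra)).
        apply Rabs_lt_between in Hy. unfold M in *. lra.
      - (* Near 0 the slope is close to c, which is less than M. *)
        destruct (proj1 (continuous_eps _ _) (Cp 0) c Hc) as [d [Hd Hpd]].
        exists d. split; trivial. intros y Hyd. rewrite <- HS0 in Hyd.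
        assert (B := abs_le_of_derive f (fun x => M * x) p (fun _ => M) 0 y (proj1 Hyd)). cbv beta in B.
        rewrite F0, Rmult_0_r, !Rminus_0_r in B. apply B; intros; auto.
        + auto_derive; trivial; ring.
        + apply (continuous_of_derive _ x M). auto_derive; trivial; ring.
        + specialize (Hpd x). rewrite Rminus_0_r, Rabs_pos_eq in Hpd by lra.
          specialize (Hpd ltac:(lra)). rewrite P0 in Hpd.
          apply Rabs_lt_between in Hpd. apply Rabs_le. unfold M; lra. }
    assert (S + d / 2 <= S); [|lra].
    apply HS1. split. lra. intros x Hx. destruct (Rle_lt_dec x S).
    + apply AS; lra.
    + apply Hy; lra. }
  exists f, p, (fun x => trunc_force M x (f x)). split; trivial.
  - intros x Hx. apply Untrunc; trivial. apply (All x); lra.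
  - intros x. apply continuous_trunc_force; trivial; lra.
  - intros x Hx. apply FB; trivial. now apply All.
  - intros x Hx. apply PB; trivial. now apply All.
Qed.

(** * The polar angle and its dependence on the parameter *)

Section Profile.
Variables (c : R) (f p n : R -> R).
Hypothesis c_pos : 0 < c.
Hypothesis sol : profile c f p n.

Lemma profile_p0 : p 0 = c.
Proof. apply (profile_neg c f p n sol). lra. Qed.

Lemma profile_cf x : continuous f x.
Proof. exact (continuous_of_derive _ _ _ (profile_df _ _ _ _ sol x)). Qed.

Lemma profile_cp x : continuous p x.
Proof. exact (continuous_of_derive _ _ _ (profile_dp _ _ _ _ sol x)). Qed.

Lemma profile_eq x : 0 <= x -> is_derive p x (- (csch2 x * f x ^ 3)).
Proof.
  intros Hx. rewrite <- (profile_n _ _ _ _ sol) by trivial.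
  apply (profile_dp _ _ _ _ sol).
Qed.

(** Half the energy divided by the weight.  In the scale-invariant regime near 0 it
    measures the amplitude of the oscillation. *)
Definition growth (x : R) : R := sinh x ^ 2 * p x ^ 2 / 2 + f x ^ 4 / 4.

(** The weight drops out: the derivative is [sinh x cosh x p^2]. *)
Lemma growth_increases a b : 0 <= a <= b -> growth a <= growth b.
Proof.
  intros Hab.
  assert (Hd : forall x, 0 < x -> is_derive growth x (sinh x * cosh x * p x ^ 2)).
  { intros x Hx. assert (Hf := profile_df _ _ _ _ sol x).
    assert (Hp := profile_eq x (Rlt_le _ _ Hx)). unfold growth.
    assert (S := sinh_pos x Hx).
    auto_derive. repeat split; trivial; eexists; eassumption.
    replace (Derive (fun x0 : R => p x0) x) with (- (csch2 x * f x ^ 3)) by (symmetry; now apply is_derive_unique).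
    replace (Derive (fun x0 : R => f x0) x) with (p x) by (symmetry; now apply is_derive_unique).
    unfold csch2. field. lra. }
  apply (le_of_derive growth (fun x => sinh x * cosh x * p x ^ 2)); try lra.
  - intros x Hx. apply Hd; lra.
  - intros x Hx. unfold growth.
    apply (continuous_of_derive _ x (sinh x * cosh x * p x ^ 2 - sinh x ^ 2 * p x * n x + f x ^ 3 * p x)).
    assert (Hf := profile_df _ _ _ _ sol x). assert (Hp := profile_dp _ _ _ _ sol x).
    auto_derive. repeat split; trivial; eexists; eassumption.
    replace (Derive (fun x0 : R => p x0) x) with (- n x) by (symmetry; now apply is_derive_unique).
    replace (Derive (fun x0 : R => f x0) x) with (p x) by (symmetry; now apply is_derive_unique).
    field.
  - intros x Hx. assert (S := sinh_pos x ltac:(lra)). assert (Q := cosh_ge x ltac:(lra)).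
    apply Rmult_le_pos; [|apply pow2_ge_0]. apply Rmult_le_pos; nra.
Qed.

Lemma pow4_nonneg x : 0 <= x ^ 4.
Proof. replace (x ^ 4) with ((x ^ 2) ^ 2) by ring. apply pow2_ge_0. Qed.

(** If [f] and [p] vanished together then so would [growth], hence [p] would
    vanish on the whole interval from 0, contradicting [p 0 = c]. *)
Lemma profile_nonzero x : 0 < f x ^ 2 + p x ^ 2.
Proof.
  assert (A := pow2_ge_0 (f x)). assert (B := pow2_ge_0 (p x)).
  destruct (Rle_lt_dec x 0) as [Hx|Hx].
  - rewrite (profile_neg _ _ _ _ sol) in * by trivial. nra.
  - apply Rnot_le_lt. intros H.
    assert (F : f x = 0) by nra. assert (P : p x = 0) by nra.
    assert (Z : forall s, 0 < s <= x -> p s = 0).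
    { intros s Hs. assert (M := growth_increases s x ltac:(lra)). unfold growth in M.
      rewrite F, P in M. assert (S := sinh_pos s ltac:(lra)).
      assert (Q := pow4_nonneg (f s)).
      replace (sinh s ^ 2 * p s ^ 2) with ((sinh s * p s) ^ 2) in M by ring.
      assert (T0 := pow2_ge_0 (sinh s * p s)).
      assert (T : sinh s * p s = 0) by (apply Rsqr_0_uniq; rewrite Rsqr_pow2; lra).
      apply Rmult_integral in T. lra. }
    destruct (proj1 (continuous_eps _ _) (profile_cp 0) c c_pos) as [d [Hd Hy]].
    set (y := Rmin (d / 2) x).
    assert (Y0 : 0 < y) by (apply Rmin_pos; lra).
    assert (Y1 : y <= d / 2) by apply Rmin_l. assert (Y2 : y <= x) by apply Rmin_r.
    specialize (Hy y). rewrite Rminus_0_r, Rabs_pos_eq in Hy by lra. specialize (Hy ltac:(lra)).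
    rewrite profile_p0, Z in Hy by lra. apply Rabs_lt_between in Hy. lra.
Qed.

(** The angular velocity of [(p, f)] in the plane. *)
Definition speed (x : R) : R := (p x ^ 2 + f x * n x) / (f x ^ 2 + p x ^ 2).
Definition angle (x : R) : R := RInt speed 0 x.

Lemma continuous_sqr (g : R -> R) x : continuous g x -> continuous (fun x => g x ^ 2) x.
Proof.
  intros Hg. apply (continuous_ext (fun x => g x * g x)). intros; simpl; ring.
  now apply (continuous_mult g g).
Qed.

Lemma continuous_speed x : continuous speed x.
Proof.
  apply (continuous_mult (fun x => p x ^ 2 + f x * n x) (fun x => / (f x ^ 2 + p x ^ 2))).
  - apply (continuous_plus (fun x => p x ^ 2) (fun x => f x * n x)).
    apply continuous_sqr, profile_cp.
    apply (continuous_mult f n). apply profile_cf. apply (profile_cont _ _ _ _ sol).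
  - apply (continuous_Rinv_comp (fun x => f x ^ 2 + p x ^ 2)).
    apply (continuous_plus (fun x => f x ^ 2) (fun x => p x ^ 2));
      apply continuous_sqr; [apply profile_cf|apply profile_cp].
    assert (A := profile_nonzero x). lra.
Qed.

Lemma is_derive_angle x : is_derive angle x (speed x).
Proof. apply is_derive_RInt0. apply continuous_speed. Qed.

Lemma continuous_angle x : continuous angle x.
Proof. exact (continuous_of_derive _ _ _ (is_derive_angle x)). Qed.

Lemma angle_0 : angle 0 = 0.
Proof. apply (RInt_point (V := R_CompleteNormedModule)). Qed.

Lemma constant_of_derive (g : R -> R) : (forall x, is_derive g x 0) -> forall x, g x = g 0.
Proof.
  intros H x. destruct (Rtotal_order x 0) as [Hx|[->|Hx]]; trivial.
  - exact (eq_is_derive (V := R_NormedModule) g x 0 (fun t _ => H t) Hx).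
  - exact (eq_sym (eq_is_derive (V := R_NormedModule) g 0 x (fun t _ => H t) Hx)).
Qed.

(** Any solution of the linear equation satisfied by the length of [(f, p)] is a
    multiple of that length. *)
Lemma ratio_constant (G : R -> R) :
  (forall x, is_derive G x (G x * (p x * (f x - n x) / (f x ^ 2 + p x ^ 2)))) ->
  forall x, G x = G 0 / c * sqrt (f x ^ 2 + p x ^ 2).
Proof.
  intros HG x.
  assert (R0 : forall x, 0 < sqrt (f x ^ 2 + p x ^ 2)) by (intros; apply sqrt_lt_R0, profile_nonzero).
  assert (E := constant_of_derive (fun x => G x / sqrt (f x ^ 2 + p x ^ 2))).
  cbv beta in E. rewrite (profile_0 _ _ _ _ sol), profile_p0 in E.
  replace (0 ^ 2 + c ^ 2) with (c ^ 2) in E by ring. rewrite sqrt_pow2 in E by lra.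
  rewrite <- (E) with (x := x). field. specialize (R0 x). lra.
  clear x E. intros x.
  assert (Hf := profile_df _ _ _ _ sol x). assert (Hp := profile_dp _ _ _ _ sol x).
  assert (Hg := HG x). specialize (R0 x). assert (P := profile_nonzero x).
  auto_derive. repeat split; trivial; try (eexists; eassumption).
  { apply Rgt_not_eq. exact R0. }
  replace (Derive (fun x0 : R => p x0) x) with (- n x) by (symmetry; now apply is_derive_unique).
  replace (Derive (fun x0 : R => f x0) x) with (p x) by (symmetry; now apply is_derive_unique).
  replace (Derive (fun x0 : R => G x0) x) with (G x * (p x * (f x - n x) / (f x ^ 2 + p x ^ 2)))
    by (symmetry; now apply is_derive_unique).
  replace (f x * (f x * 1) + p x * (p x * 1)) with (f x ^ 2 + p x ^ 2) by ring.
  assert (SS : sqrt (f x ^ 2 + p x ^ 2) * sqrt (f x ^ 2 + p x ^ 2) = f x ^ 2 + p x ^ 2)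
    by (apply sqrt_sqrt; lra).
  set (r := sqrt (f x ^ 2 + p x ^ 2)) in *. rewrite <- SS.
  field. lra.
Qed.

(** Rotating [(f, p)] back by the angle gives two quantities that satisfy the
    equation of [ratio_constant]; their values at 0 are 0 and [c]. *)
Lemma polar x : f x = sqrt (f x ^ 2 + p x ^ 2) * sin (angle x) /\
                p x = sqrt (f x ^ 2 + p x ^ 2) * cos (angle x).
Proof.
  assert (E1 := ratio_constant (fun x => f x * cos (angle x) - p x * sin (angle x))).
  assert (E2 := ratio_constant (fun x => f x * sin (angle x) + p x * cos (angle x))).
  cbv beta in E1, E2. rewrite (profile_0 _ _ _ _ sol), profile_p0, angle_0, sin_0, cos_0 in E1, E2.
  rewrite Rmult_0_r, Rmult_0_l, Rminus_diag in E1.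
  rewrite Rmult_0_l, Rplus_0_l, Rmult_1_r, Rdiv_diag in E2 by lra.
  specialize (fun H => E1 H x). specialize (fun H => E2 H x).
  assert (T := sin2_cos2 (angle x)). unfold Rsqr in T.
  assert (A1 : f x * cos (angle x) - p x * sin (angle x) = 0).
  { rewrite E1. unfold Rdiv; ring. clear x E1 E2 T. intros x.
    assert (Hf := profile_df _ _ _ _ sol x). assert (Hp := profile_dp _ _ _ _ sol x).
    assert (Ha := is_derive_angle x). assert (P := profile_nonzero x).
    auto_derive. repeat split; trivial; try (eexists; eassumption).
    replace (Derive (fun x0 : R => p x0) x) with (- n x) by (symmetry; now apply is_derive_unique).
    replace (Derive (fun x0 : R => f x0) x) with (p x) by (symmetry; now apply is_derive_unique).
    replace (Derive (fun x0 : R => angle x0) x) with (speed x) by (symmetry; now apply is_derive_unique).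
    unfold speed. field. lra. }
  assert (A2 : f x * sin (angle x) + p x * cos (angle x) = 1 * sqrt (f x ^ 2 + p x ^ 2)).
  { apply E2. clear x E1 E2 T A1. intros x.
    assert (Hf := profile_df _ _ _ _ sol x). assert (Hp := profile_dp _ _ _ _ sol x).
    assert (Ha := is_derive_angle x). assert (P := profile_nonzero x).
    auto_derive. repeat split; trivial; try (eexists; eassumption).
    replace (Derive (fun x0 : R => p x0) x) with (- n x) by (symmetry; now apply is_derive_unique).
    replace (Derive (fun x0 : R => f x0) x) with (p x) by (symmetry; now apply is_derive_unique).
    replace (Derive (fun x0 : R => angle x0) x) with (speed x) by (symmetry; now apply is_derive_unique).
    unfold speed. field. lra. }
  rewrite Rmult_1_l in A2. rewrite <- A2.
  set (s := sin (angle x)) in *. set (k := cos (angle x)) in *. split.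
  - transitivity (f x * (s * s + k * k)). rewrite T; ring. 
    transitivity (f x * (s * s) + (f x * k) * k). ring.
    replace (f x * k) with (p x * s) by lra. ring.
  - transitivity (p x * (s * s + k * k)). rewrite T; ring. 
    transitivity (p x * (k * k) + (p x * s) * s). ring.
    replace (p x * s) with (f x * k) by lra. ring.
Qed.

(** In this form the angle solves a first-order equation of its own, with
    coefficient [csch2 x * f x ^ 2] bounded by [c^2]. *)
Lemma speed_polar x : 0 <= x ->
  speed x = cos (angle x) ^ 2 + csch2 x * f x ^ 2 * sin (angle x) ^ 2.
Proof.
  intros Hx. unfold speed. rewrite (profile_n _ _ _ _ sol) by trivial.
  destruct (polar x) as [A B]. assert (P := profile_nonzero x).
  replace (p x ^ 2) with ((f x ^ 2 + p x ^ 2) * cos (angle x) ^ 2) at 1.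
  2:{ rewrite B at 2. rewrite Rpow_mult_distr, pow2_sqrt by lra. trivial. }
  replace (f x * (csch2 x * f x ^ 3)) with (csch2 x * f x ^ 2 * f x ^ 2) by ring.
  replace (csch2 x * f x ^ 2 * f x ^ 2) with (csch2 x * f x ^ 2 * ((f x ^ 2 + p x ^ 2) * sin (angle x) ^ 2)).
  2:{ f_equal. rewrite A at 2. rewrite Rpow_mult_distr, pow2_sqrt by lra. trivial. }
  field. lra.
Qed.

Lemma speed_pos x : 0 < x -> 0 < speed x.
Proof.
  intros Hx. unfold speed. rewrite (profile_n _ _ _ _ sol) by lra.
  apply Rdiv_lt_0_compat; [|apply profile_nonzero].
  assert (P := profile_nonzero x). assert (H := csch2_pos x Hx).
  replace (f x * (csch2 x * f x ^ 3)) with (csch2 x * (f x ^ 2 * f x ^ 2)) by ring.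
  assert (A := pow2_ge_0 (f x)). assert (B := pow2_ge_0 (p x)).
  destruct (Req_dec (p x ^ 2) 0) as [E|E].
  - rewrite E in *. assert (0 < f x ^ 2) by lra.
    rewrite Rplus_0_l. apply Rmult_lt_0_compat; nra.
  - assert (0 <= csch2 x * (f x ^ 2 * f x ^ 2)) by (apply Rmult_le_pos; nra). lra.
Qed.

Lemma angle_increasing a b : 0 <= a < b -> angle a < angle b.
Proof.
  intros H. apply (lt_of_derive angle speed); try lra.
  - intros; apply is_derive_angle.
  - intros; apply continuous_angle.
  - intros; apply speed_pos; lra.
Qed.

Lemma angle_le a b : 0 <= a <= b -> angle a <= angle b.
Proof.
  intros [H [H1|<-]]; [left; now apply angle_increasing|lra].
Qed.

Lemma angle_lt_inv a b : 0 <= a -> 0 <= b -> angle a < angle b -> a < b.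
Proof.
  intros Ha Hb H. apply Rnot_le_lt. intros Hle. assert (A := angle_le b a (conj Hb Hle)). lra.
Qed.

Lemma zero_iff_sin x : f x = 0 <-> sin (angle x) = 0.
Proof.
  destruct (polar x) as [A _].
  assert (S : 0 < sqrt (f x ^ 2 + p x ^ 2)) by apply sqrt_lt_R0, profile_nonzero.
  split; intros H.
  - rewrite H in A at 1. symmetry in A. apply Rmult_integral in A. destruct A; [lra|trivial].
  - rewrite A, H. ring.
Qed.

End Profile.

Lemma sin_lip a b : Rabs (sin a - sin b) <= Rabs (a - b).
Proof.
  assert (W : forall a b, a <= b -> Rabs (sin b - sin a) <= b - a).
  { clear. intros a b H.
    apply (abs_le_of_derive sin (fun x => x) cos (fun _ => 1)); trivial; intros x _.
    - apply is_derive_sin.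
    - apply (is_derive_id x).
    - apply (continuous_of_derive _ _ _ (is_derive_sin x)).
    - apply continuous_id.
    - apply Rabs_le, COS_bound. }
  destruct (Rle_dec a b).
  - rewrite Rabs_minus_sym, (Rabs_minus_sym a b), (Rabs_pos_eq (b - a)) by lra. now apply W.
  - rewrite (Rabs_pos_eq (a - b)) by lra. apply W. lra.
Qed.

(** Gronwall for the squared distance of two solutions: the difference of the
    forces is at most [3 C^2] times the difference of the positions. *)
Lemma profile_lipschitz C X c1 c2 f1 p1 n1 f2 p2 n2 :
  0 < c1 <= C -> 0 < c2 <= C -> 0 <= X ->
  profile c1 f1 p1 n1 -> profile c2 f2 p2 n2 ->
  Rabs (p1 X - p2 X) <= Rabs (c1 - c2) * exp ((1 + 3 * C ^ 2) * X) /\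
  Rabs (f1 X - f2 X) <= Rabs (c1 - c2) * exp ((1 + 3 * C ^ 2) * X).
Proof.
  intros H1 H2 HX S1 S2. set (K := 1 + 3 * C ^ 2).
  assert (HK : 0 < K) by (unfold K; nra).
  set (D := fun x => (f1 x - f2 x) ^ 2 + (p1 x - p2 x) ^ 2).
  set (dD := fun x => 2 * (f1 x - f2 x) * (p1 x - p2 x) - 2 * (p1 x - p2 x) * (n1 x - n2 x)).
  assert (Hd : forall x, is_derive D x (dD x)).
  { intros x. unfold D, dD.
    assert (A1 := profile_df _ _ _ _ S1 x). assert (A2 := profile_df _ _ _ _ S2 x).
    assert (B1 := profile_dp _ _ _ _ S1 x). assert (B2 := profile_dp _ _ _ _ S2 x).
    auto_derive. repeat split; trivial; try (eexists; eassumption).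
    replace (Derive (fun x0 : R => f1 x0) x) with (p1 x) by (symmetry; now apply is_derive_unique).
    replace (Derive (fun x0 : R => f2 x0) x) with (p2 x) by (symmetry; now apply is_derive_unique).
    replace (Derive (fun x0 : R => p1 x0) x) with (- n1 x) by (symmetry; now apply is_derive_unique).
    replace (Derive (fun x0 : R => p2 x0) x) with (- n2 x) by (symmetry; now apply is_derive_unique).
    ring. }
  assert (G := gronwall D dD (2 * K) 0 X HX).
  assert (HG : D X <= (D 0 + 0 * X) * exp (2 * K * X)).
  { apply G; try lra; auto.
    - intros x Hx. exact (continuous_of_derive _ _ _ (Hd x)).
    - intros x Hx. unfold dD, D.
      rewrite (profile_n _ _ _ _ S1), (profile_n _ _ _ _ S2) by lra.
      assert (F1 := profile_f_le _ _ _ _ S1 x ltac:(lra)). assert (F2 := profile_f_le _ _ _ _ S2 x ltac:(lra)).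
      assert (P := csch2_pos x ltac:(lra)). assert (P2 := csch2_le_inv_sqr x ltac:(lra)).
      set (a := f1 x) in *. set (b := f2 x) in *.
      assert (A1 : Rabs a <= C * x) by nra. assert (B1 : Rabs b <= C * x) by nra.
      assert (Q : 0 <= csch2 x * (a ^ 2 + a * b + b ^ 2) <= 3 * C ^ 2).
      { apply Rabs_le_between in A1. apply Rabs_le_between in B1.
        assert (0 <= a ^ 2 + a * b + b ^ 2) by nra.
        assert (a ^ 2 + a * b + b ^ 2 <= 3 * C ^ 2 * x ^ 2) by nra.
        split. nra.
        apply Rle_trans with (csch2 x * (3 * C ^ 2 * x ^ 2)). nra.
        replace (csch2 x * (3 * C ^ 2 * x ^ 2)) with (csch2 x * x ^ 2 * (3 * C ^ 2)) by ring. nra. }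
      replace (csch2 x * a ^ 3 - csch2 x * b ^ 3) with (csch2 x * (a ^ 2 + a * b + b ^ 2) * (a - b)) by ring.
      set (q := csch2 x * (a ^ 2 + a * b + b ^ 2)) in *. 
      set (u := a - b). set (v := p1 x - p2 x). unfold K. set (k := 3 * C ^ 2) in *.
      assert (0 <= (u - v) ^ 2) by apply pow2_ge_0. assert (0 <= (u + v) ^ 2) by apply pow2_ge_0.
      assert (0 <= u ^ 2) by apply pow2_ge_0. assert (0 <= v ^ 2) by apply pow2_ge_0.
      assert (- 2 * v * (q * u) <= q * (u ^ 2 + v ^ 2)) by nra.
      assert (q * (u ^ 2 + v ^ 2) <= k * (u ^ 2 + v ^ 2)) by (apply Rmult_le_compat_r; lra).
      nra. }
  unfold D in HG at 2.
  rewrite (profile_0 _ _ _ _ S1), (profile_0 _ _ _ _ S2), (profile_p0 _ _ _ _ S1), (profile_p0 _ _ _ _ S2) in HG.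
  assert (T : exp (2 * K * X) = exp (K * X) ^ 2).
  { simpl. rewrite Rmult_1_r, <- exp_plus. f_equal. ring. }
  rewrite T in HG. set (E := exp (K * X)) in *.
  assert (HE : 0 < E) by apply exp_pos.
  assert (HZ : D X <= (Rabs (c1 - c2) * E) ^ 2).
  { rewrite Rpow_mult_distr. rewrite pow2_abs. lra. }
  assert (HA := Rabs_pos (c1 - c2)).
  assert (HP : 0 <= Rabs (c1 - c2) * E) by nra.
  unfold D in HZ.
  assert (0 <= (f1 X - f2 X) ^ 2) by apply pow2_ge_0. assert (0 <= (p1 X - p2 X) ^ 2) by apply pow2_ge_0.
  split; rewrite <- (Rabs_pos_eq (Rabs (c1 - c2) * E)) by trivial; apply Rsqr_le_abs_0;
    rewrite !Rsqr_pow2; lra.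
Qed.

(** Gronwall for the squared difference of the angles, by [speed_polar].  The
    coefficients [csch2 x * f x ^ 2] are uniformly close down to [x = 0] because
    the positions differ by a multiple of [x]. *)
Lemma angle_lipschitz C X : 0 < C -> 0 <= X -> exists L, 0 < L /\
  forall c1 c2 f1 p1 n1 f2 p2 n2,
  0 < c1 <= C -> 0 < c2 <= C ->
  profile c1 f1 p1 n1 -> profile c2 f2 p2 n2 ->
  Rabs (angle f1 p1 n1 X - angle f2 p2 n2 X) <= L * Rabs (c1 - c2).
Proof.
  intros HC HX. set (E := exp ((1 + 3 * C ^ 2) * X)).
  set (K := 4 * (C ^ 2 + 1) + 1).
  assert (HE : 0 < E) by apply exp_pos.
  assert (HL : 0 < (2 * C * E) ^ 2 * (X + 1) * exp (K * X)).
  { apply Rmult_lt_0_compat; [|apply exp_pos]. apply Rmult_lt_0_compat; [|lra].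
    apply pow_lt. nra. }
  exists (sqrt ((2 * C * E) ^ 2 * (X + 1) * exp (K * X))). split. now apply sqrt_lt_R0.
  intros c1 c2 f1 p1 n1 f2 p2 n2 H1 H2 S1 S2.
  set (th1 := angle f1 p1 n1). set (th2 := angle f2 p2 n2).
  set (d := Rabs (c1 - c2)). assert (Hd0 : 0 <= d) by apply Rabs_pos.
  set (eps := 2 * C * E * d).
  assert (Heps : 0 <= eps) by (apply Rmult_le_pos; nra).
  assert (Hf : forall x, 0 < x <= X -> Rabs (f1 x - f2 x) <= d * E * x).
  { intros x Hx.
    assert (A := abs_le_of_derive (fun x => f1 x - f2 x) (fun x => d * E * x)
       (fun x => p1 x - p2 x) (fun _ => d * E) 0 x ltac:(lra)). cbv beta in A.
    rewrite (profile_0 _ _ _ _ S1), (profile_0 _ _ _ _ S2), Rmult_0_r, !Rminus_0_r in A.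
    apply A; intros y Hy.
    - apply (is_derive_minus f1 f2). apply (profile_df _ _ _ _ S1). apply (profile_df _ _ _ _ S2).
    - auto_derive; trivial; ring.
    - apply (continuous_minus f1 f2). apply (profile_cf _ _ _ _ S1). apply (profile_cf _ _ _ _ S2).
    - apply (continuous_of_derive _ y (d * E)). auto_derive; trivial; ring.
    - eapply Rle_trans. apply (profile_lipschitz C y c1 c2 f1 p1 n1 f2 p2 n2); trivial; lra.
      apply Rmult_le_compat_l; trivial. left. apply exp_increasing.
      apply Rmult_lt_compat_l; nra. }
  set (Z := fun x => (th1 x - th2 x) ^ 2).
  set (dZ := fun x => 2 * (th1 x - th2 x) * (speed f1 p1 n1 x - speed f2 p2 n2 x)).
  assert (Hd : forall x, is_derive Z x (dZ x)).
  { intros x. unfold Z, dZ.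
    assert (A1 := is_derive_angle c1 f1 p1 n1 ltac:(lra) S1 x).
    assert (A2 := is_derive_angle c2 f2 p2 n2 ltac:(lra) S2 x).
    fold th1 in A1. fold th2 in A2.
    auto_derive. repeat split; trivial; try (eexists; eassumption).
    replace (Derive (fun x0 : R => th1 x0) x) with (speed f1 p1 n1 x) by (symmetry; now apply is_derive_unique).
    replace (Derive (fun x0 : R => th2 x0) x) with (speed f2 p2 n2 x) by (symmetry; now apply is_derive_unique).
    ring. }
  assert (G : Z X <= (Z 0 + eps ^ 2 * X) * exp (K * X)).
  { apply (gronwall Z dZ); auto.
    - unfold K; nra.
    - apply pow2_ge_0.
    - intros x _. exact (continuous_of_derive _ _ _ (Hd x)).
    - intros x Hx. unfold dZ, Z.
      rewrite (speed_polar c1), (speed_polar c2) by (trivial; lra).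
      fold th1. fold th2.
      assert (F1 := profile_f_le _ _ _ _ S1 x ltac:(lra)). assert (F2 := profile_f_le _ _ _ _ S2 x ltac:(lra)).
      specialize (Hf x ltac:(lra)).
      assert (P := csch2_pos x ltac:(lra)). assert (P2 := csch2_le_inv_sqr x ltac:(lra)).
      set (a := f1 x) in *. set (b := f2 x) in *.
      assert (A1 : Rabs a <= C * x) by nra. assert (B1 : Rabs b <= C * x) by nra.
      assert (Q1 : 0 <= csch2 x * a ^ 2 <= C ^ 2).
      { rewrite <- (pow2_abs a). assert (A0 := Rabs_pos a).
        assert (Rabs a ^ 2 <= C ^ 2 * x ^ 2) by nra.
        split. nra. apply Rle_trans with (csch2 x * (C ^ 2 * x ^ 2)). nra.
        replace (csch2 x * (C ^ 2 * x ^ 2)) with (csch2 x * x ^ 2 * C ^ 2) by ring. nra. }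
      assert (Q2 : Rabs (csch2 x * a ^ 2 - csch2 x * b ^ 2) <= eps).
      { replace (csch2 x * a ^ 2 - csch2 x * b ^ 2) with (csch2 x * ((a - b) * (a + b))) by ring.
        rewrite !Rabs_mult, (Rabs_pos_eq (csch2 x)) by lra.
        assert (T := Rabs_triang a b).
        assert (T0 := Rabs_pos (a + b)). assert (T1 := Rabs_pos (a - b)).
        apply Rle_trans with (csch2 x * ((d * E * x) * (2 * (C * x)))).
        apply Rmult_le_compat_l. lra. apply Rmult_le_compat; lra.
        replace (csch2 x * ((d * E * x) * (2 * (C * x)))) with (csch2 x * x ^ 2 * eps) by (unfold eps; ring).
        nra. }
      set (q1 := csch2 x * a ^ 2) in *. set (q2 := csch2 x * b ^ 2) in *.
      assert (C1 := sin2_cos2 (th1 x)). assert (C2 := sin2_cos2 (th2 x)).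
      rewrite !Rsqr_pow2 in C1, C2.
      assert (SL := sin_lip (th1 x) (th2 x)).
      assert (SB1 := SIN_bound (th1 x)). assert (SB2 := SIN_bound (th2 x)).
      set (s1 := sin (th1 x)) in *. set (s2 := sin (th2 x)) in *.
      replace (cos (th1 x) ^ 2) with (1 - s1 ^ 2) by lra.
      replace (cos (th2 x) ^ 2) with (1 - s2 ^ 2) by lra.
      set (t := th1 x - th2 x) in *.
      replace (1 - s1 ^ 2 + q1 * s1 ^ 2 - (1 - s2 ^ 2 + q2 * s2 ^ 2)) with
        ((q1 - 1) * (s1 + s2) * (s1 - s2) + (q1 - q2) * s2 ^ 2) by ring.
      assert (U1 : Rabs ((q1 - 1) * (s1 + s2) * (s1 - s2)) <= (C ^ 2 + 1) * 2 * Rabs t).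
      { rewrite !Rabs_mult. apply Rmult_le_compat; trivial.
        apply Rmult_le_pos; apply Rabs_pos. apply Rabs_pos.
        apply Rmult_le_compat; try apply Rabs_pos; apply Rabs_le; lra. }
      assert (U2 : Rabs ((q1 - q2) * s2 ^ 2) <= eps).
      { rewrite Rabs_mult. assert (V := Rabs_pos (q1 - q2)).
        assert (Rabs (s2 ^ 2) <= 1). { rewrite Rabs_pos_eq by apply pow2_ge_0. nra. }
        nra. }
      set (m1 := (q1 - 1) * (s1 + s2) * (s1 - s2)) in *. set (m2 := (q1 - q2) * s2 ^ 2) in *.
      assert (Rabs (m1 + m2) <= (C ^ 2 + 1) * 2 * Rabs t + eps).
      { eapply Rle_trans. apply Rabs_triang. lra. }
      assert (M : t * (m1 + m2) <= Rabs t * ((C ^ 2 + 1) * 2 * Rabs t + eps)).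
      { eapply Rle_trans. apply Rle_abs. rewrite Rabs_mult. apply Rmult_le_compat_l; trivial. apply Rabs_pos. }
      replace (t ^ 2) with (Rabs t ^ 2) by apply pow2_abs. unfold K.
      assert (0 <= (Rabs t - eps) ^ 2) by apply pow2_ge_0. nra. }
  assert (Z0 : Z 0 = 0) by (unfold Z, th1, th2; rewrite !angle_0; ring).
  rewrite Z0 in G.
  assert (EX : 0 < exp (K * X)) by apply exp_pos.
  rewrite <- (Rabs_pos_eq (sqrt _ * d)) by (apply Rmult_le_pos; trivial; apply sqrt_pos).
  apply Rsqr_le_abs_0. rewrite !Rsqr_pow2, Rpow_mult_distr, pow2_sqrt by lra.
  fold th1 th2. fold (Z X). eapply Rle_trans. exact G.
  replace ((2 * C * E) ^ 2 * (X + 1) * exp (K * X) * d ^ 2) with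
    (eps ^ 2 * (X + 1) * exp (K * X)) by (unfold eps; ring).
  apply Rmult_le_compat_r. lra. assert (0 <= eps ^ 2) by apply pow2_ge_0. lra.
Qed.

(** * Behaviour for large abscissae, small data and large data *)

Lemma abs_cube (a b : R) : Rabs a <= b -> Rabs (a ^ 3) <= b ^ 3.
Proof. intros H. rewrite <- RPow_abs. apply pow_incr. split; trivial. apply Rabs_pos. Qed.

Section Tail.
Variables (c : R) (f p n : R -> R).
Hypothesis c_pos : 0 < c.
Hypothesis sol : profile c f p n.

(** The function [18 d^3 / x^2] is the integral from [x] to infinity of the bound
    [36 d^3 / x^3] for the force. *)
Lemma slope_variation d a b :
  0 < a <= b -> (forall x, a <= x <= b -> Rabs (f x) <= d * x) ->
  Rabs (p b - p a) <= 18 * d ^ 3 / a ^ 2.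
Proof.
  intros Hab Hd.
  assert (Hd0 : 0 <= d).
  { assert (A := Hd a ltac:(lra)). assert (B := Rabs_pos (f a)). nra. }
  assert (Hd3 : 0 <= d ^ 3) by now apply pow_le.
  assert (Hg : forall x, 0 < x -> is_derive (fun x => - (18 * d ^ 3 / x ^ 2)) x (36 * d ^ 3 / x ^ 3)).
  { intros x Hx. auto_derive. apply Rgt_not_eq. nra. field. lra. }
  apply Rle_trans with (- (18 * d ^ 3 / b ^ 2) - - (18 * d ^ 3 / a ^ 2)).
  - apply (abs_le_of_derive p (fun x => - (18 * d ^ 3 / x ^ 2)) (fun x => - (csch2 x * f x ^ 3))
      (fun x => 36 * d ^ 3 / x ^ 3)); try lra.
    + intros x Hx. apply (profile_eq c f p n sol). lra.
    + intros x Hx. apply Hg. lra.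
    + intros x _. apply (profile_cp c f p n sol).
    + intros x Hx. refine (continuous_of_derive _ _ _ (Hg x _)). lra.
    + intros x Hx. specialize (Hd x ltac:(lra)). apply abs_cube in Hd.
      assert (P := csch2_pos x ltac:(lra)). assert (P6 := csch2_le_inv_pow6 x ltac:(lra)).
      rewrite Rabs_Ropp, Rabs_mult, (Rabs_pos_eq (csch2 x)) by lra.
      assert (0 < x ^ 3) by (apply pow_lt; lra).
      apply Rle_trans with (csch2 x * (d * x) ^ 3). nra.
      replace (csch2 x * (d * x) ^ 3) with (csch2 x * x ^ 6 * (d ^ 3 / x ^ 3)) by (field; lra).
      replace (36 * d ^ 3 / x ^ 3) with (36 * (d ^ 3 / x ^ 3)) by (field; lra).
      apply Rmult_le_compat_r; trivial. apply Rdiv_le_0_compat; lra.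
  - assert (0 <= 18 * d ^ 3 / b ^ 2) by (apply Rdiv_le_0_compat; [lra|apply pow_lt; lra]). lra.
Qed.

(** After a zero with slope [d] the energy keeps the slope at most [d], so [|f|]
    is at most [d x] and [slope_variation] leaves the slope no room to change
    sign. *)
Lemma no_late_zero a b : 18 * c ^ 2 < a ^ 2 -> 0 < a < b -> f a = 0 -> f b <> 0.
Proof.
  intros Ha Hab Fa.
  set (d := Rabs (p a)).
  assert (Hd : 0 < d).
  { apply Rabs_pos_lt. assert (A := profile_nonzero c f p n c_pos sol a). rewrite Fa in A. nra. }
  assert (Hdc : d <= c) by (apply (profile_p_le c f p n sol); lra).
  assert (Hp : forall x, a <= x -> Rabs (p x) <= d).
  { intros x Hx. apply Rsqr_le_abs_0. rewrite !Rsqr_pow2.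
    assert (E := energy_decreases f p a x ltac:(lra)).
    rewrite Fa in E.
    assert (E1 : p x ^ 2 + csch2 x * f x ^ 4 / 2 <= p a ^ 2 + csch2 a * 0 ^ 4 / 2).
    { apply E; intros y Hy. apply (profile_df c f p n sol). apply (profile_eq c f p n sol). lra. }
    assert (P := csch2_pos x ltac:(lra)). assert (Q := pow4_nonneg (f x)).
    assert (0 <= csch2 x * f x ^ 4) by nra. simpl in *. lra. }
  assert (Hf : forall x, a <= x -> Rabs (f x) <= d * x).
  { intros x Hx.
    assert (A := abs_le_of_derive f (fun x => d * x) p (fun _ => d) a x Hx). cbv beta in A.
    rewrite Fa, Rminus_0_r in A.
    apply Rle_trans with (d * x - d * a); [|nra].
    apply A; intros y Hy.
    - apply (profile_df c f p n sol).
    - auto_derive; trivial; ring.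
    - apply (profile_cf c f p n sol).
    - apply (continuous_of_derive _ y d). auto_derive; trivial; ring.
    - apply Hp; lra. }
  assert (Hs : forall x, a <= x -> 0 < p x * p a).
  { intros x Hx. assert (V := slope_variation d a x ltac:(lra)).
    specialize (V (fun y Hy => Hf y (proj1 Hy))).
    assert (V2 : 18 * d ^ 3 / a ^ 2 < d).
    { apply (Rmult_lt_reg_r (a ^ 2)). nra. unfold Rdiv. rewrite Rmult_assoc, Rinv_l by nra.
      assert (d ^ 2 <= c ^ 2) by nra. nra. }
    unfold d in V at 1, V2. unfold d in *. 
    destruct (Rcase_abs (p a)) as [N|N].
    - rewrite (Rabs_left (p a)) in * by trivial.
      assert (V3 : Rabs (p x - p a) < - p a) by lra. apply Rabs_lt_between in V3. nra.
    - rewrite (Rabs_pos_eq (p a)) in * by lra.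
      assert (V3 : Rabs (p x - p a) < p a) by lra. apply Rabs_lt_between in V3. nra. }
  assert (f a * p a < f b * p a).
  { apply (lt_of_derive (fun x => f x * p a) (fun x => p x * p a)). lra.
    - intros x Hx. assert (A := profile_df c f p n sol x).
      auto_derive. exists (p x); trivial.
      replace (Derive (fun x0 : R => f x0) x) with (p x) by (symmetry; now apply is_derive_unique). ring.
    - intros x _. apply (continuous_mult f (fun _ => p a)). apply (profile_cf c f p n sol). apply continuous_const.
    - intros x Hx. apply Hs. lra. }
  rewrite Fa in H. intros Fb. rewrite Fb in H. lra.
Qed.

Lemma slope_initial x : 0 <= x -> Rabs (p x - c) <= c ^ 3 * x ^ 2 / 2.
Proof.
  intros Hx. assert (P0 := profile_p0 c f p n sol).
  assert (A := abs_le_of_derive p (fun x => c ^ 3 * x ^ 2 / 2) (fun x => - (csch2 x * f x ^ 3))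
    (fun x => c ^ 3 * x) 0 x Hx). cbv beta in A. rewrite P0 in A.
  apply Rle_trans with (c ^ 3 * x ^ 2 / 2 - c ^ 3 * 0 ^ 2 / 2); [|simpl; lra].
  assert (Hg : forall y, is_derive (fun x => c ^ 3 * x ^ 2 / 2) y (c ^ 3 * y)).
  { intros y. auto_derive; trivial. field. }
  apply A; intros y Hy; trivial.
  - apply (profile_eq c f p n sol). lra.
  - apply (profile_cp c f p n sol).
  - exact (continuous_of_derive _ _ _ (Hg y)).
  - assert (F := profile_f_le c f p n sol y ltac:(lra)). apply abs_cube in F.
    assert (P := csch2_pos y ltac:(lra)). assert (P3 := csch2_cube_le y ltac:(lra)).
    rewrite Rabs_Ropp, Rabs_mult, (Rabs_pos_eq (csch2 y)) by lra.
    apply Rle_trans with (csch2 y * (c * y) ^ 3). nra.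
    replace (csch2 y * (c * y) ^ 3) with (c ^ 3 * (csch2 y * y ^ 3)) by ring.
    apply Rmult_le_compat_l; trivial. apply pow_le; lra.
Qed.

(** The slope loses at most [c^3 / 2] on the unit interval and [18 c^3]
    afterwards. *)
Lemma small_data_positive x : c <= / 10 -> 0 < x -> 0 < f x.
Proof.
  intros Hc Hx. rewrite <- (profile_0 c f p n sol).
  assert (C3 : 0 < c ^ 3) by now apply pow_lt.
  assert (C4 : c ^ 3 <= c / 100) by nra.
  apply (lt_of_derive f p); trivial.
  - intros; apply (profile_df c f p n sol).
  - intros; apply (profile_cf c f p n sol).
  - intros y Hy.
    assert (S1 : forall z, 0 <= z <= 1 -> c - c ^ 3 / 2 <= p z).
    { intros z Hz. assert (A := slope_initial z ltac:(lra)).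
      apply Rabs_le_between in A. assert (z ^ 2 <= 1) by nra. nra. }
    destruct (Rle_lt_dec y 1) as [H1|H1].
    + specialize (S1 y ltac:(lra)). lra.
    + assert (V := slope_variation c 1 y ltac:(lra)).
      specialize (V (fun z Hz => profile_f_le c f p n sol z ltac:(lra))).
      apply Rabs_le_between in V. specialize (S1 1 ltac:(lra)).
      replace (18 * c ^ 3 / 1 ^ 2) with (18 * c ^ 3) in V by field. lra.
Qed.

(** At [x = 1 / c] the slope is still at least [c / 2]; this gives an amplitude
    independent of [c]. *)
Lemma growth_initial : / 8 <= growth f p (/ c).
Proof.
  assert (Hx : 0 < / c) by now apply Rinv_0_lt_compat.
  assert (A := slope_initial (/ c) ltac:(lra)). apply Rabs_le_between in A.
  replace (c ^ 3 * (/ c) ^ 2 / 2) with (c / 2) in A by (field; lra).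
  assert (P : c / 2 <= p (/ c)) by lra.
  unfold growth. assert (Q := pow4_nonneg (f (/ c))).
  assert (S := sinh_ge (/ c) ltac:(lra)). assert (0 < (/ c) ^ 3) by now apply pow_lt.
  assert (T : / 2 <= sinh (/ c) * p (/ c)).
  { replace (/ 2) with (/ c * (c / 2)) by (field; lra). apply Rmult_le_compat; lra. }
  replace (sinh (/ c) ^ 2 * p (/ c) ^ 2) with ((sinh (/ c) * p (/ c)) ^ 2) by ring. nra.
Qed.

End Tail.

(** Positivity cannot last beyond a fixed multiple of the starting point, by
    scale-invariant estimates.  The lower bound on [growth] says that at each [x]
    either [F] or [x |P|] is not small.  While the slope is positive [F] gains a fixed
    amount each time [x] doubles, but it is bounded; so the slope becomes
    nonpositive, then definitely negative, and concavity brings [F] down to 0. *)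
Lemma bounded_positivity : exists R0, 1 < R0 /\ forall (F P : R -> R) (y : R),
  0 < y -> R0 * y <= 1 ->
  (forall x, 0 < x -> is_derive F x (P x)) ->
  (forall x, 0 < x -> is_derive P x (- (csch2 x * F x ^ 3))) ->
  (forall x, y <= x <= R0 * y -> / 8 <= growth F P x) ->
  0 <= F y -> (forall x, y < x <= R0 * y -> 0 < F x) -> False.
Proof.
  (* J is the number of doublings, each with a gain of at least
     (1/12)^3 / 16 = 1/27648, that would lead beyond the bound 4. *)
  destruct (INR_unbounded (4 * 27648)) as [J HJ].
  set (K1 := 2 ^ (J + 3)).
  assert (HK1 : 8 <= K1).
  { unfold K1. rewrite pow_add. assert (1 <= 2 ^ J) by (apply pow_R1_Rle; lra). simpl; lra. }
  exists (66 * K1). split. lra.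
  intros F P y Hy HR HF HP HG F0 Fpos.
  assert (KR : K1 * y <= 66 * K1 * y) by nra.
  assert (K8 : 8 * y <= K1 * y) by nra.
  assert (Fnn : forall x, y <= x <= 66 * K1 * y -> 0 <= F x).
  { intros x [[Hx|<-] Hx2]; trivial. left. apply Fpos; lra. }
  assert (CF : forall x, 0 < x -> continuous F x).
  { intros x Hx. exact (continuous_of_derive _ _ _ (HF x Hx)). }
  assert (CP : forall x, 0 < x -> continuous P x).
  { intros x Hx. exact (continuous_of_derive _ _ _ (HP x Hx)). }
  assert (Pdec : forall a b, y <= a -> a <= b -> b <= 66 * K1 * y -> P b <= P a).
  { intros a b Ha Hab Hb. cut (- P a <= - P b); [lra|].
    apply (le_of_derive (fun x => - P x) (fun x => - - (csch2 x * F x ^ 3))); trivial.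
    - intros x Hx. apply (is_derive_opp P). apply HP. lra.
    - intros x Hx. apply (continuous_opp P). apply CP. lra.
    - intros x Hx. assert (H := csch2_pos x ltac:(lra)). assert (0 <= F x) by (apply Fnn; lra).
      assert (0 <= F x ^ 3) by now apply pow_le. nra. }
  assert (Chord : forall a b, y <= a -> a <= b -> b <= 66 * K1 * y ->
    P b * (b - a) <= F b - F a <= P a * (b - a)).
  { intros a b Ha Hab Hb. split.
    - cut (F a - P b * a <= F b - P b * b); [lra|].
      apply (le_of_derive (fun x => F x - P b * x) (fun x => P x - P b)); trivial.
      + intros x Hx. apply (is_derive_minus F (fun x => P b * x)). apply HF; lra.
        auto_derive; trivial; ring.
      + intros x Hx. apply (continuous_minus F (fun x => P b * x)). apply CF; lra.
        apply (continuous_of_derive _ x (P b)). auto_derive; trivial; ring.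
      + intros x Hx. assert (P b <= P x) by (apply Pdec; lra). lra.
    - cut (P a * a - F a <= P a * b - F b); [lra|].
      apply (le_of_derive (fun x => P a * x - F x) (fun x => P a - P x)); trivial.
      + intros x Hx. apply (is_derive_minus (fun x => P a * x) F).
        auto_derive; trivial; ring. apply HF; lra.
      + intros x Hx. apply (continuous_minus (fun x => P a * x) F).
        apply (continuous_of_derive _ x (P a)). auto_derive; trivial; ring. apply CF; lra.
      + intros x Hx. assert (P x <= P a) by (apply Pdec; lra). lra. }
  (* The integral of the force from x to 2 x is at least that of m^3 / (4 s^2). *)
  assert (Loss : forall x m, y <= x -> 2 * x <= 66 * K1 * y -> 0 <= m ->
    (forall s, x <= s <= 2 * x -> m <= F s) -> P (2 * x) <= P x - m ^ 3 / (8 * x)).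
  { intros x m Hx Hx2 Hm HmF.
    assert (Hd : forall s, 0 < s -> is_derive (fun s => m ^ 3 / 4 * / s - P s) s
      (- (m ^ 3 / 4 * / s ^ 2) - - (csch2 s * F s ^ 3))).
    { intros s Hs. apply (is_derive_minus (fun s => m ^ 3 / 4 * / s) P); [|now apply HP].
      auto_derive. lra. field. lra. }
    assert (A : m ^ 3 / 4 * / x - P x <= m ^ 3 / 4 * / (2 * x) - P (2 * x)).
    { apply (le_of_derive (fun s => m ^ 3 / 4 * / s - P s)
        (fun s => - (m ^ 3 / 4 * / s ^ 2) - - (csch2 s * F s ^ 3))). lra.
      - intros s Hs. apply Hd; lra.
      - intros s Hs. refine (continuous_of_derive _ _ _ (Hd s _)). lra.
      - intros s Hs. assert (H1 := csch2_ge_inv_sqr s ltac:(lra)).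
        assert (m ^ 3 <= F s ^ 3). { apply pow_incr. split; trivial. apply HmF; lra. }
        assert (0 <= m ^ 3) by now apply pow_le.
        assert (Hs2 : 0 < s ^ 2) by (apply pow_lt; lra).
        assert (H2 : / s ^ 2 / 4 <= csch2 s).
        { apply (Rmult_le_reg_r (4 * s ^ 2)). lra. field_simplify; lra. }
        assert (0 < / s ^ 2) by now apply Rinv_0_lt_compat.
        assert (/ s ^ 2 / 4 * m ^ 3 <= csch2 s * F s ^ 3) by (apply Rmult_le_compat; lra). lra. }
    replace (m ^ 3 / 4 * / (2 * x)) with (m ^ 3 / (8 * x)) in A by (field; lra).
    replace (m ^ 3 / 4 * / x) with (2 * (m ^ 3 / (8 * x))) in A by (field; lra). lra. }
  assert (Dich : forall x, y <= x <= 66 * K1 * y -> / 2 <= F x \/ / 6 <= x * Rabs (P x)).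
  { intros x Hx. destruct (Rle_lt_dec (/ 2) (F x)) as [H|H]; [now left|right].
    assert (G := HG x Hx). unfold growth in G. assert (F1 := Fnn x Hx).
    assert (F x ^ 4 <= / 16). { replace (/ 16) with ((/ 2) ^ 4) by field. apply pow_incr. lra. }
    assert (S := sinh_le x ltac:(lra)). assert (S0 := sinh_pos x ltac:(lra)).
    assert (sinh x ^ 2 * P x ^ 2 <= 4 * (x * Rabs (P x)) ^ 2).
    { rewrite Rpow_mult_distr, pow2_abs. assert (0 <= P x ^ 2) by apply pow2_ge_0.
      assert (sinh x ^ 2 <= 4 * x ^ 2) by nra. nra. }
    apply Rnot_lt_le. intros Hlt. assert (A := Rabs_pos (P x)).
    assert (0 <= x * Rabs (P x)) by nra. nra. }
  (* Otherwise F increases: by Loss it gains at least 1/27648 whenever x doubles,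
     since it starts from at least 1/12, yet Loss and Chord together give F <= 4;
     J doublings are too many. *)
  assert (exists z, y <= z <= K1 * y /\ P z <= 0) as [z [Hz Pz]].
  { apply NNPP. intros Hno.
    assert (Ppos : forall x, y <= x <= K1 * y -> 0 < P x).
    { intros x Hx. apply Rnot_le_lt. intros H. apply Hno. now exists x. }
    assert (Fle : forall a b, y <= a -> a <= b -> b <= K1 * y -> F a <= F b).
    { intros a b Ha Hab Hb. assert (C := Chord a b Ha Hab ltac:(lra)).
      assert (0 < P b) by (apply Ppos; lra). nra. }
    assert (F2 : / 12 <= F (2 * y)).
    { destruct (Dich (2 * y) ltac:(lra)) as [H|H]. lra.
      assert (P2 : 0 < P (2 * y)) by (apply Ppos; lra). rewrite Rabs_pos_eq in H by lra.
      assert (C := Chord y (2 * y) ltac:(lra) ltac:(lra) ltac:(lra)). nra. }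
    assert (Slope : forall x, 2 * y <= x -> 2 * x <= K1 * y -> F x ^ 3 <= 8 * x * P x).
    { intros x Hx Hx2. assert (L := Loss x (F x) ltac:(lra) ltac:(lra)).
      specialize (L (Fnn x ltac:(lra))).
      assert (P (2 * x) <= P x - F x ^ 3 / (8 * x)). { apply L. intros s Hs. apply Fle; lra. }
      assert (0 < P (2 * x)) by (apply Ppos; lra).
      assert (H1 : F x ^ 3 / (8 * x) <= P x) by lra.
      apply (Rmult_le_compat_r (8 * x)) in H1; [|lra].
      unfold Rdiv in H1. rewrite Rmult_assoc, Rinv_l in H1 by lra. lra. }
    assert (Cap : forall x, 2 * y <= x -> 2 * x <= K1 * y -> F x <= 4).
    { intros x Hx Hx2. assert (S := Slope x Hx Hx2).
      assert (C := Chord y x ltac:(lra) ltac:(lra) ltac:(lra)).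
      assert (Px : 0 < P x) by (apply Ppos; lra).
      assert (F x >= x / 2 * P x) by nra.
      apply Rnot_lt_le. intros H4.
      assert (16 * F x < F x ^ 3) by (replace (F x ^ 3) with (F x * F x * F x) by ring; nra).
      nra. }
    assert (Step : forall j, (j <= J)%nat -> / 12 + INR j * / 27648 <= F (2 ^ (S j) * y)).
    { induction j as [|j IH]; intros Hj.
      - simpl. replace (2 * 1 * y) with (2 * y) by ring. lra.
      - specialize (IH ltac:(lia)). rewrite S_INR.
        set (x := 2 ^ S j * y) in *.
        replace (2 ^ S (S j) * y) with (2 * x) by (unfold x; simpl; ring).
        assert (Hx1 : 2 * y <= x).
        { unfold x. simpl. assert (1 <= 2 ^ j) by (apply pow_R1_Rle; lra). nra. }
        assert (Hx2 : 4 * x <= K1 * y).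
        { unfold x, K1. replace (4 * (2 ^ S j * y)) with (2 ^ (j + 3) * y) by (rewrite pow_add; simpl; ring).
          apply Rmult_le_compat_r. lra. apply Rle_pow; [lra|lia]. }
        assert (S := Slope (2 * x) ltac:(lra) ltac:(lra)).
        assert (C := Chord x (2 * x) ltac:(lra) ltac:(lra) ltac:(lra)).
        assert (0 <= INR j) by apply pos_INR.
        assert (F x <= F (2 * x)) by (apply Fle; lra).
        assert ((/ 12) ^ 3 <= F (2 * x) ^ 3) by (apply pow_incr; lra). simpl in *. lra. }
    specialize (Step J (le_n _)).
    assert (F (2 ^ S J * y) <= 4).
    { apply Cap; unfold K1; rewrite ?pow_add; simpl;
      assert (1 <= 2 ^ J) by (apply pow_R1_Rle; lra); nra. }
    lra. }
  (* At 2 z the slope is at most - F / (64 z), so F is used up before 66 z. *)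
  assert (Hz66 : 66 * z <= 66 * K1 * y) by lra.
  assert (P2 : P (2 * z) <= 0). { assert (P (2 * z) <= P z) by (apply Pdec; lra). lra. }
  assert (Fdec : forall s, z <= s <= 2 * z -> F (2 * z) <= F s).
  { intros s Hs. assert (C := Chord s (2 * z) ltac:(lra) ltac:(lra) ltac:(lra)).
    assert (P s <= P z) by (apply Pdec; lra). nra. }
  assert (L := Loss z (F (2 * z)) ltac:(lra) ltac:(lra) ltac:(apply Fnn; lra) Fdec).
  assert (Fz : 0 < F (2 * z)) by (apply Fpos; lra).
  assert (Hfall : P (2 * z) * (64 * z) <= - F (2 * z)).
  { set (m := F (2 * z)) in *.
    assert (L1 : P (2 * z) * (64 * z) <= - (8 * m ^ 3)).
    { replace (8 * m ^ 3) with (m ^ 3 / (8 * z) * (64 * z)) by (field; lra). nra. }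
    destruct (Rle_lt_dec 1 m) as [H|H].
    - assert (m <= m ^ 3) by (replace (m ^ 3) with (m * m * m) by ring; nra). lra.
    - destruct (Dich (2 * z) ltac:(lra)) as [D|D].
      + fold m in D. assert (/ 8 <= m ^ 3). { replace (/ 8) with ((/ 2) ^ 3) by field. apply pow_incr. lra. }
        lra.
      + rewrite Rabs_left1 in D by lra. lra. }
  assert (C := Chord (2 * z) (66 * z) ltac:(lra) ltac:(lra) ltac:(lra)).
  assert (0 < F (66 * z)) by (apply Fpos; lra).
  nra.
Qed.

(** * Shooting *)

Lemma sign_between (f : R -> R) (x y : R) :
  (forall t, continuous f t) -> x <= y -> (forall t, x <= t <= y -> f t <> 0) -> 0 < f x * f y.
Proof.
  intros Cf Hxy Hnz. apply Rnot_le_lt. intros H.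
  destruct (IVT_gen f x y 0) as [t [Ht Ft]].
  - intros t. apply continuity_pt_filterlim, Cf.
  - unfold Rmin, Rmax. destruct (Rle_dec (f x) (f y)); nra.
  - rewrite Rmin_left, Rmax_right in Ht by lra. exact (Hnz t Ht Ft).
Qed.

Lemma sign_choice (f : R -> R) (a : R) : f a <> 0 -> exists e, e ^ 2 = 1 /\ forall b, 0 < f a * f b -> 0 < e * f b.
Proof.
  intros H. destruct (Rdichotomy _ _ H) as [H1|H1].
  - exists (-1). split. ring. intros b Hb. nra.
  - exists 1. split. ring. intros b Hb. nra.
Qed.

Lemma sin_multiple (m : nat) : sin (INR m * PI) = 0.
Proof. apply sin_eq_0_1. exists (Z.of_nat m). now rewrite <- INR_IZR_INZ. Qed.

(** The angle at a zero is a multiple of [PI], so passing one multiple means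
    reaching at least the next. *)
Lemma sin_zero_next (m : nat) (t : R) : sin t = 0 -> INR m * PI < t -> INR (S m) * PI <= t.
Proof.
  intros H Ht. destruct (sin_eq_0_0 t H) as [k ->]. assert (HP := PI_RGT_0).
  apply Rmult_le_compat_r. lra. apply Rmult_lt_reg_r in Ht; [|lra].
  rewrite INR_IZR_INZ in *. apply IZR_le. apply lt_IZR in Ht. lia.
Qed.

(** The solution has at least [m] zeros at positive abscissae (for positive [m]).
    The angle turns this count into inequalities that are stable under
    perturbation. *)
Definition reaches (m : nat) (f p n : R -> R) : Prop :=
  exists x, 0 <= x /\ INR m * PI <= angle f p n x.

Section Reach.
Variables (c : R) (f p n : R -> R).
Hypothesis c_pos : 0 < c.
Hypothesis sol : profile c f p n.

Lemma angle_hits x v : 0 <= x -> 0 <= v <= angle f p n x -> exists y, 0 <= y <= x /\ angle f p n y = v.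
Proof.
  intros Hx Hv. destruct (IVT_gen (angle f p n) 0 x v) as [y [Hy Ay]].
  - intros t. apply continuity_pt_filterlim. exact (continuous_angle c f p n c_pos sol t).
  - rewrite angle_0, Rmin_left, Rmax_right; lra.
  - rewrite Rmin_left, Rmax_right in Hy by lra. now exists y.
Qed.

Lemma small_data_no_reach m : c <= / 10 -> ~ reaches (S m) f p n.
Proof.
  intros Hc [x [Hx Ha]]. assert (HP := PI_RGT_0).
  rewrite S_INR in Ha. assert (H0 := pos_INR m).
  destruct (angle_hits x PI Hx) as [y [Hy Ay]]. nra.
  assert (Y : 0 < y).
  { destruct (proj1 Hy) as [Y|Y]; trivial. rewrite <- Y, angle_0 in Ay. lra. }
  assert (F := small_data_positive c f p n c_pos sol y Hc Y).
  assert (Z : f y = 0).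
  { apply (zero_iff_sin c f p n c_pos sol). rewrite Ay. apply sin_PI. }
  lra.
Qed.

Lemma not_reached_lt m x : ~ reaches m f p n -> 0 <= x -> angle f p n x < INR m * PI.
Proof. intros H Hx. apply Rnot_le_lt. intros H1. apply H. now exists x. Qed.

End Reach.

(** A solution without zero has a constant sign [e], and [bounded_positivity]
    applies to [e f]. *)
Lemma next_zero : exists R0, 1 < R0 /\ forall c f p n y,
  0 < c -> profile c f p n -> 0 < y -> R0 * y <= 1 -> / 8 <= growth f p y ->
  exists z, y < z <= R0 * y /\ f z = 0.
Proof.
  destruct bounded_positivity as [R0 [HR0 H]]. exists R0. split; trivial.
  intros c f p n y Hc sol Hy Hy1 HG. apply NNPP. intros Hno.
  assert (Cf := profile_cf c f p n sol).
  assert (Hyy : y < R0 * y) by nra.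
  assert (Hnz : forall x, y < x <= R0 * y -> f x <> 0).
  { intros x Hx Fx. apply Hno. now exists x. }
  destruct (sign_choice f (R0 * y)) as [e [He Hs]]. apply Hnz; lra.
  assert (Pos : forall x, y < x <= R0 * y -> 0 < e * f x).
  { intros x Hx. apply Hs. rewrite Rmult_comm. apply sign_between; trivial; try lra.
    intros t Ht. apply Hnz. lra. }
  apply (H (fun x => e * f x) (fun x => e * p x) y Hy Hy1); trivial.
  - intros x Hx. apply (is_derive_scal f). apply (profile_df c f p n sol).
  - intros x Hx. replace (- (csch2 x * (e * f x) ^ 3)) with (e * (- (csch2 x * f x ^ 3))).
    apply (is_derive_scal p). apply (profile_eq c f p n sol). lra.
    replace ((e * f x) ^ 3) with (e ^ 2 * e * f x ^ 3) by ring. rewrite He. ring.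
  - intros x Hx. unfold growth.
    replace ((e * p x) ^ 2) with (e ^ 2 * p x ^ 2) by ring.
    replace ((e * f x) ^ 4) with (e ^ 2 * e ^ 2 * f x ^ 4) by ring. rewrite He, !Rmult_1_l.
    eapply Rle_trans. exact HG. apply (growth_increases c f p n sol). lra.
  - apply Rnot_lt_le. intros Hlt.
    assert (Ce : continuous (fun x => e * f x) y).
    { apply (continuous_mult (fun _ => e) f). apply continuous_const. apply Cf. }
    destruct (proj1 (continuous_eps _ _) Ce (- (e * f y))) as [d [Hd Hn]]. lra.
    set (z := Rmin (y + d / 2) (R0 * y)).
    assert (Z1 : z <= y + d / 2) by apply Rmin_l. assert (Z2 : z <= R0 * y) by apply Rmin_r.
    assert (Z3 : y < z) by (apply Rmin_glb_lt; lra).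
    specialize (Hn z). rewrite (Rabs_pos_eq (z - y)) in Hn by lra. specialize (Hn ltac:(lra)).
    specialize (Pos z ltac:(lra)). rewrite Rabs_pos_eq in Hn by lra. lra.
Qed.

(** [next_zero] is used [m] times from [x = 1 / c]; the lower bound on [growth]
    persists, and [c >= R0 ^ m] keeps all the abscissae in the unit interval. *)
Lemma many_zeros (m : nat) : exists C, 1 <= C /\ forall c f p n,
  C <= c -> profile c f p n -> reaches m f p n.
Proof.
  destruct next_zero as [R0 [HR0 H]].
  assert (HRm : 1 <= R0 ^ m) by (apply pow_R1_Rle; lra).
  exists (R0 ^ m). split; trivial. intros c f p n Hc sol.
  assert (c_pos : 0 < c) by lra.
  assert (Hi : 0 < / c) by now apply Rinv_0_lt_compat.
  assert (Hm : R0 ^ m * / c <= 1).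
  { apply (Rmult_le_reg_r c); trivial. rewrite Rmult_assoc, Rinv_l by lra. lra. }
  assert (Main : forall j, (j <= m)%nat -> INR j * PI <= angle f p n (R0 ^ j * / c)).
  { induction j as [|j IH]; intros Hj.
    - simpl. rewrite Rmult_0_l, Rmult_1_l, <- (angle_0 f p n).
      apply (angle_le c f p n c_pos sol). lra.
    - specialize (IH ltac:(lia)).
      assert (Rj : 1 <= R0 ^ j) by (apply pow_R1_Rle; lra).
      set (y := R0 ^ j * / c) in *.
      assert (Hy : / c <= y) by (unfold y; nra).
      replace (R0 ^ S j * / c) with (R0 * y) by (unfold y; simpl; ring).
      assert (Hy1 : R0 * y <= 1).
      { eapply Rle_trans; [|exact Hm]. unfold y. rewrite <- Rmult_assoc.
        apply Rmult_le_compat_r. lra. change (R0 ^ S j <= R0 ^ m). apply Rle_pow; [lra|lia]. }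
      destruct (H c f p n y c_pos sol ltac:(lra) Hy1) as [z [Hz Fz]].
      { eapply Rle_trans. apply (growth_initial c f p n c_pos sol).
        apply (growth_increases c f p n sol). lra. }
      apply Rle_trans with (angle f p n z).
      + apply sin_zero_next. now apply (zero_iff_sin c f p n c_pos sol).
        eapply Rle_lt_trans. exact IH. apply (angle_increasing c f p n c_pos sol). lra.
      + apply (angle_le c f p n c_pos sol). lra. }
  exists (R0 ^ m * / c). split. nra. now apply Main.
Qed.

Section Shooting.
Variables (F P N : R -> R -> R).
Hypothesis family : forall c, 0 < c -> profile c (F c) (P c) (N c).

Let th (c x : R) : R := angle (F c) (P c) (N c) x.
Let hit (m : nat) (c : R) : Prop := reaches m (F c) (P c) (N c).

Lemma family_near c0 X eps : 0 < c0 -> 0 <= X -> 0 < eps ->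
  exists d, 0 < d <= 1 /\ forall c, 0 < c -> Rabs (c - c0) < d ->
    Rabs (th c X - th c0 X) < eps /\ Rabs (F c X - F c0 X) < eps /\ Rabs (P c X - P c0 X) < eps.
Proof.
  intros Hc0 HX He. set (C := c0 + 1).
  destruct (angle_lipschitz C X) as [L [HL HA]]; trivial. unfold C; lra.
  set (E := exp ((1 + 3 * C ^ 2) * X)). assert (HE : 0 < E) by apply exp_pos.
  exists (Rmin 1 (eps / (L + E))). split.
  { split. apply Rmin_pos. lra. apply Rdiv_lt_0_compat; lra. apply Rmin_l. }
  intros c Hc Hd.
  assert (D1 : Rabs (c - c0) < 1) by (eapply Rlt_le_trans; [exact Hd|apply Rmin_l]).
  assert (D2 : Rabs (c - c0) < eps / (L + E)) by (eapply Rlt_le_trans; [exact Hd|apply Rmin_r]).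
  apply (Rmult_lt_compat_r (L + E)) in D2; [|lra].
  unfold Rdiv in D2. rewrite Rmult_assoc, Rinv_l, Rmult_1_r in D2 by lra.
  apply Rabs_lt_between in D1.
  assert (H1 : 0 < c <= C) by (unfold C; lra). assert (H2 : 0 < c0 <= C) by (unfold C; lra).
  assert (A := HA c c0 _ _ _ _ _ _ H1 H2 (family c Hc) (family c0 Hc0)).
  assert (B := profile_lipschitz C X c c0 _ _ _ _ _ _ H1 H2 HX (family c Hc) (family c0 Hc0)).
  fold E in B. assert (R0 := Rabs_pos (c - c0)). unfold th.
  destruct B as [B1 B2].
  split; [|split]; eapply Rle_lt_trans; try eassumption; nra.
Qed.

Lemma hit_open m c0 : 0 < c0 -> hit m c0 ->
  exists d, 0 < d /\ forall c, 0 < c -> Rabs (c - c0) < d -> hit m c.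
Proof.
  intros Hc0 [x [Hx Ha]].
  assert (A := angle_increasing c0 _ _ _ Hc0 (family c0 Hc0) x (x + 1) ltac:(lra)).
  destruct (family_near c0 (x + 1) (th c0 (x + 1) - INR m * PI)) as [d [Hd H]]; trivial; try lra.
  { unfold th. lra. }
  exists d. split. lra. intros c Hc Hcd. destruct (H c Hc Hcd) as [H1 _].
  exists (x + 1). split. lra. apply Rabs_lt_between in H1. unfold th in H1. lra.
Qed.

(** Beyond [X = 5 (c0 + 1)] all nearby solutions have at most one zero by
    [no_late_zero], and on the interval up to [X] the angle is still below the
    threshold. *)
Lemma miss_next m c0 : 0 < c0 -> ~ hit (S m) c0 ->
  exists d, 0 < d /\ forall c, 0 < c -> Rabs (c - c0) < d -> ~ hit (S (S m)) c.
Proof.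
  intros Hc0 Hno.
  (* 25 > 18, as no_late_zero requires. *)
  set (X := 5 * (c0 + 1)).
  assert (HX : 0 < X) by (unfold X; lra).
  assert (A := not_reached_lt _ _ _ _ X Hno ltac:(lra)).
  destruct (family_near c0 X (INR (S m) * PI - th c0 X)) as [d [Hd H]]; trivial; try lra.
  { unfold th; lra. }
  exists d. split. lra. intros c Hc Hcd [y [Hy Ay]].
  destruct (H c Hc Hcd) as [H1 _]. apply Rabs_lt_between in H1. unfold th in H1.
  assert (HP := PI_RGT_0). assert (Hm := pos_INR m).
  assert (sol := family c Hc).
  destruct (angle_hits c _ _ _ Hc sol y (INR (S (S m)) * PI) Hy) as [x2 [Hx2 A2]].
  { split; trivial. apply Rmult_le_pos; [apply pos_INR|lra]. }
  destruct (angle_hits c _ _ _ Hc sol x2 (INR (S m) * PI)) as [x1 [Hx1 A1]]. lra.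
  { rewrite A2. split. apply Rmult_le_pos; [apply pos_INR|lra].
    apply Rmult_le_compat_r. lra. apply le_INR. lia. }
  assert (L1 : X < x1). { apply (angle_lt_inv c _ _ _ Hc sol); lra. }
  assert (L2 : x1 < x2).
  { apply (angle_lt_inv c _ _ _ Hc sol); try lra. rewrite A1, A2.
    apply Rmult_lt_compat_r. lra. apply lt_INR. lia. }
  apply (no_late_zero c _ _ _ Hc sol x1 x2); try lra.
  - apply Rabs_lt_between in Hcd. assert (c <= c0 + 1) by lra.
    apply Rle_lt_trans with (18 * (c0 + 1) ^ 2). nra.
    apply Rlt_le_trans with (X ^ 2). unfold X; nra. apply pow_incr. lra.
  - apply (zero_iff_sin c _ _ _ Hc sol). rewrite A1. apply sin_multiple.
  - apply (zero_iff_sin c _ _ _ Hc sol). rewrite A2. apply sin_multiple.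
Qed.

(** The solution is eventually of one sign and moves away from 0 with a slope
    bounded below; in the variable [rho] it is logarithmically singular at 1. *)
Definition escapes (f p : R -> R) : Prop :=
  exists e a X0, e ^ 2 = 1 /\ 0 < a /\ forall x, X0 < x -> a <= e * p x /\ 0 < e * f x.

(** Far enough out the total variation of the slope is less than half the lower
    bound [a], so solutions starting nearby also move away from 0 for ever. *)
Lemma escape_stable m c0 : 0 < c0 -> escapes (F c0) (P c0) -> ~ hit (S m) c0 ->
  exists d, 0 < d /\ forall c, 0 < c -> Rabs (c - c0) < d -> ~ hit (S m) c.
Proof.
  intros Hc0 (e & a & X0 & He & Ha & Hesc) Hno.
  set (C := c0 + 1). assert (HC3 : 0 < C ^ 3) by (apply pow_lt; unfold C; lra).
  (* Beyond this abscissa 18 C^3 / X^2 is less than a / 2. *)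
  set (X := Rmax (X0 + 1) (36 * C ^ 3 / a + 1)).
  assert (X1 : X0 + 1 <= X) by apply Rmax_l.
  assert (X2 : 36 * C ^ 3 / a + 1 <= X) by apply Rmax_r.
  assert (X3 : 0 < 36 * C ^ 3 / a) by (apply Rdiv_lt_0_compat; lra).
  assert (XV : 18 * C ^ 3 / X ^ 2 < a / 2).
  { apply (Rmult_lt_reg_r (X ^ 2)). apply pow_lt; lra.
    unfold Rdiv at 1. rewrite Rmult_assoc, Rinv_l, Rmult_1_r by (apply pow_nonzero; lra).
    assert (36 * C ^ 3 < X * a).
    { replace (36 * C ^ 3) with (36 * C ^ 3 / a * a) by (field; lra). nra. }
    nra. }
  destruct (Hesc X ltac:(lra)) as [PX FX].
  assert (A := not_reached_lt _ _ _ _ X Hno ltac:(lra)).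
  set (eps := Rmin (a / 2) (Rmin (e * F c0 X) (INR (S m) * PI - th c0 X))).
  assert (E1 : eps <= a / 2) by apply Rmin_l.
  assert (E2 : eps <= e * F c0 X) by (eapply Rle_trans; [apply Rmin_r|apply Rmin_l]).
  assert (E3 : eps <= INR (S m) * PI - th c0 X) by (eapply Rle_trans; [apply Rmin_r|apply Rmin_r]).
  assert (E0 : 0 < eps). { repeat apply Rmin_pos; unfold th; lra. }
  destruct (family_near c0 X eps) as [d [Hd H]]; trivial; try lra.
  exists d. split. lra. intros c Hc Hcd [y [Hy Ay]].
  destruct (H c Hc Hcd) as (H1 & H2 & H3). assert (sol := family c Hc).
  apply Rabs_lt_between in H1. unfold th in H1, E3.
  assert (Ecase : e = 1 \/ e = -1).
  { assert ((e - 1) * (e + 1) = 0) by (simpl in He; lra).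
    apply Rmult_integral in H0. destruct H0; [left|right]; lra. }
  assert (Hcle : c <= C) by (apply Rabs_lt_between in Hcd; unfold C; lra).
  assert (Fc : 0 < e * F c X).
  { apply Rabs_lt_between in H2. destruct Ecase; subst e; lra. }
  assert (Pc : forall x, X <= x -> 0 < e * P c x).
  { intros x Hx.
    assert (V := slope_variation c _ _ _ sol c X x ltac:(lra)).
    specialize (V (fun z Hz => profile_f_le _ _ _ _ sol z ltac:(lra))).
    assert (c ^ 3 <= C ^ 3) by (apply pow_incr; lra).
    assert (18 * c ^ 3 / X ^ 2 <= 18 * C ^ 3 / X ^ 2).
    { apply Rmult_le_compat_r. left. apply Rinv_0_lt_compat, pow_lt; lra. lra. }
    assert (V2 : Rabs (P c x - P c X) < a / 2) by lra.
    apply Rabs_lt_between in V2. apply Rabs_lt_between in H3. destruct Ecase; subst e; lra. }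
  destruct (angle_hits c _ _ _ Hc sol y (INR (S m) * PI) Hy) as [x1 [Hx1 A1]].
  { split; trivial. apply Rmult_le_pos; [apply pos_INR|]. assert (HP := PI_RGT_0). lra. }
  assert (L1 : X < x1). { apply (angle_lt_inv c _ _ _ Hc sol); lra. }
  assert (Z : F c x1 = 0).
  { apply (zero_iff_sin c _ _ _ Hc sol). rewrite A1. apply sin_multiple. }
  assert (e * F c X < e * F c x1).
  { apply (lt_of_derive (fun x => e * F c x) (fun x => e * P c x)); trivial.
    - intros x Hx. apply (is_derive_scal (F c)). apply (profile_df _ _ _ _ sol).
    - intros x Hx. apply (continuous_mult (fun _ => e) (F c)). apply continuous_const.
      apply (profile_cf _ _ _ _ sol).
    - intros x Hx. apply Pc. lra. }
  rewrite Z in H0. lra.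
Qed.

(** Arbitrarily close to the supremum of the parameters with at most [n] zeros lie
    some with at most [n] and some with more than [n] zeros.  The former exclude [n + 1] zeros by openness; the
    latter exclude, by the two stability lemmas, both fewer than [n] zeros and an
    escaping solution. *)
Lemma critical_parameter (n : nat) : (0 < n)%nat ->
  exists c, 0 < c /\ hit n c /\ ~ hit (S n) c /\ ~ escapes (F c) (P c).
Proof.
  intros Hn. destruct n as [|m]; [lia|]. clear Hn.
  destruct (many_zeros (S (S m))) as [C [HC HCm]].
  set (E := fun c => / 10 <= c /\ ~ hit (S (S m)) c).
  destruct (completeness E) as [s [Hs1 Hs2]].
  { exists C. intros c [Hc Hno]. apply Rnot_lt_le. intros Hlt. apply Hno.
    apply (HCm c). lra. apply family. lra. }
  { exists (/ 10). split. lra. apply (small_data_no_reach (/ 10)); try lra. apply family. lra. }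
  assert (s0 : / 10 <= s).
  { apply Hs1. split. lra. apply (small_data_no_reach (/ 10)); try lra. apply family. lra. }
  assert (Above : forall d, 0 < d -> exists c, 0 < c /\ Rabs (c - s) < d /\ hit (S (S m)) c).
  { intros d Hd. exists (s + d / 2). split. lra. split.
    rewrite Rabs_pos_eq; lra. apply NNPP. intros Hno.
    assert (s + d / 2 <= s); [|lra]. apply Hs1. split; trivial. lra. }
  assert (Below : forall d, 0 < d -> exists c, 0 < c /\ Rabs (c - s) < d /\ ~ hit (S (S m)) c).
  { intros d Hd. apply NNPP. intros Hno.
    assert (s <= s - d / 2); [|lra]. apply Hs2. intros c [Hc Hm].
    assert (Hcs : c <= s) by (apply Hs1; now split).
    apply Rnot_lt_le. intros Hlt. apply Hno. exists c. split. lra. split; trivial.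
    rewrite Rabs_left1; lra. }
  assert (Miss : ~ hit (S (S m)) s).
  { intros Hh. destruct (hit_open _ s ltac:(lra) Hh) as [d [Hd H]].
    destruct (Below d Hd) as (c & Hc & Hcd & Hno). apply Hno. now apply H. }
  exists s. split. lra. split; [|split; trivial].
  - apply NNPP. intros Hno. destruct (miss_next m s ltac:(lra) Hno) as [d [Hd H]].
    destruct (Above d Hd) as (c & Hc & Hcd & Hh). exact (H c Hc Hcd Hh).
  - intros Hesc. destruct (escape_stable (S m) s ltac:(lra) Hesc Miss) as [d [Hd H]].
    destruct (Above d Hd) as (c & Hc & Hcd & Hh). exact (H c Hc Hcd Hh).
Qed.
End Shooting.

Lemma critical_profile (n : nat) : (0 < n)%nat -> exists c f p nu,
  0 < c /\ profile c f p nu /\ reaches n f p nu /\ ~ reaches (S n) f p nu /\ ~ escapes f p.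
Proof.
  intros Hn.
  assert (D : forall c, exists w : (R -> R) * (R -> R) * (R -> R),
    0 < c -> profile c (fst (fst w)) (snd (fst w)) (snd w)).
  { intros c. destruct (Rlt_dec 0 c) as [Hc|Hc].
    - destruct (profile_exists c Hc) as (f & p & nu & H). now exists (f, p, nu).
    - exists (fun x => x, fun x => x, fun x => x). tauto. }
  set (w := fun c => proj1_sig (constructive_indefinite_description _ (D c))).
  assert (Hw : forall c, 0 < c -> profile c (fst (fst (w c))) (snd (fst (w c))) (snd (w c)))
    by (intros c; exact (proj2_sig (constructive_indefinite_description _ (D c)))).
  destruct (critical_parameter (fun c => fst (fst (w c))) (fun c => snd (fst (w c))) (fun c => snd (w c)) Hw n Hn)
    as (c & Hc & H1 & H2 & H3).
  exists c, (fst (fst (w c))), (snd (fst (w c))), (snd (w c)). repeat (split; auto).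
Qed.

(** * Asymptotics of the critical solution *)

Section Critical.
Variables (n : nat) (c : R) (f p nu : R -> R).
Hypothesis c_pos : 0 < c.
Hypothesis sol : profile c f p nu.
Hypothesis hits_n : reaches n f p nu.
Hypothesis misses : ~ reaches (S n) f p nu.

Lemma critical_zeros : exists zeros : list R,
  NoDup zeros /\ length zeros = n /\ (forall x, In x zeros <-> 0 < x /\ f x = 0).
Proof.
  assert (HP := PI_RGT_0). destruct hits_n as [X [HX AX]].
  assert (D : forall k, exists x, (0 < k <= n)%nat -> 0 < x /\ angle f p nu x = INR k * PI).
  { intros k. destruct (Compare_dec.le_lt_dec k n) as [Hk|Hk]; [|exists 0; lia].
    assert (Hkn : INR k * PI <= INR n * PI) by (apply Rmult_le_compat_r; [lra|now apply le_INR]).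
    destruct (angle_hits c f p nu c_pos sol X (INR k * PI) HX) as [y [Hy Ay]].
    { split. apply Rmult_le_pos; [apply pos_INR|lra]. lra. }
    exists y. intros Hk0. split; trivial.
    destruct (proj1 Hy) as [Y|Y]; trivial. rewrite <- Y, angle_0 in Ay.
    assert (0 < INR k) by (apply lt_0_INR; lia). nra. }
  set (z := fun k => proj1_sig (constructive_indefinite_description _ (D k))).
  assert (Hz : forall k, (0 < k <= n)%nat -> 0 < z k /\ angle f p nu (z k) = INR k * PI)
    by (intros k; exact (proj2_sig (constructive_indefinite_description _ (D k)))).
  exists (map z (seq 1 n)). split; [|split].
  - apply NoDup_map_NoDup_ForallPairs; [|apply seq_NoDup].
    intros i j Hi Hj E. apply in_seq in Hi, Hj.
    assert (Zi := proj2 (Hz i ltac:(lia))). assert (Zj := proj2 (Hz j ltac:(lia))).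
    rewrite E, Zj in Zi. apply Rmult_eq_reg_r in Zi; [|lra]. now apply INR_eq in Zi.
  - now rewrite length_map, length_seq.
  - intros x. rewrite in_map_iff. split.
    + intros [k [<- Hk]]. apply in_seq in Hk. destruct (Hz k ltac:(lia)) as [Z1 Z2].
      split; trivial. apply (zero_iff_sin c f p nu c_pos sol). rewrite Z2. apply sin_multiple.
    + intros [Hx Fx]. apply (zero_iff_sin c f p nu c_pos sol) in Fx.
      destruct (sin_eq_0_0 _ Fx) as [k Hk].
      assert (A0 := angle_increasing c f p nu c_pos sol 0 x ltac:(lra)). rewrite angle_0 in A0.
      assert (A1 := not_reached_lt f p nu (S n) x misses ltac:(lra)).
      rewrite Hk in A0, A1.
      assert (K0 : (0 < k)%Z) by (apply lt_IZR; nra).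
      assert (K1 : (k < Z.of_nat (S n))%Z).
      { apply Rmult_lt_reg_r in A1; [|lra]. rewrite INR_IZR_INZ in A1. now apply lt_IZR in A1. }
      exists (Z.to_nat k). split; [|apply in_seq; lia].
      destruct (Hz (Z.to_nat k) ltac:(lia)) as [Z1 Z2].
      rewrite INR_IZR_INZ, Z2Nat.id, <- Hk in Z2 by lia.
      destruct (Rtotal_order (z (Z.to_nat k)) x) as [H|[H|H]]; trivial.
      * assert (A := angle_increasing c f p nu c_pos sol _ _ (conj (Rlt_le _ _ Z1) H)). lra.
      * assert (A := angle_increasing c f p nu c_pos sol _ _ (conj (Rlt_le _ _ Hx) H)). lra.
Qed.

Lemma final_sign : exists e X0, e ^ 2 = 1 /\ 0 < X0 /\ forall x, X0 <= x -> 0 < e * f x.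
Proof.
  destruct hits_n as [X [HX AX]].
  assert (Hnz : forall x, X + 1 <= x -> f x <> 0).
  { intros x Hx Fx. apply (zero_iff_sin c f p nu c_pos sol) in Fx.
    assert (A := angle_increasing c f p nu c_pos sol X x ltac:(lra)).
    assert (B := not_reached_lt f p nu (S n) x misses ltac:(lra)).
    assert (S := sin_zero_next n _ Fx ltac:(lra)). lra. }
  destruct (sign_choice f (X + 1)) as [e [He H]]. { apply Hnz; lra. }
  exists e, (X + 1). split; trivial. split. lra. intros x Hx. apply H.
  apply sign_between; trivial. apply (profile_cf c f p nu sol).
  intros t Ht. apply Hnz. lra.
Qed.

(** After the last zero [e f] is positive and concave; a nonpositive slope would
    force another zero. *)
Lemma final_monotone : exists e X0, e ^ 2 = 1 /\ 0 < X0 /\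
  (forall x, X0 <= x -> 0 < e * f x) /\ (forall x, X0 <= x -> 0 < e * p x) /\
  (forall x y, X0 <= x -> x <= y -> e * p y <= e * p x).
Proof.
  destruct final_sign as (e & X0 & He & HX & Hf). exists e, X0.
  assert (Dec : forall x y, X0 <= x -> x < y -> e * p y < e * p x).
  { intros x y Hx Hxy. apply Ropp_lt_cancel.
    apply (lt_of_derive (fun x => - (e * p x)) (fun x => - (e * - (csch2 x * f x ^ 3)))); trivial.
    - intros t Ht. apply (is_derive_opp (fun x => e * p x)). apply (is_derive_scal p).
      apply (profile_eq c f p nu sol). lra.
    - intros t Ht. apply (continuous_opp (fun x => e * p x)).
      apply (continuous_mult (fun _ => e) p). apply continuous_const. apply (profile_cp c f p nu sol).
    - intros t Ht. assert (P := csch2_pos t ltac:(lra)). assert (Q := Hf t ltac:(lra)).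
      replace (- (e * - (csch2 t * f t ^ 3))) with (csch2 t * (1 * e * f t ^ 3)) by ring. rewrite <- He.
      replace (e ^ 2 * e * f t ^ 3) with ((e * f t) ^ 3) by ring.
      apply Rmult_lt_0_compat; trivial. now apply pow_lt. }
  split; trivial. split; trivial. split; trivial. split.
  - intros x Hx. apply Rnot_le_lt. intros Hle.
    set (s := - (e * p (x + 1))).
    assert (Hs : 0 < s). { assert (A := Dec x (x + 1) Hx ltac:(lra)). unfold s; lra. }
    assert (Hf1 := Hf (x + 1) ltac:(lra)).
    set (y := x + 1 + e * f (x + 1) / s).
    assert (Hy : 0 < e * f (x + 1) / s) by (now apply Rdiv_lt_0_compat).
    assert (A : - (s * (x + 1)) - e * f (x + 1) <= - (s * y) - e * f y).
    { apply (le_of_derive (fun t => - (s * t) - e * f t) (fun t => - s - e * p t)). unfold y; lra.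
      - intros t Ht. apply (is_derive_minus (fun t => - (s * t)) (fun t => e * f t)).
        auto_derive; trivial; ring. apply (is_derive_scal f). apply (profile_df c f p nu sol).
      - intros t Ht. apply (continuous_minus (fun t => - (s * t)) (fun t => e * f t)).
        apply (continuous_of_derive _ t (- s)). auto_derive; trivial; ring.
        apply (continuous_mult (fun _ => e) f). apply continuous_const. apply (profile_cf c f p nu sol).
      - intros t Ht. assert (e * p t < e * p (x + 1)) by (apply Dec; lra). unfold s; lra. }
    assert (B := Hf y ltac:(unfold y; lra)).
    replace (s * y) with (s * (x + 1) + e * f (x + 1)) in A by (unfold y; field; lra). lra.
  - intros x y Hx [Hxy|<-]; [|lra]. left. now apply Dec.
Qed.

Hypothesis trapped : ~ escapes f p.

Lemma sign_abs e v : e ^ 2 = 1 -> Rabs (e * v) = Rabs v.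
Proof.
  intros He. assert (H : (e - 1) * (e + 1) = 0) by (simpl in He; lra).
  apply Rmult_integral in H. destruct H as [H|H].
  - replace e with 1 by lra. now rewrite Rmult_1_l.
  - replace e with (-1) by lra. rewrite <- Rabs_Ropp. f_equal. ring.
Qed.

Lemma slope_vanishes eps : 0 < eps -> exists X, 0 < X /\ forall x, X <= x -> Rabs (p x) < eps.
Proof.
  intros Heps. destruct final_monotone as (e & X0 & He & HX & Hf & Hp & Hd).
  apply NNPP. intros Hno. apply trapped. exists e, eps, X0. split; trivial. split; trivial.
  intros x Hx. split; [|apply Hf; lra]. apply Rnot_lt_le. intros Hlt.
  apply Hno. exists x. split. lra. intros y Hy. rewrite <- (sign_abs e) by trivial.
  assert (A := Hd x y ltac:(lra) Hy). assert (B := Hp y ltac:(lra)). rewrite Rabs_pos_eq; lra.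
Qed.

(** Since the slope tends to 0, [slope_variation] bounds it by [18 c^3 / x^2],
    which is integrable; a bounded monotone function has a limit. *)
Lemma value_converges : exists b, forall eps, 0 < eps ->
  exists X, 0 < X /\ forall x, X <= x -> Rabs (f x - b) < eps.
Proof.
  destruct final_monotone as (e & X0 & He & HX & Hf & Hp & Hd).
  set (A := 18 * c ^ 3). assert (HA : 0 < A). { assert (0 < c ^ 3) by now apply pow_lt. unfold A; lra. }
  assert (Pdecay : forall x, X0 <= x -> e * p x <= A / x ^ 2).
  { intros x Hx. apply Rnot_lt_le. intros Hlt.
    destruct (slope_vanishes (e * p x - A / x ^ 2)) as [X [X1 X2]]. lra.
    set (y := Rmax X x). assert (Y1 : X <= y) by apply Rmax_l. assert (Y2 : x <= y) by apply Rmax_r.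
    specialize (X2 y Y1).
    assert (V := slope_variation c f p nu sol c x y ltac:(lra)).
    specialize (V (fun t Ht => profile_f_le c f p nu sol t ltac:(lra))). fold A in V.
    rewrite <- (sign_abs e) in X2, V by trivial.
    apply Rabs_lt_between in X2. apply Rabs_le_between in V. lra. }
  assert (Up : forall x y, X0 <= x -> x <= y -> e * f x <= e * f y).
  { intros x y Hx Hxy. apply (le_of_derive (fun t => e * f t) (fun t => e * p t)); trivial.
    - intros t Ht. apply (is_derive_scal f). apply (profile_df c f p nu sol).
    - intros t Ht. apply (continuous_mult (fun _ => e) f). apply continuous_const. apply (profile_cf c f p nu sol).
    - intros t Ht. left. apply Hp. lra. }
  assert (Bd : forall x, X0 <= x -> e * f x <= e * f X0 + A / X0).
  { intros x Hx.
    assert (D : forall t, 0 < t -> is_derive (fun t => - (A / t) - e * f t) t (A / t ^ 2 - e * p t)).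
    { intros t Ht. apply (is_derive_minus (fun t => - (A / t)) (fun t => e * f t)).
      auto_derive. lra. field. lra. apply (is_derive_scal f). apply (profile_df c f p nu sol). }
    assert (M : - (A / X0) - e * f X0 <= - (A / x) - e * f x).
    { apply (le_of_derive (fun t => - (A / t) - e * f t) (fun t => A / t ^ 2 - e * p t)); trivial.
      - intros t Ht. apply D. lra.
      - intros t Ht. refine (continuous_of_derive _ _ _ (D t _)). lra.
      - intros t Ht. specialize (Pdecay t ltac:(lra)). lra. }
    assert (0 < A / x) by (apply Rdiv_lt_0_compat; lra). lra. }
  destruct (completeness (fun v => exists x, X0 <= x /\ v = e * f x)) as [B [B1 B2]].
  { exists (e * f X0 + A / X0). intros v [x [Hx ->]]. now apply Bd. }
  { exists (e * f X0), X0. split; [lra|trivial]. }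
  exists (e * B). intros eps Heps.
  assert (exists X, X0 <= X /\ B - eps < e * f X) as [X [HX1 HX2]].
  { apply NNPP. intros Hno. assert (B <= B - eps); [|lra]. apply B2. intros v [x [Hx ->]].
    apply Rnot_lt_le. intros Hlt. apply Hno. now exists x. }
  exists X. split. lra. intros x Hx. rewrite <- (sign_abs e) by trivial.
  replace (e * (f x - e * B)) with (e * f x - e ^ 2 * B) by ring. rewrite He, Rmult_1_l.
  assert (U1 : e * f X <= e * f x) by (apply Up; lra).
  assert (U2 : e * f x <= B). { apply B1. exists x. split; [lra|trivial]. }
  apply Rabs_lt_between. lra.
Qed.
End Critical.

(** * Smoothness up to the singular points *)

Notation unit_interval := (fun rho => 0 <= rho <= 1).

(** One-sided derivative at the end points of the unit interval, without the
    filters of [is_derive_within]. *)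
Definition derives01 (f : R -> R) (x l : R) : Prop :=
  forall eps, 0 < eps -> exists d, 0 < d /\ forall y, 0 <= y <= 1 -> Rabs (y - x) < d ->
    Rabs (f y - f x - l * (y - x)) <= eps * Rabs (y - x).

Lemma derives01_within f x l : 0 <= x <= 1 -> derives01 f x l ->
  is_derive_within unit_interval f x l.
Proof.
  intros Hx H. split. apply (is_linear_scal_l (K := R_AbsRing) (V := R_NormedModule) l).
  intros z Hz eps.
  assert (Hzx : z = x).
  { destruct (Req_dec z x) as [E|E]; trivial. exfalso.
    assert (Hd : 0 < Rabs (x - z)) by (apply Rabs_pos_lt; lra).
    specialize (Hz (ball z (mkposreal _ Hd)) (locally_ball z _)).
    destruct Hz as [d Hz]. specialize (Hz x (ball_center x d) Hx).
    unfold ball in Hz; simpl in Hz; unfold AbsRing_ball, abs, minus, plus, opp in Hz; simpl in Hz.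
    replace (x + - z) with (x - z) in Hz by ring. lra. }
  subst z. destruct (H eps (cond_pos eps)) as [d [Hd Hy]].
  exists (mkposreal d Hd). intros y Hb HI. specialize (Hy y HI Hb).
  unfold norm, minus, plus, opp, scal; simpl. unfold mult, abs; simpl.
  replace (f y + - f x + - ((y + - x) * l)) with (f y - f x - l * (y - x)) by ring.
  exact Hy.
Qed.

Lemma derives01_ext f g x l : 0 <= x <= 1 -> (forall y, 0 <= y <= 1 -> f y = g y) ->
  derives01 f x l -> derives01 g x l.
Proof.
  intros Hx E H eps He. destruct (H eps He) as [d [Hd Hy]]. exists d. split; trivial.
  intros y HI Hb. rewrite <- !E by trivial. now apply Hy.
Qed.

Lemma derives01_unique f x l m : 0 <= x <= 1 -> derives01 f x l -> derives01 f x m -> l = m.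
Proof.
  intros Hx H1 H2. apply NNPP. intros Hne.
  assert (He : 0 < Rabs (l - m) / 3). { assert (0 < Rabs (l - m)) by (apply Rabs_pos_lt; lra). lra. }
  destruct (H1 _ He) as [d1 [Hd1 B1]]. destruct (H2 _ He) as [d2 [Hd2 B2]].
  set (d := Rmin (Rmin d1 d2) (/ 2)).
  assert (D1 : d <= d1) by (eapply Rle_trans; [apply Rmin_l|apply Rmin_l]).
  assert (D2 : d <= d2) by (eapply Rle_trans; [apply Rmin_l|apply Rmin_r]).
  assert (D3 : d <= / 2) by apply Rmin_r.
  assert (D0 : 0 < d). { apply Rmin_pos; [now apply Rmin_pos|lra]. }
  assert (exists y, 0 <= y <= 1 /\ Rabs (y - x) = d / 2) as [y [Hy Hyd]].
  { destruct (Rle_lt_dec x (/ 2)).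
    - exists (x + d / 2). split. lra. rewrite Rabs_pos_eq; lra.
    - exists (x - d / 2). split. lra. rewrite Rabs_left1; lra. }
  specialize (B1 y Hy ltac:(lra)). specialize (B2 y Hy ltac:(lra)).
  assert (T := Rabs_triang (f y - f x - m * (y - x)) (- (f y - f x - l * (y - x)))).
  rewrite Rabs_Ropp in T.
  replace (f y - f x - m * (y - x) + - (f y - f x - l * (y - x))) with ((l - m) * (y - x)) in T by ring.
  rewrite Rabs_mult in T. rewrite Hyd in *. nra.
Qed.

Lemma derives01_of_is_derive f x l : is_derive f x l -> derives01 f x l.
Proof.
  intros [_ H] eps He.
  destruct (H x (fun P HP => HP) (mkposreal eps He)) as [d Hd].
  exists d. split; [apply cond_pos|]. intros y _ Hy. specialize (Hd y Hy).
  unfold norm, minus, plus, opp, scal in Hd; simpl in Hd. unfold mult, abs in Hd; simpl in Hd.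
  replace (f y - f x - l * (y - x)) with (f y + - f x + - ((y + - x) * l)) by ring. exact Hd.
Qed.

Lemma derives01_interior f x l : 0 < x < 1 -> derives01 f x l -> is_derive f x l.
Proof.
  intros Hx H. split. apply (is_linear_scal_l (K := R_AbsRing) (V := R_NormedModule) l).
  intros z Hz. rewrite <- (is_filter_lim_locally_unique (V := R_NormedModule) x z Hz). clear z Hz. intros eps.
  destruct (H eps (cond_pos eps)) as [d [Hd Hy]].
  set (e := Rmin d (Rmin x (1 - x))).
  assert (E0 : 0 < e) by (repeat apply Rmin_pos; lra).
  assert (E1 : e <= d) by apply Rmin_l.
  assert (E2 : e <= x) by (eapply Rle_trans; [apply Rmin_r|apply Rmin_l]).
  assert (E3 : e <= 1 - x) by (eapply Rle_trans; [apply Rmin_r|apply Rmin_r]).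
  exists (mkposreal e E0). intros y Hb.
  assert (Hb' : Rabs (y - x) < e) by exact Hb. assert (Hb2 := Hb').
  apply Rabs_lt_between in Hb'. specialize (Hy y ltac:(lra) ltac:(lra)).
  unfold norm, minus, plus, opp, scal; simpl. unfold mult, abs; simpl.
  replace (f y + - f x + - ((y + - x) * l)) with (f y - f x - l * (y - x)) by ring.
  exact Hy.
Qed.

Lemma derives01_plus f g x l m : derives01 f x l -> derives01 g x m ->
  derives01 (fun x => f x + g x) x (l + m).
Proof.
  intros H1 H2 eps He.
  destruct (H1 (eps / 2) ltac:(lra)) as [d1 [Hd1 B1]]. destruct (H2 (eps / 2) ltac:(lra)) as [d2 [Hd2 B2]].
  exists (Rmin d1 d2). split. now apply Rmin_pos. intros y HI Hy.
  specialize (B1 y HI (Rlt_le_trans _ _ _ Hy (Rmin_l _ _))).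
  specialize (B2 y HI (Rlt_le_trans _ _ _ Hy (Rmin_r _ _))).
  replace (f y + g y - (f x + g x) - (l + m) * (y - x)) with
    ((f y - f x - l * (y - x)) + (g y - g x - m * (y - x))) by ring.
  eapply Rle_trans. apply Rabs_triang. lra.
Qed.

Lemma derives01_mult f g x l m : derives01 f x l -> derives01 g x m ->
  derives01 (fun x => f x * g x) x (l * g x + f x * m).
Proof.
  intros H1 H2 eps He.
  set (A := Rabs (f x) + Rabs (g x) + (Rabs l + 1) * (Rabs m + 1) + 1).
  assert (F0 := Rabs_pos (f x)). assert (G0 := Rabs_pos (g x)).
  assert (L0 := Rabs_pos l). assert (M0 := Rabs_pos m).
  assert (HA : 1 <= A) by (unfold A; nra).
  set (e := Rmin 1 (eps / A)).
  assert (E0 : 0 < e) by (apply Rmin_pos; [lra|apply Rdiv_lt_0_compat; lra]).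
  assert (E1 : e <= 1) by apply Rmin_l. assert (E2 : e * A <= eps).
  { replace eps with (eps / A * A) by (field; lra). apply Rmult_le_compat_r. lra. apply Rmin_r. }
  destruct (H1 e E0) as [d1 [Hd1 B1]]. destruct (H2 e E0) as [d2 [Hd2 B2]].
  exists (Rmin e (Rmin d1 d2)). split. { apply Rmin_pos; [exact E0|now apply Rmin_pos]. } intros y HI Hy.
  assert (Y0 : Rabs (y - x) < e) by (eapply Rlt_le_trans; [exact Hy|apply Rmin_l]).
  assert (Y1 : Rabs (y - x) < d1)
    by (eapply Rlt_le_trans; [exact Hy|eapply Rle_trans; [apply Rmin_r|apply Rmin_l]]).
  assert (Y2 : Rabs (y - x) < d2)
    by (eapply Rlt_le_trans; [exact Hy|eapply Rle_trans; [apply Rmin_r|apply Rmin_r]]).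
  specialize (B1 y HI Y1). specialize (B2 y HI Y2).
  set (r := Rabs (y - x)) in *. assert (R0 : 0 <= r) by apply Rabs_pos.
  assert (Z1 : Rabs (f y - f x) <= (Rabs l + 1) * r).
  { replace (f y - f x) with ((f y - f x - l * (y - x)) + l * (y - x)) by ring.
    eapply Rle_trans. apply Rabs_triang. rewrite (Rabs_mult l). fold r. nra. }
  assert (Z2 : Rabs (g y - g x) <= (Rabs m + 1) * r).
  { replace (g y - g x) with ((g y - g x - m * (y - x)) + m * (y - x)) by ring.
    eapply Rle_trans. apply Rabs_triang. rewrite (Rabs_mult m). fold r. nra. }
  replace (f y * g y - f x * g x - (l * g x + f x * m) * (y - x)) with
    ((f y - f x - l * (y - x)) * g x + f x * (g y - g x - m * (y - x)) + (f y - f x) * (g y - g x)) by ring.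
  eapply Rle_trans. apply Rabs_triang.
  apply Rle_trans with (e * r * Rabs (g x) + Rabs (f x) * (e * r) + (Rabs l + 1) * r * ((Rabs m + 1) * r)).
  - apply Rplus_le_compat.
    + eapply Rle_trans. apply Rabs_triang. rewrite !Rabs_mult. apply Rplus_le_compat.
      apply Rmult_le_compat_r; trivial. apply Rmult_le_compat_l; trivial.
    + rewrite Rabs_mult. apply Rmult_le_compat; trivial; apply Rabs_pos.
  - apply Rle_trans with (e * A * r); [|apply Rmult_le_compat_r; trivial].
    assert (T : (Rabs l + 1) * (Rabs m + 1) * (r * r) <= (Rabs l + 1) * (Rabs m + 1) * (e * r)).
    { apply Rmult_le_compat_l. nra. nra. }
    unfold A. assert (0 <= e * r) by nra. nra.
Qed.

Lemma mean_value01 f df a b : (forall x, continuous f x) ->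
  (forall x, 0 < x < 1 -> is_derive f x (df x)) ->
  0 <= a <= 1 -> 0 <= b <= 1 ->
  exists z, 0 <= z <= 1 /\ Rabs (z - a) <= Rabs (b - a) /\ f b - f a = df z * (b - a).
Proof.
  intros Cf Hd Ha Hb.
  destruct (MVT_gen f a b df) as [z [Hz E]].
  - intros x Hx. apply Hd. unfold Rmin, Rmax in Hx. destruct (Rle_dec a b); lra.
  - intros x _. apply continuity_pt_filterlim, Cf.
  - exists z. unfold Rmin, Rmax in Hz. destruct (Rle_dec a b).
    + split. lra. split; trivial. rewrite !Rabs_pos_eq; lra.
    + split. lra. split; trivial. rewrite !Rabs_left1; lra.
Qed.

(** A function continuous up to the end points whose interior derivative has a
    limit there is differentiable at the end points too. *)
Lemma derives01_of_interior f df : (forall x, continuous f x) -> (forall x, continuous df x) ->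
  (forall x, 0 < x < 1 -> is_derive f x (df x)) ->
  forall x, 0 <= x <= 1 -> derives01 f x (df x).
Proof.
  intros Cf Cd Hd x Hx eps He.
  destruct (proj1 (continuous_eps _ _) (Cd x) eps He) as [d [Hd0 Hy]].
  exists d. split; trivial. intros y HI Hyd.
  destruct (mean_value01 f df x y Cf Hd Hx HI) as (z & Hz & Hzx & E).
  rewrite E, <- Rmult_minus_distr_r, Rabs_mult.
  apply Rmult_le_compat_r. apply Rabs_pos. left. apply Hy. lra.
Qed.

(** Continuity is required on the whole line, so that integrals need no domain
    condition, but differentiability only relative to the closed unit interval. *)
Fixpoint Ck (k : nat) (f : R -> R) : Prop :=
  (forall x, continuous f x) /\
  match k with
  | O => True
  | S k => exists f', (forall x, 0 <= x <= 1 -> derives01 f x (f' x)) /\ Ck k f'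
  end.

Lemma Ck_continuous k f : Ck k f -> forall x, continuous f x.
Proof. destruct k; intros H; apply H. Qed.

Lemma Ck_pred k f : Ck (S k) f -> Ck k f.
Proof.
  revert f. induction k as [|k IH]; intros f [H1 (f' & H2 & H3)]; split; trivial.
  exists f'. auto.
Qed.

Lemma Ck_const k a : Ck k (fun _ => a).
Proof.
  revert a. induction k as [|k IH]; intros a; split; trivial; try (intros; apply continuous_const).
  exists (fun _ => 0). split; trivial. intros x _. apply derives01_of_is_derive. apply (is_derive_const a).
Qed.

Lemma Ck_id k : Ck k (fun x => x).
Proof.
  destruct k; split; trivial; try (intros; apply continuous_id).
  exists (fun _ => 1). split. intros x _. apply derives01_of_is_derive. apply (is_derive_id x). apply Ck_const.
Qed.

Lemma Ck_plus k f g : Ck k f -> Ck k g -> Ck k (fun x => f x + g x).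
Proof.
  revert f g. induction k as [|k IH]; intros f g [Cf Hf] [Cg Hg]; (split; [intros x; now apply (continuous_plus f g)|trivial]).
  destruct Hf as (f' & Hf & Hf'), Hg as (g' & Hg & Hg').
  exists (fun x => f' x + g' x). split; auto. intros x Hx. apply derives01_plus; auto.
Qed.

Lemma Ck_mult k f g : Ck k f -> Ck k g -> Ck k (fun x => f x * g x).
Proof.
  revert f g. induction k as [|k IH]; intros f g Kf Kg;
    (split; [intros x; apply (continuous_mult f g); eapply Ck_continuous; eassumption|trivial]).
  assert (Pf := Ck_pred _ _ Kf). assert (Pg := Ck_pred _ _ Kg).
  destruct Kf as [Cf (f' & Hf & Hf')], Kg as [Cg (g' & Hg & Hg')].
  exists (fun x => f' x * g x + f x * g' x). split.
  - intros x Hx. apply derives01_mult; auto.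
  - apply (Ck_plus k (fun x => f' x * g x) (fun x => f x * g' x)); auto.
Qed.

Lemma Ck_inv_succ k : Ck k (fun x => / (1 + Rabs x)).
Proof.
  assert (C : forall x, continuous (fun x => / (1 + Rabs x)) x).
  { intros x. apply (continuous_Rinv_comp (fun x => 1 + Rabs x)).
    apply (continuous_plus (fun _ => 1) Rabs). apply continuous_const. apply continuous_Rabs.
    assert (A := Rabs_pos x). lra. }
  induction k as [|k IH]; split; trivial.
  exists (fun x => -1 * (/ (1 + Rabs x) * / (1 + Rabs x))). split.
  - intros x Hx. apply (derives01_ext (fun x => / (1 + x))); trivial.
    + intros y Hy. now rewrite Rabs_pos_eq.
    + apply derives01_of_is_derive. rewrite Rabs_pos_eq by lra. auto_derive. lra. field. lra.
  - apply (Ck_mult k (fun _ => -1)). apply Ck_const. now apply (Ck_mult k (fun x => / (1 + Rabs x))).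
Qed.

(** With [e = 0] or [e = 1] and [w] a power of [1 - t] this is a weighted integral
    between [x] and an end point of the interval, divided by a power of the distance to
    that point. *)
Definition average (e : R) (w v : R -> R) (x : R) : R :=
  RInt (fun t => w t * v ((1 - t) * x + t * e)) 0 1.

Lemma continuous_average_integrand e w v x t :
  (forall t, continuous w t) -> (forall x, continuous v x) ->
  continuous (fun t => w t * v ((1 - t) * x + t * e)) t.
Proof.
  intros Hw Hv. apply (continuous_mult w (fun t => v ((1 - t) * x + t * e))); trivial.
  apply (continuous_comp (fun t => (1 - t) * x + t * e) v); trivial.
  apply (continuous_of_derive _ t (e - x)). auto_derive; trivial. ring.
Qed.

Lemma ex_RInt_average e w v x :
  (forall t, continuous w t) -> (forall x, continuous v x) ->
  ex_RInt (fun t => w t * v ((1 - t) * x + t * e)) 0 1.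
Proof.
  intros Hw Hv. apply (ex_RInt_continuous (V := R_CompleteNormedModule)).
  intros t _. now apply continuous_average_integrand.
Qed.

Lemma continuous_average e w v x : 0 <= e <= 1 ->
  (forall t, continuous w t) -> (forall t, 0 <= t <= 1 -> Rabs (w t) <= 1) ->
  (forall x, continuous v x) -> continuous (average e w v) x.
Proof.
  intros He Hw Hw1 Hv. apply continuous_eps. intros eps Heps.
  set (A := Rabs x + 2).
  assert (Heps2 : 0 < eps / 2) by lra.
  destruct (@Heine_cor2 v (- A) A (fun z _ => proj2 (continuity_pt_filterlim v z) (Hv z)) (mkposreal _ Heps2))
    as [d Hd]. simpl in Hd.
  exists (Rmin d 1). split. apply Rmin_pos; [apply cond_pos|lra].
  intros y Hy.
  assert (Y1 : Rabs (y - x) < d) by (eapply Rlt_le_trans; [exact Hy|apply Rmin_l]).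
  assert (Y2 : Rabs (y - x) < 1) by (eapply Rlt_le_trans; [exact Hy|apply Rmin_r]).
  assert (E : RInt (fun t => minus (w t * v ((1 - t) * y + t * e)) (w t * v ((1 - t) * x + t * e))) 0 1
    = average e w v y - average e w v x).
  { apply (RInt_minus (V := R_CompleteNormedModule)); now apply ex_RInt_average. }
  rewrite <- E.
  eapply Rle_lt_trans. apply (abs_RInt_le_const _ 0 1 (eps / 2)). lra.
  - apply (ex_RInt_minus (V := R_NormedModule)); now apply ex_RInt_average.
  - intros t Ht. unfold minus, plus, opp; simpl.
    replace (w t * v ((1 - t) * y + t * e) + - (w t * v ((1 - t) * x + t * e))) with
      (w t * (v ((1 - t) * y + t * e) - v ((1 - t) * x + t * e))) by ring.
    rewrite Rabs_mult. replace (eps / 2) with (1 * (eps / 2)) by ring.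
    apply Rmult_le_compat; try apply Rabs_pos. now apply Hw1. left. apply Hd.
    + assert (X1 : Rabs y <= Rabs x + 1).
      { replace y with (x + (y - x)) by ring. eapply Rle_trans. apply Rabs_triang. lra. }
      apply Rabs_le_between in X1. unfold A. nra.
    + assert (X1 := Rle_refl (Rabs x)). apply Rabs_le_between in X1. assert (X0 := Rabs_pos x). unfold A. nra.
    + replace ((1 - t) * y + t * e - ((1 - t) * x + t * e)) with ((1 - t) * (y - x)) by ring.
      rewrite Rabs_mult, (Rabs_pos_eq (1 - t)) by lra. assert (0 <= Rabs (y - x)) by apply Rabs_pos. nra.
  - lra.
Qed.

(** Differentiation under the integral sign; the factor [1 - t] is the derivative
    of the inner affine map, and the new weight is again at most 1. *)
Lemma derives01_average e w v v' x : 0 <= e <= 1 ->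
  (forall t, continuous w t) -> (forall t, 0 <= t <= 1 -> Rabs (w t) <= 1) ->
  (forall x, continuous v x) -> (forall x, continuous v' x) ->
  (forall x, 0 <= x <= 1 -> derives01 v x (v' x)) -> 0 <= x <= 1 ->
  derives01 (average e w v) x (average e (fun t => (1 - t) * w t) v' x).
Proof.
  intros He Hw Hw1 Hv Hv' Hd Hx eps Heps.
  destruct (@Heine_cor2 v' 0 1 (fun z _ => proj2 (continuity_pt_filterlim v' z) (Hv' z)) (mkposreal _ Heps))
    as [d Hu]. simpl in Hu.
  exists d. split. apply cond_pos. intros y HI Hy.
  assert (Hw' : forall t, continuous (fun t => (1 - t) * w t) t).
  { intros t. apply (continuous_mult (fun t => 1 - t) w); trivial.
    apply (continuous_of_derive _ t (-1)). auto_derive; trivial; ring. }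
  assert (X1 := ex_RInt_average e w v y Hw Hv). assert (X2 := ex_RInt_average e w v x Hw Hv).
  assert (X3 := ex_RInt_average e _ v' x Hw' Hv').
  assert (E : RInt (fun t => minus (minus (w t * v ((1 - t) * y + t * e)) (w t * v ((1 - t) * x + t * e)))
     (scal (y - x) ((1 - t) * w t * v' ((1 - t) * x + t * e)))) 0 1
    = average e w v y - average e w v x - average e (fun t => (1 - t) * w t) v' x * (y - x)).
  { rewrite (RInt_minus (V := R_CompleteNormedModule)).
    rewrite (RInt_minus (V := R_CompleteNormedModule)); trivial.
    rewrite (RInt_scal (V := R_CompleteNormedModule)); trivial.
    unfold average, minus, plus, opp, scal; simpl; unfold mult; simpl. ring.
    now apply (ex_RInt_minus (V := R_NormedModule)).
    now apply (ex_RInt_scal (V := R_NormedModule)). }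
  rewrite <- E.
  replace (eps * Rabs (y - x)) with ((1 - 0) * (eps * Rabs (y - x))) by ring.
  apply abs_RInt_le_const. lra.
  - apply (ex_RInt_minus (V := R_NormedModule)).
    now apply (ex_RInt_minus (V := R_NormedModule)). now apply (ex_RInt_scal (V := R_NormedModule)).
  - intros t Ht. unfold minus, plus, opp, scal; simpl; unfold mult; simpl.
    set (a := (1 - t) * x + t * e). set (b := (1 - t) * y + t * e).
    assert (Ha : 0 <= a <= 1) by (unfold a; nra). assert (Hb : 0 <= b <= 1) by (unfold b; nra).
    assert (Hba : b - a = (1 - t) * (y - x)) by (unfold a, b; ring).
    destruct (mean_value01 v v' a b Hv) as (z & Hz & Hza & Ez); trivial.
    { intros s Hs. apply derives01_interior; trivial. apply Hd; lra. }
    assert (R0 := Rabs_pos (y - x)).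
    assert (Hab : Rabs (b - a) <= Rabs (y - x)).
    { rewrite Hba, Rabs_mult, (Rabs_pos_eq (1 - t)) by lra. nra. }
    replace (w t * v b + - (w t * v a) + - ((y - x) * ((1 - t) * w t * v' a))) with
      (w t * ((v b - v a) - v' a * (b - a))) by (rewrite Hba; ring).
    rewrite Ez, <- Rmult_minus_distr_r, !Rabs_mult.
    assert (V : Rabs (v' z - v' a) < eps) by (apply Hu; trivial; lra).
    assert (W := Hw1 t Ht). assert (W0 := Rabs_pos (w t)). assert (V0 := Rabs_pos (v' z - v' a)).
    assert (B0 := Rabs_pos (b - a)).
    assert (Rabs (v' z - v' a) * Rabs (b - a) <= eps * Rabs (y - x)) by (apply Rmult_le_compat; lra).
    assert (0 <= Rabs (v' z - v' a) * Rabs (b - a)) by (now apply Rmult_le_pos). nra.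
Qed.

Lemma Ck_average k e w v : 0 <= e <= 1 ->
  (forall t, continuous w t) -> (forall t, 0 <= t <= 1 -> Rabs (w t) <= 1) ->
  Ck k v -> Ck k (average e w v).
Proof.
  intros He. revert w v. induction k as [|k IH]; intros w v Hw Hw1 Hv;
    (split; [intros x; apply continuous_average; trivial; eapply Ck_continuous; eassumption|trivial]).
  destruct Hv as [Cv (v' & Hd & Hv')].
  exists (average e (fun t => (1 - t) * w t) v'). split.
  - intros x Hx. apply derives01_average; trivial. eapply Ck_continuous; eassumption.
  - apply IH; trivial.
    + intros t. apply (continuous_mult (fun t => 1 - t) w); trivial.
      apply (continuous_of_derive _ t (-1)). auto_derive; trivial; ring.
    + intros t Ht. specialize (Hw1 t Ht). rewrite Rabs_mult, (Rabs_pos_eq (1 - t)) by lra.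
      assert (W0 := Rabs_pos (w t)). nra.
Qed.

(** A derivative operator depending on the values on the unit interval only, so
    that the derivatives obtained for different orders [k] agree. *)
Definition deriv01 (f : R -> R) (x : R) : R := epsilon (inhabits 0) (derives01 f x).

Lemma smooth_of_Ck f : (forall k, Ck k f) ->
  exists V : nat -> R -> R, V 0%nat = f /\ forall k x, 0 <= x <= 1 -> derives01 (V k) x (V (S k) x).
Proof.
  intros Hf. set (V := fix V n := match n with O => f | S n => deriv01 (V n) end).
  assert (Key : forall j k, exists g, Ck k g /\ forall x, 0 <= x <= 1 -> V j x = g x).
  { induction j as [|j IH]; intros k.
    - exists f. split; trivial.
    - destruct (IH (S k)) as (g & [_ (g' & Hg & Hg')] & E). exists g'. split; trivial.
      intros x Hx. simpl. assert (H : derives01 (V j) x (g' x)).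
      { apply (derives01_ext g); auto. intros y Hy. symmetry. now apply E. }
      apply (derives01_unique (V j) x); trivial.
      apply (epsilon_spec (inhabits 0) (derives01 (V j) x)). now exists (g' x). }
  exists V. split; trivial. intros j x Hx.
  destruct (Key j 1%nat) as (g & [_ (g' & Hg & _)] & E).
  apply (epsilon_spec (inhabits 0) (derives01 (V j) x)). exists (g' x).
  apply (derives01_ext g); auto. intros y Hy. symmetry. now apply E.
Qed.

Section Regularity.
Variables (U Q : R -> R).
Let g (x : R) : R := U x * U x * U x + -2 * U x.
Let m (x : R) : R := x * x * g x.
Hypothesis U_cont : forall x, continuous U x.
Hypothesis Q_cont : forall x, continuous Q x.
Hypothesis Q_0 : Q 0 = 0.
Hypothesis Q_1 : Q 1 = 0.
Hypothesis U_der : forall x, 0 < x < 1 -> is_derive U x (Q x / (x ^ 2 * (1 - x ^ 2))).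
Hypothesis Q_der : forall x, 0 < x < 1 -> is_derive Q x (- (x ^ 2 * (U x ^ 3 - 2 * U x))).

Lemma Ck_force k : Ck k U -> Ck k g.
Proof.
  intros H. apply (Ck_plus k (fun x => U x * U x * U x) (fun x => -2 * U x)).
  - apply (Ck_mult k (fun x => U x * U x) U); trivial. now apply Ck_mult.
  - apply (Ck_mult k (fun _ => -2) U); trivial. apply Ck_const.
Qed.

Lemma Ck_source k : Ck k U -> Ck k m.
Proof.
  intros H. apply (Ck_mult k (fun x => x * x) g). apply (Ck_mult k (fun x => x)); apply Ck_id.
  now apply Ck_force.
Qed.

Lemma source_cont x : continuous m x.
Proof. apply (Ck_continuous 0). apply Ck_source. now split. Qed.

Lemma flux_integral x : 0 <= x <= 1 -> Q x = - RInt m 0 x.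
Proof.
  intros Hx.
  set (S := fun x => Q x + RInt m 0 x).
  assert (CS : forall y, continuous S y).
  { intros y. apply (continuous_plus Q (fun y => RInt m 0 y)); trivial. apply continuous_RInt0, source_cont. }
  assert (DS : forall y, 0 < y < 1 -> is_derive S y 0).
  { intros y Hy. replace 0 with (- (y ^ 2 * (U y ^ 3 - 2 * U y)) + m y) by (unfold m, g; ring).
    apply (is_derive_plus Q (fun y => RInt m 0 y)). now apply Q_der. apply is_derive_RInt0, source_cont. }
  destruct (mean_value01 S (fun _ => 0) 0 x CS DS ltac:(lra) Hx) as (z & _ & _ & E).
  unfold S in E. rewrite Q_0, (RInt_point (V := R_CompleteNormedModule)) in E.
  change (@zero R_CompleteNormedModule) with 0 in E. lra.
Qed.

(** Since [Q x = - RInt m 0 x], the partial fractions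
    [1 / (x^2 (1 - x^2)) = 1 / x^2 + 1 / (1 - x^2)] split [U'] into one
    quotient for each end point.  The absolute value avoids the
    pole at -1. *)
Definition slope (x : R) : R :=
  -1 * (x * average 0 (fun t => (1 - t) ^ 2) g x) + average 1 (fun _ => 1) m x * / (1 + Rabs x).

Lemma weight_cont t : continuous (fun t => (1 - t) ^ 2) t.
Proof. apply (continuous_of_derive _ t (- 2 * (1 - t))). auto_derive; trivial. ring. Qed.

Lemma Ck_slope k : Ck k U -> Ck k slope.
Proof.
  intros H. apply (Ck_plus k (fun x => -1 * (x * average 0 (fun t => (1 - t) ^ 2) g x))
    (fun x => average 1 (fun _ => 1) m x * / (1 + Rabs x))).
  - apply (Ck_mult k (fun _ => -1)). apply Ck_const.
    apply (Ck_mult k (fun x => x)). apply Ck_id.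
    apply Ck_average. lra. apply weight_cont.
    + intros t Ht. rewrite Rabs_pos_eq by apply pow2_ge_0. nra.
    + now apply Ck_force.
  - apply (Ck_mult k (average 1 (fun _ => 1) m)); [|apply Ck_inv_succ].
    apply Ck_average. lra. intros; apply continuous_const.
    + intros t Ht. rewrite Rabs_R1. lra.
    + now apply Ck_source.
Qed.

(** Substitution [s = (1 - t) x] at the left end point; at the right end point,
    where [Q 1 = 0], the integral of [m] from [x] to 1 is [Q x]. *)
Lemma slope_formula x : 0 < x < 1 -> Q x / (x ^ 2 * (1 - x ^ 2)) = slope x.
Proof.
  intros Hx. unfold slope.
  assert (EX : forall a b, ex_RInt m a b).
  { intros a b. apply (ex_RInt_continuous (V := R_CompleteNormedModule)). intros; apply source_cont. }
  assert (A0 : x ^ 3 * average 0 (fun t => (1 - t) ^ 2) g x = - Q x).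
  { rewrite flux_integral by lra.
    assert (L := RInt_comp_lin (V := R_CompleteNormedModule) m (- x) x 0 1 (EX _ _)).
    replace (- x * 0 + x) with x in L by ring. replace (- x * 1 + x) with 0 in L by ring.
    assert (W := opp_RInt_swap (V := R_CompleteNormedModule) m 0 x (EX _ _)).
    rewrite <- L in W. unfold opp in W; simpl in W. rewrite W.
    unfold average.
    transitivity (opp (RInt (fun y => scal (- x) (m (- x * y + x))) 0 1)); [|reflexivity].
    rewrite <- (RInt_opp (V := R_CompleteNormedModule)).
    2:{ apply (ex_RInt_continuous (V := R_CompleteNormedModule)). intros t _.
        apply (continuous_scal_r (V := R_NormedModule) (- x)). apply (continuous_comp (fun y => - x * y + x) m).
        apply (continuous_of_derive _ t (- x)). auto_derive; trivial; ring. apply source_cont. }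
    transitivity (scal (x ^ 3) (RInt (fun t => (1 - t) ^ 2 * g ((1 - t) * x + t * 0)) 0 1)).
    reflexivity.
    rewrite <- (RInt_scal (V := R_CompleteNormedModule)).
    2:{ apply ex_RInt_average. apply weight_cont. apply (Ck_continuous 0), Ck_force. now split. }
    apply (RInt_ext (V := R_CompleteNormedModule)). intros t _. unfold opp, scal; simpl; unfold mult; simpl. unfold m.
    replace ((1 - t) * x + t * 0) with (- x * t + x) by ring. ring. }
  assert (A1 : (1 - x) * average 1 (fun _ => 1) m x = Q x).
  { assert (L := RInt_comp_lin (V := R_CompleteNormedModule) m (1 - x) x 0 1 (EX _ _)).
    replace ((1 - x) * 0 + x) with x in L by ring. replace ((1 - x) * 1 + x) with 1 in L by ring.
    assert (C := RInt_Chasles (V := R_CompleteNormedModule) m 0 x 1 (EX _ _) (EX _ _)).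
    unfold plus in C; simpl in C.
    assert (Q1 := flux_integral 1 ltac:(lra)). rewrite Q_1 in Q1.
    assert (Qx := flux_integral x ltac:(lra)).
    transitivity (RInt m x 1); [|lra]. rewrite <- L. unfold average.
    transitivity (scal (1 - x) (RInt (fun t => 1 * m ((1 - t) * x + t * 1)) 0 1)). reflexivity.
    rewrite <- (RInt_scal (V := R_CompleteNormedModule)).
    2:{ apply (ex_RInt_average 1 (fun _ => 1)). intros; apply continuous_const. apply source_cont. }
    apply (RInt_ext (V := R_CompleteNormedModule)). intros t _.
    rewrite Rmult_1_l. do 2 f_equal. ring. }
  rewrite Rabs_pos_eq by lra.
  set (a0 := average 0 (fun t => (1 - t) ^ 2) g x) in *. set (a1 := average 1 (fun _ => 1) m x) in *.
  apply (Rmult_eq_reg_r (x ^ 2 * (1 - x ^ 2))).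
  2:{ apply Rgt_not_eq. apply Rmult_lt_0_compat; nra. }
  transitivity (Q x). field. split; nra.
  transitivity (- (1 - x ^ 2) * (x ^ 3 * a0) + x ^ 2 * ((1 - x) * a1)).
  rewrite A0, A1. ring. field. lra.
Qed.

Lemma slope_derives k : Ck k U -> forall x, 0 <= x <= 1 -> derives01 U x (slope x).
Proof.
  intros H. apply derives01_of_interior; trivial.
  - eapply Ck_continuous, Ck_slope, H.
  - intros x Hx. rewrite <- slope_formula by trivial. now apply U_der.
Qed.

(** If [U] is of class [C^k], so is its derivative [slope], being made of averages
    of polynomials in [x] and [U]. *)
Lemma Ck_all k : Ck k U.
Proof.
  induction k as [|k IH]; split; trivial.
  exists slope. split. now apply (slope_derives k). now apply Ck_slope.
Qed.

(** The equation at every nonzero point, including 1, follows by differentiating the flux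
    [x^2 (1 - x^2) U'] in two ways. *)
Lemma regular_solution : smooth_on unit_interval U /\ solves_profile_ode unit_interval U.
Proof.
  destruct (smooth_of_Ck U Ck_all) as (V & V0 & HV).
  split.
  { exists V. split. intros; now rewrite V0. intros k x Hx. apply derives01_within; auto. }
  exists (V 1%nat), (V 2%nat). split; [|split].
  { intros x Hx. apply derives01_within; trivial. rewrite <- V0. now apply HV. }
  { intros x Hx. apply derives01_within; trivial. now apply HV. }
  assert (V1 : forall x, 0 <= x <= 1 -> V 1%nat x = slope x).
  { intros x Hx. apply (derives01_unique U x); trivial. rewrite <- V0 at 1. now apply HV.
    exact (slope_derives 0 (Ck_all 0) x Hx). }
  assert (HQ : forall x, 0 <= x <= 1 -> Q x = (x ^ 2 * (1 - x ^ 2)) * V 1%nat x).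
  { intros x Hx. destruct (Req_dec x 0) as [->|H0]. rewrite Q_0. ring.
    destruct (Req_dec x 1) as [->|H1]. rewrite Q_1. ring.
    rewrite V1, <- slope_formula by lra. field. split; nra. }
  intros x Hx Hx0.
  assert (D1 : derives01 Q x (- (x ^ 2 * (U x ^ 3 - 2 * U x)))).
  { apply (derives01_of_interior Q (fun x => - (x ^ 2 * (U x ^ 3 - 2 * U x)))); trivial.
    intros y. apply (continuous_ext (fun x => - m x)).
    intros t. unfold m, g. simpl. ring. apply (continuous_opp m), source_cont. }
  assert (D2 : derives01 Q x ((2 * x - 4 * x ^ 3) * V 1%nat x + (x ^ 2 * (1 - x ^ 2)) * V 2%nat x)).
  { apply (derives01_ext (fun x => (x ^ 2 * (1 - x ^ 2)) * V 1%nat x)); trivial.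
    { intros y Hy. symmetry. now apply HQ. }
    apply (derives01_mult (fun x => x ^ 2 * (1 - x ^ 2)) (V 1%nat)); auto.
    apply derives01_of_is_derive. auto_derive; trivial. ring. }
  assert (E := derives01_unique _ _ _ _ Hx D1 D2).
  apply (Rmult_eq_reg_l (x ^ 2)); [|apply Rgt_not_eq; nra].
  replace (x ^ 2 * ((1 - x ^ 2) * V 2%nat x + (2 / x - 4 * x) * V 1%nat x - 2 * U x + U x ^ 3)) with
    (((2 * x - 4 * x ^ 3) * V 1%nat x + (x ^ 2 * (1 - x ^ 2)) * V 2%nat x)
      - (- (x ^ 2 * (U x ^ 3 - 2 * U x)))) by (field; trivial).
  rewrite <- E. ring.
Qed.
End Regularity.

(** * Return to the light cone *)

Definition glue (a b : R) (v : R -> R) (x : R) : R :=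
  if Rle_dec x 0 then a else if Rlt_dec x 1 then v x else b.

Lemma glue_interior a b v x : 0 < x < 1 -> glue a b v x = v x.
Proof. intros H. unfold glue. destruct (Rle_dec x 0); [lra|]. destruct (Rlt_dec x 1); [trivial|lra]. Qed.
Lemma glue_left a b v x : x <= 0 -> glue a b v x = a.
Proof. intros H. unfold glue. destruct (Rle_dec x 0); [trivial|lra]. Qed.
Lemma glue_right a b v x : 1 <= x -> glue a b v x = b.
Proof. intros H. unfold glue. destruct (Rle_dec x 0); [lra|]. destruct (Rlt_dec x 1); [lra|trivial]. Qed.

Lemma locally_interior (x : R) (Pr : R -> Prop) : 0 < x < 1 ->
  (forall y, 0 < y < 1 -> Pr y) -> locally x Pr.
Proof.
  intros Hx H.
  assert (E0 : 0 < Rmin x (1 - x)) by (apply Rmin_pos; lra).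
  exists (mkposreal _ E0). intros y Hy. apply H.
  assert (Hb : Rabs (y - x) < Rmin x (1 - x)) by exact Hy.
  assert (E1 := Rmin_l x (1 - x)). assert (E2 := Rmin_r x (1 - x)).
  apply Rabs_lt_between in Hb. lra.
Qed.

Lemma is_derive_glue a b v x l : 0 < x < 1 -> is_derive v x l -> is_derive (glue a b v) x l.
Proof.
  intros Hx H. apply (is_derive_ext_loc v); trivial.
  apply locally_interior; trivial. intros y Hy. symmetry. now apply glue_interior.
Qed.

Lemma continuous_glue a b v :
  (forall x, 0 < x < 1 -> continuous v x) ->
  (forall eps, 0 < eps -> exists d, 0 < d /\ forall x, 0 < x < 1 -> x < d -> Rabs (v x - a) < eps) ->
  (forall eps, 0 < eps -> exists d, 0 < d /\ forall x, 0 < x < 1 -> 1 - x < d -> Rabs (v x - b) < eps) ->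
  forall x, continuous (glue a b v) x.
Proof.
  intros Hv Ha Hb x. apply continuous_eps. intros eps He.
  destruct (Rle_lt_dec x 0) as [[Hx|Hx]|Hx].
  - exists (- x). split. lra. intros y Hy. apply Rabs_lt_between in Hy.
    rewrite !glue_left, Rminus_diag, Rabs_R0; lra.
  - subst x. destruct (Ha eps He) as [d [Hd H]]. exists (Rmin d 1). split. apply Rmin_pos; lra.
    intros y Hy. assert (Y1 := Rlt_le_trans _ _ _ Hy (Rmin_l _ _)).
    assert (Y2 := Rlt_le_trans _ _ _ Hy (Rmin_r _ _)).
    apply Rabs_lt_between in Y1. apply Rabs_lt_between in Y2.
    rewrite (glue_left _ _ _ 0) by lra. destruct (Rle_lt_dec y 0).
    + rewrite glue_left, Rminus_diag, Rabs_R0; lra.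
    + rewrite glue_interior by lra. apply H; lra.
  - destruct (Rlt_le_dec x 1) as [H1|[H1|H1]].
    + assert (C : continuous (glue a b v) x).
      { apply (continuous_ext_loc _ v).
        - apply locally_interior; [lra|]. intros y Hy. symmetry. now apply glue_interior.
        - apply Hv. lra. }
      exact (proj1 (continuous_eps _ _) C eps He).
    + exists (x - 1). split. lra. intros y Hy. apply Rabs_lt_between in Hy.
      rewrite !glue_right, Rminus_diag, Rabs_R0; lra.
    + subst x. destruct (Hb eps He) as [d [Hd H]]. exists (Rmin d 1). split. apply Rmin_pos; lra.
      intros y Hy. assert (Y1 := Rlt_le_trans _ _ _ Hy (Rmin_l _ _)).
      assert (Y2 := Rlt_le_trans _ _ _ Hy (Rmin_r _ _)).
      apply Rabs_lt_between in Y1. apply Rabs_lt_between in Y2.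
      rewrite (glue_right _ _ _ 1) by lra. destruct (Rlt_le_dec y 1).
      * rewrite glue_interior by lra. apply H; lra.
      * rewrite glue_right, Rminus_diag, Rabs_R0; lra.
Qed.

Definition artanh (x : R) : R := / 2 * ln ((1 + x) / (1 - x)).

Lemma artanh_arg_pos x : -1 < x < 1 -> 0 < (1 + x) / (1 - x).
Proof. intros H. apply Rdiv_lt_0_compat; lra. Qed.

Lemma is_derive_artanh x : -1 < x < 1 -> is_derive artanh x (/ (1 - x ^ 2)).
Proof.
  intros H. unfold artanh. auto_derive.
  - split. lra. split; trivial. apply (artanh_arg_pos x H).
  - field. nra.
Qed.

Lemma artanh_0 : artanh 0 = 0.
Proof. unfold artanh. replace ((1 + 0) / (1 - 0)) with 1 by field. rewrite ln_1. ring. Qed.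

Lemma artanh_pos x : 0 < x < 1 -> 0 < artanh x.
Proof.
  intros H. unfold artanh. rewrite <- (Rmult_0_r (/ 2)). apply Rmult_lt_compat_l. lra.
  rewrite <- ln_1. apply ln_increasing. lra.
  apply (Rmult_lt_reg_r (1 - x)). lra. unfold Rdiv. rewrite Rmult_assoc, Rinv_l by lra. lra.
Qed.

Lemma artanh_large X : exists d, 0 < d /\ forall x, 0 < x < 1 -> 1 - x < d -> X <= artanh x.
Proof.
  exists (exp (- (2 * X))). split. apply exp_pos. intros x Hx Hd. unfold artanh.
  cut (2 * X <= ln ((1 + x) / (1 - x))); [lra|].
  rewrite <- (ln_exp (2 * X)). apply Rlt_le, ln_increasing. apply exp_pos.
  rewrite exp_Ropp in Hd. assert (P := exp_pos (2 * X)). set (E := exp (2 * X)) in *.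
  apply (Rmult_lt_reg_r (1 - x)). lra. unfold Rdiv. rewrite Rmult_assoc, Rinv_l, Rmult_1_r by lra.
  apply (Rmult_lt_compat_l E) in Hd; trivial. rewrite Rinv_r in Hd by lra. lra.
Qed.

Lemma exp_2artanh x : -1 < x < 1 -> exp (2 * artanh x) = (1 + x) / (1 - x).
Proof.
  intros H. unfold artanh. rewrite <- Rmult_assoc, Rinv_r, Rmult_1_l by lra.
  apply exp_ln. now apply artanh_arg_pos.
Qed.

Lemma csch2_artanh x : 0 < x < 1 -> csch2 (artanh x) = (1 - x ^ 2) / x ^ 2.
Proof.
  intros Hx. unfold csch2.
  assert (E := exp_2artanh x ltac:(lra)).
  assert (S : sinh (artanh x) ^ 2 = (exp (2 * artanh x) - 2 + / exp (2 * artanh x)) / 4).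
  { unfold sinh. rewrite exp_Ropp. replace (2 * artanh x) with (artanh x + artanh x) by ring.
    rewrite exp_plus. assert (P := exp_pos (artanh x)). field. lra. }
  rewrite S, E. field. repeat split; nra.
Qed.

Lemma tanh_exp x : tanh x = (exp (2 * x) - 1) / (exp (2 * x) + 1).
Proof.
  unfold tanh, sinh, cosh. rewrite exp_Ropp. replace (2 * x) with (x + x) by ring.
  rewrite exp_plus. assert (P := exp_pos x). field. repeat split; nra.
Qed.

Lemma tanh_range x : 0 < x -> 0 < tanh x < 1.
Proof.
  intros H. rewrite tanh_exp. assert (E : 1 < exp (2 * x)).
  { rewrite <- exp_0. apply exp_increasing. lra. }
  split. apply Rdiv_lt_0_compat; lra.
  apply (Rmult_lt_reg_r (exp (2 * x) + 1)). lra. unfold Rdiv. rewrite Rmult_assoc, Rinv_l by lra. lra.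
Qed.

Lemma artanh_tanh x : artanh (tanh x) = x.
Proof.
  unfold artanh. rewrite tanh_exp. assert (P := exp_pos (2 * x)).
  replace ((1 + (exp (2 * x) - 1) / (exp (2 * x) + 1)) / (1 - (exp (2 * x) - 1) / (exp (2 * x) + 1)))
    with (exp (2 * x)) by (field; lra).
  rewrite ln_exp. field.
Qed.

Lemma tanh_artanh x : -1 < x < 1 -> tanh (artanh x) = x.
Proof. intros H. rewrite tanh_exp, exp_2artanh by trivial. field. lra. Qed.

Section Cone.
Variables (c b : R) (f p nu : R -> R).
Hypothesis sol : profile c f p nu.
Hypothesis p_lim : forall eps, 0 < eps -> exists X, 0 < X /\ forall x, X <= x -> Rabs (p x) < eps.
Hypothesis f_lim : forall eps, 0 < eps -> exists X, 0 < X /\ forall x, X <= x -> Rabs (f x - b) < eps.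

Definition cone_profile : R -> R := glue c b (fun x => f (artanh x) / x).
(** The flux [rho^2 (1 - rho^2) U'], expressed through [f] and [p]. *)
Definition cone_flux : R -> R := glue 0 0 (fun x => x * p (artanh x) - (1 - x ^ 2) * f (artanh x)).

Lemma is_derive_f_artanh x : -1 < x < 1 ->
  is_derive (fun x => f (artanh x)) x (/ (1 - x ^ 2) * p (artanh x)).
Proof.
  intros H. apply (is_derive_comp f artanh). apply (profile_df _ _ _ _ sol). now apply is_derive_artanh.
Qed.

Lemma is_derive_p_artanh x : -1 < x < 1 ->
  is_derive (fun x => p (artanh x)) x (/ (1 - x ^ 2) * - nu (artanh x)).
Proof.
  intros H. apply (is_derive_comp p artanh). apply (profile_dp _ _ _ _ sol). now apply is_derive_artanh.
Qed.

Lemma is_derive_quotient x : 0 < x < 1 ->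
  is_derive (fun x => f (artanh x) / x) x
    ((x * p (artanh x) - (1 - x ^ 2) * f (artanh x)) / (x ^ 2 * (1 - x ^ 2))).
Proof.
  intros Hx. assert (D := is_derive_f_artanh x ltac:(lra)).
  replace ((x * p (artanh x) - (1 - x ^ 2) * f (artanh x)) / (x ^ 2 * (1 - x ^ 2)))
    with ((/ (1 - x ^ 2) * p (artanh x) * x - f (artanh x) * 1) / x ^ 2) by (field; split; nra).
  apply (is_derive_div (fun x => f (artanh x)) (fun x => x)); trivial.
  apply (is_derive_id x). lra.
Qed.

Lemma is_derive_flux x : -1 < x < 1 ->
  is_derive (fun x => x * p (artanh x) - (1 - x ^ 2) * f (artanh x)) x
    (2 * x * f (artanh x) - x * / (1 - x ^ 2) * nu (artanh x)).
Proof.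
  intros Hx. assert (D := is_derive_f_artanh x Hx). assert (E := is_derive_p_artanh x Hx).
  replace (2 * x * f (artanh x) - x * / (1 - x ^ 2) * nu (artanh x)) with
    ((1 * p (artanh x) + x * (/ (1 - x ^ 2) * - nu (artanh x))) -
     ((- (2 * x)) * f (artanh x) + (1 - x ^ 2) * (/ (1 - x ^ 2) * p (artanh x)))) by (field; nra).
  apply (is_derive_minus (fun x => x * p (artanh x)) (fun x => (1 - x ^ 2) * f (artanh x))).
  - apply (is_derive_mult (fun x => x) (fun x => p (artanh x))); trivial.
    apply (is_derive_id x). intros; apply Rmult_comm.
  - apply (is_derive_mult (fun x => 1 - x ^ 2) (fun x => f (artanh x))); trivial.
    auto_derive; trivial; ring. intros; apply Rmult_comm.
Qed.

Lemma cone_profile_continuous x : continuous cone_profile x.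
Proof.
  apply continuous_glue; clear x.
  - intros x Hx. exact (continuous_of_derive _ _ _ (is_derive_quotient x Hx)).
  - intros eps He.
    assert (D := is_derive_f_artanh 0 ltac:(lra)).
    apply derives01_of_is_derive in D. destruct (D (eps / 2) ltac:(lra)) as [d [Hd H]].
    exists d. split; trivial. intros x Hx Hxd. specialize (H x ltac:(lra)).
    rewrite artanh_0, (profile_0 _ _ _ _ sol), (profile_p0 _ _ _ _ sol), !Rminus_0_r, (Rabs_pos_eq x) in H by lra.
    specialize (H Hxd). replace (/ (1 - 0 ^ 2) * c * x) with (c * x) in H by (field; lra).
    replace (f (artanh x) / x - c) with ((f (artanh x) - c * x) * / x) by (field; lra).
    assert (Hi : 0 < / x) by (apply Rinv_0_lt_compat; lra).
    rewrite Rabs_mult, (Rabs_pos_eq (/ x)) by lra.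
    apply Rle_lt_trans with (eps / 2 * x * / x). apply Rmult_le_compat_r; lra.
    rewrite Rmult_assoc, Rinv_r by lra. lra.
  - intros eps He. destruct (f_lim (eps / 4) ltac:(lra)) as [X [HX HfX]].
    destruct (artanh_large X) as [d [Hd HA]].
    assert (B0 := Rabs_pos b).
    set (e := eps / (4 * (Rabs b + 1))).
    assert (E0 : 0 < e) by (apply Rdiv_lt_0_compat; lra).
    assert (E1 : e * (Rabs b + 1) = eps / 4) by (unfold e; field; lra).
    exists (Rmin d (Rmin (/ 2) e)). split. { repeat apply Rmin_pos; lra. }
    intros x Hx Hxd.
    assert (Y1 := Rlt_le_trans _ _ _ Hxd (Rmin_l _ _)).
    assert (Y := Rlt_le_trans _ _ _ Hxd (Rmin_r _ _)).
    assert (Y2 := Rlt_le_trans _ _ _ Y (Rmin_l _ _)). assert (Y3 := Rlt_le_trans _ _ _ Y (Rmin_r _ _)).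
    specialize (HfX _ (HA x Hx Y1)).
    replace (f (artanh x) / x - b) with (((f (artanh x) - b) + b * (1 - x)) * / x) by (field; lra).
    assert (I : 0 < / x) by (apply Rinv_0_lt_compat; lra).
    assert (I2 : / x <= 2). { rewrite <- (Rinv_inv 2). apply Rinv_le_contravar; lra. }
    rewrite Rabs_mult, (Rabs_pos_eq (/ x)) by lra.
    assert (T := Rabs_triang (f (artanh x) - b) (b * (1 - x))).
    rewrite (Rabs_mult b), (Rabs_pos_eq (1 - x)) in T by lra.
    assert (Rabs b * (1 - x) <= eps / 4) by nra.
    assert (Z := Rabs_pos (f (artanh x) - b + b * (1 - x))).
    apply Rle_lt_trans with (Rabs (f (artanh x) - b + b * (1 - x)) * 2).
    apply Rmult_le_compat_l; lra. lra.
Qed.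

(** The value 0 at the right end point is where the vanishing of the slope at
    infinity enters. *)
Lemma cone_flux_continuous x : continuous cone_flux x.
Proof.
  apply continuous_glue; clear x.
  - intros x Hx. refine (continuous_of_derive _ _ _ (is_derive_flux x _)). lra.
  - intros eps He.
    assert (C := continuous_of_derive _ _ _ (is_derive_flux 0 ltac:(lra))).
    destruct (proj1 (continuous_eps _ _) C eps He) as [d [Hd H]].
    exists d. split; trivial. intros x Hx Hxd. specialize (H x).
    rewrite artanh_0, (profile_0 _ _ _ _ sol), !Rminus_0_r, Rmult_0_l, Rmult_0_r, Rminus_0_r, (Rabs_pos_eq x) in H by lra.
    now apply H.
  - intros eps He. destruct (f_lim 1 ltac:(lra)) as [X1 [HX1 HfX]].
    destruct (p_lim (eps / 2) ltac:(lra)) as [X2 [HX2 HpX]].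
    destruct (artanh_large (Rmax X1 X2)) as [d [Hd HA]].
    assert (B0 := Rabs_pos b).
    set (e := eps / (4 * (Rabs b + 1))).
    assert (E0 : 0 < e) by (apply Rdiv_lt_0_compat; lra).
    assert (E1 : e * (Rabs b + 1) = eps / 4) by (unfold e; field; lra).
    exists (Rmin d e). split. { apply Rmin_pos; lra. }
    intros x Hx Hxd.
    assert (Y1 := Rlt_le_trans _ _ _ Hxd (Rmin_l _ _)).
    assert (Y2 := Rlt_le_trans _ _ _ Hxd (Rmin_r _ _)).
    specialize (HA x Hx Y1).
    specialize (HfX _ (Rle_trans _ _ _ (Rmax_l _ _) HA)). specialize (HpX _ (Rle_trans _ _ _ (Rmax_r _ _) HA)).
    rewrite Rminus_0_r. set (F := f (artanh x)) in *. set (P := p (artanh x)) in *.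
    assert (FB : Rabs F <= Rabs b + 1).
    { replace F with (F - b + b) by ring. eapply Rle_trans. apply Rabs_triang. lra. }
    unfold Rminus at 1. eapply Rle_lt_trans. apply Rabs_triang.
    rewrite Rabs_Ropp, !Rabs_mult, (Rabs_pos_eq x), (Rabs_pos_eq (1 - x ^ 2)) by nra.
    assert (P0 := Rabs_pos P). assert (F0 := Rabs_pos F).
    assert ((1 - x ^ 2) * Rabs F <= 2 * e * (Rabs b + 1)) by (apply Rmult_le_compat; nra).
    nra.
Qed.

Lemma cone_solution :
  smooth_on unit_interval cone_profile /\ solves_profile_ode unit_interval cone_profile.
Proof.
  apply (regular_solution cone_profile cone_flux).
  - apply cone_profile_continuous.
  - apply cone_flux_continuous.
  - apply glue_left. lra.
  - apply glue_right. lra.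
  - intros x Hx. apply is_derive_glue; trivial. unfold cone_flux. rewrite glue_interior by trivial.
    now apply is_derive_quotient.
  - intros x Hx. apply is_derive_glue; trivial. unfold cone_profile. rewrite glue_interior by trivial.
    replace (- (x ^ 2 * ((f (artanh x) / x) ^ 3 - 2 * (f (artanh x) / x)))) with
      (2 * x * f (artanh x) - x * / (1 - x ^ 2) * nu (artanh x)).
    apply is_derive_flux. lra.
    assert (A := artanh_pos x Hx).
    rewrite (profile_n _ _ _ _ sol), csch2_artanh by lra. field. split; nra.
Qed.

Lemma cone_nodal (n : nat) (zeros : list R) :
  NoDup zeros -> length zeros = n -> (forall x, In x zeros <-> 0 < x /\ f x = 0) ->
  nodal_class n cone_profile.
Proof.
  intros ND Len Hz. exists (map tanh zeros). split; [|split].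
  - apply NoDup_map_NoDup_ForallPairs; trivial. intros x y _ _ E.
    rewrite <- (artanh_tanh x), <- (artanh_tanh y). now f_equal.
  - now rewrite length_map.
  - intros rho. rewrite in_map_iff. split.
    + intros [x [<- Hx]]. apply Hz in Hx. destruct Hx as [Hx Fx].
      assert (R := tanh_range x Hx). split; trivial.
      unfold cone_profile. rewrite glue_interior, artanh_tanh, Fx by trivial. unfold Rdiv; ring.
    + intros [Hr Ur]. exists (artanh rho). split. apply tanh_artanh; lra.
      apply Hz. split. now apply artanh_pos.
      unfold cone_profile in Ur. rewrite glue_interior in Ur by trivial.
      apply (Rmult_eq_reg_r (/ rho)). rewrite Rmult_0_l. exact Ur.
      apply Rinv_neq_0_compat. lra.
Qed.
End Cone.

Theorem mainTheorem1 (n : nat) (hn : (0 < n)%nat) :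
  exists (c b : R) (U : R -> R),
    smooth_on (fun rho => 0 <= rho <= 1) U /\
    solves_profile_ode (fun rho => 0 <= rho <= 1) U /\
    U 0 = c /\ U 1 = b /\
    nodal_class n U.
Proof.
  destruct (critical_profile n hn) as (c & f & p & nu & Hc & sol & Hit & Miss & Trap).
  destruct (value_converges n c f p nu Hc sol Hit Miss Trap) as [b Hb].
  destruct (critical_zeros n c f p nu Hc sol Hit Miss) as (zeros & ND & Len & Hz).
  assert (Hp := slope_vanishes n c f p nu Hc sol Hit Miss Trap).
  destruct (cone_solution c b f p nu sol Hp Hb) as [Smooth Ode].
  exists c, b, (cone_profile c b f).
  split; [exact Smooth|]. split; [exact Ode|]. split; [|split].
  - apply glue_left. lra.
  - apply glue_right. lra.
  - exact (cone_nodal c b f n zeros ND Len Hz).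
Qed.
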